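(* Let $F$ be a finite graph, let $H\subset F$ be a subgraph, and let $X$ be the mapping torus of a cellular immersion $\psi:H\rightarrow F$. Suppose that $\psi^{-1}(H)$ is homeomorphic to a forest. Then $X$ has negative immersions.
   Context: Graphs are $1$-dimensional CW-complexes. A forest is a disjoint union of trees; the empty graph counts as a forest. A map of CW-complexes is cellular if it sends the $k$-skeleton into the $k$-skeleton for all $k$; it is combinatorial if it maps open cells homeomorphically onto open cells; it is an immersion if it is locally injective. In particular a cellular immersion of graphs sends vertices to vertices and edges to (nondegenerate) edge paths without backtracking. The set $\psi^{-1}(H)=\{x\in H:\psi(x)\in H\}$ is regarded as a subspace of $H$; it need not be a subgraph. Mapping torus: for a subgraph $H\subset F$ and a map $\psi:H\to F$, the mapping torus is the $2$-complex $X=(F\sqcup (H\times[0,1]))/\{(x,0)\sim x,\ (x,1)\sim\psi(x): x\in H\}$. Its cells are the vertices and edges of $F$ (vertical edges), one additional (horizontal) edge for each vertex of $H$, and one $2$-cell for each edge of $H$. Negative immersions: a complex is collapsed if it has no free faces; an edge is isolated if it is not a face of a $2$-cell. A $2$-complex $X$ has negative immersions if there is a constant $c>0$ such that for every combinatorial immersion $Y\to X$ with $Y$ compact, connected, collapsed and with no isolated edges, either $\pi_1Y$ is trivial or $\chi(Y)\le -c|Y|_2$, where $|Y|_2$ is the number of $2$-cells of $Y$ and $\chi$ is the Euler characteristic. *)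

(* Defs.v *)
From HB Require Import structures.
From Stdlib Require Import Relations.
From mathcomp Require Import all_boot all_order all_algebra finmap.
From mathcomp Require Import all_classical all_reals topology normedtype.

Set Implicit Arguments.
Unset Strict Implicit.
Unset Printing Implicit Defensive.

Import Order.TTheory GRing.Theory Num.Theory.
Import numFieldTopology.Exports numFieldNormedType.Exports.

Local Open Scope classical_set_scope.
Local Open Scope ring_scope.

Section Topology.
Context {S T : topologicalType}.

(* Partial maps [A -> T] with [A] a subspace of [S] are total functions whose
   values outside [A] are irrelevant. *)

Definition locally_injective (A : set S) (f : S -> T) : Prop :=
  forall x, A x -> exists2 U, nbhs x U & set_inj (A `&` U) f.

Definition immersion (A : set S) (f : S -> T) : Prop :=
  {within A, continuous f} /\ locally_injective A f.

Definition homeomorphic_onto (A : set S) (B : set T) (f : S -> T) : Prop :=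
  [/\ set_bij A B f, {within A, continuous f} &
      exists2 g : T -> S, {within B, continuous g} &
                          forall x, A x -> g (f x) = x].

Definition homeomorphic : Prop :=
  exists (f : S -> T) (g : T -> S),
    [/\ continuous f, continuous g, cancel f g & cancel g f].

End Topology.
Arguments homeomorphic : clear implicits.

(** * CW-complexes *)

Section Cube.
Context {R : realType}.

(* The model of the closed n-ball is the n-cube. *)
Definition cube (n : nat) : set 'rV[R]_n :=
  [set u | forall i, 0 <= u ord0 i <= 1].

Definition open_cube (n : nat) : set 'rV[R]_n :=
  [set u | forall i, 0 < u ord0 i < 1].

Definition cube_boundary (n : nat) : set 'rV[R]_n :=
  @cube n `\` @open_cube n.

End Cube.
Arguments cube : clear implicits.
Arguments open_cube : clear implicits.
Arguments cube_boundary : clear implicits.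

(* Only the values of [cmap c] on the cube are meaningful. *)
Record cell_structure (R : realType) (T : topologicalType) := CellStructure {
  cell : choiceType;
  dim : cell -> nat;
  cmap : forall c : cell, 'rV[R]_(dim c) -> T
}.
Arguments cmap {R T} _ _ _.

Section CW.
Context {R : realType} {T : topologicalType} (S : cell_structure R T).

Definition closed_cell (c : cell S) : set T := cmap S c @` cube R (dim c).
Definition open_cell (c : cell S) : set T := cmap S c @` open_cube R (dim c).

Record is_cw_complex : Prop := IsCWComplex {
  cw_hausdorff : hausdorff_space T;
  cw_continuous : forall c, {within cube R (dim c), continuous (cmap S c)};
  cw_injective : forall c, set_inj (open_cube R (dim c)) (cmap S c);
  cw_disjoint : trivIset [set: cell S] open_cell;
  cw_cover : \bigcup_(c in [set: cell S]) open_cell c = [set: T];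
  cw_closure_finite : forall c, exists B : set (cell S),
    [/\ finite_set B, (forall d, B d -> dim d < dim c)%N &
        cmap S c @` cube_boundary R (dim c) `<=` \bigcup_(d in B) open_cell d];
  cw_weak_topology : forall A : set T,
    (forall c, closed (cube R (dim c) `&` cmap S c @^-1` A)) -> closed A
}.

Definition is_complex_of_dim_le (n : nat) : Prop :=
  is_cw_complex /\ forall c : cell S, (dim c <= n)%N.

Definition is_graph : Prop := is_complex_of_dim_le 1.
Definition is_2_complex : Prop := is_complex_of_dim_le 2.

Definition is_finite_complex : Prop := finite_set [set: cell S].

Definition skeleton (n : nat) : set T :=
  \bigcup_(c in [set c : cell S | (dim c <= n)%N]) open_cell c.

(* A subcomplex (for a graph: a subgraph) is given by its set of cells. *)
Definition is_subcomplex (H : set (cell S)) : Prop :=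
  forall c, H c -> closed_cell c `<=` \bigcup_(d in H) open_cell d.

Definition space_of (H : set (cell S)) : set T := \bigcup_(c in H) open_cell c.

Definition ncells (n : nat) : nat := #|` fset_set [set c : cell S | dim c = n]|.

(* Euler characteristic of a finite complex of dimension at most 2. *)
Definition euler : int := (ncells 0)%:Z - (ncells 1)%:Z + (ncells 2)%:Z.

Definition is_face (c d : cell S) : Prop :=
  (dim c < dim d)%N /\ open_cell c `<=` closed_cell d.

(* [c] is a face of [d] only, and the attaching map of [d] passes over [c]
   exactly once: the preimage of the open cell [c] under the characteristic map
   of [d] has one connected component for each passage. *)
Definition is_free_face (c d : cell S) : Prop :=
  [/\ is_face c d, dim d = (dim c).+1,
      (forall d', is_face c d' -> d' = d) &
      connected (cube R (dim d) `&` cmap S d @^-1` open_cell c)].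

Definition collapsed : Prop := forall c d, ~ is_free_face c d.

Definition isolated_edge (e : cell S) : Prop :=
  dim e = 1%N /\ forall d, dim d = 2%N -> ~ is_face e d.

(* A disjoint union of trees, i.e. a graph without embedded circles. *)
Definition is_forest : Prop :=
  is_graph /\
  ~ exists g : R -> T,
      [/\ {within `[0, 1], continuous g}, g 0 = g 1 & set_inj `[0, 1[ g].

End CW.

(* The map [f] is only considered on the subcomplex [space_of H]. *)
Definition cellular_on (R : realType) (T T' : topologicalType)
    (S : cell_structure R T) (S' : cell_structure R T') (H : set (cell S))
    (f : T -> T') : Prop :=
  forall n, f @` (space_of H `&` skeleton S n) `<=` skeleton S' n.
Arguments cellular_on {R T T'} S S' H f.

(* By invariance of domain, a homeomorphism between open cells preserves the
   dimension. *)
Definition combinatorial (R : realType) (T T' : topologicalType)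
    (S : cell_structure R T) (S' : cell_structure R T') (f : T -> T') : Prop :=
  continuous f /\
  forall c : cell S, exists2 d : cell S', dim d = dim c &
    homeomorphic_onto (open_cell c) (open_cell d) f.

Definition trivial_pi1 (R : realType) (T : topologicalType) : Prop :=
  forall g : R -> T, {within `[0, 1], continuous g} -> g 0 = g 1 ->
  exists h : R * R -> T,
    [/\ {within `[0, 1] `*` `[0, 1], continuous h},
        forall s, s \in `[0, 1] -> h (s, 0) = g s /\ h (s, 1) = g 0 &
        forall t, t \in `[0, 1] -> h (0, t) = g 0 /\ h (1, t) = g 0].

Definition negative_immersions (R : realType) (X : topologicalType)
    (SX : cell_structure R X) : Prop :=
  exists2 c : R, 0 < c &
  forall (Y : topologicalType) (SY : cell_structure R Y) (f : Y -> X),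
    is_2_complex SY -> combinatorial SY SX f -> immersion [set: Y] f ->
    compact [set: Y] -> connected [set: Y] ->
    collapsed SY -> (forall e : cell SY, ~ isolated_edge e) ->
    trivial_pi1 R Y \/ (euler SY)%:~R <= - c * (ncells SY 2)%:R.

(** * Mapping tori *)

Section MappingTorus.
Context {R : realType} {F : topologicalType} (H : set F) (psi : F -> F).

Definition cylinder : set (F * R) := H `*` `[0, 1].

Definition mt_summand (b : bool) : topologicalType :=
  if b then (set_type cylinder : topologicalType) else F.

(* The disjoint union of F and H x [0, 1]. *)
Definition mt_sum : topologicalType := {b : bool & mt_summand b}.

Definition in_base (x : F) : mt_sum := existT mt_summand false x.
Definition in_cyl (p : set_type cylinder) : mt_sum := existT mt_summand true p.

Inductive mt_glue : mt_sum -> mt_sum -> Prop :=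
| mt_glue0 p : (set_val p).2 = 0 -> mt_glue (in_cyl p) (in_base (set_val p).1)
| mt_glue1 p :
    (set_val p).2 = 1 -> mt_glue (in_cyl p) (in_base (psi (set_val p).1)).

Definition mt_rel (a b : mt_sum) : bool :=
  `[< clos_refl_sym_trans mt_sum mt_glue a b >].

Lemma mt_rel_refl : reflexive mt_rel.
Proof. by move=> a; apply/asboolP; exact: rst_refl. Qed.

Lemma mt_rel_sym : symmetric mt_rel.
Proof. by move=> a b; apply/asboolP/asboolP; exact: rst_sym. Qed.

Lemma mt_rel_trans : transitive mt_rel.
Proof.
by move=> b a c /asboolP ab /asboolP bc; apply/asboolP; exact: rst_trans bc.
Qed.

Canonical mt_equiv := EquivRel mt_rel mt_rel_refl mt_rel_sym mt_rel_trans.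

Definition mapping_torus : topologicalType :=
  quotient_topology {eq_quot mt_equiv}%qT.

Definition mt_proj (a : mt_sum) : mapping_torus :=
  (\pi_(quotient_topology {eq_quot mt_equiv}) a)%qT.

Definition mt_base (x : F) : mapping_torus := mt_proj (in_base x).

(* The class of (x, t) for x in H and t in [0, 1], a dummy value otherwise. *)
Definition mt_cyl (x : F) (t : R) : mapping_torus :=
  mt_proj (oapp in_cyl (in_base x) (insub (x, t))).

End MappingTorus.

Section MappingTorusCells.
Context {R : realType} {F : topologicalType} (S : cell_structure R F).
Variables (H : set (cell S)) (psi : F -> F).

Definition mt_space : topologicalType := @mapping_torus R F (space_of H) psi.

(* The cells of F, and a cell c x (0, 1) for each cell c of H. *)
Definition mt_cell : choiceType := (cell S + set_type H)%type.

Definition mt_dim (c : mt_cell) : nat :=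
  match c with inl c => dim c | inr c => (dim (set_val c)).+1 end.

(* In c x (0, 1), the first coordinate is the one of the interval. *)
Definition mt_cmap (c : mt_cell) : 'rV[R]_(mt_dim c) -> mt_space :=
  match c return 'rV[R]_(mt_dim c) -> mt_space with
  | inl c => fun u => mt_base (space_of H) psi (cmap S c u)
  | inr c => fun u =>
      mt_cyl (space_of H) psi (cmap S (set_val c) (col' ord0 u)) (u ord0 ord0)
  end.

Definition mapping_torus_cells : cell_structure R mt_space :=
  CellStructure mt_cmap.

End MappingTorusCells.

(* Main.v *)
Require Import Defs.
From HB Require Import structures.
From Stdlib Require Import Relations.
From mathcomp Require Import all_boot all_order all_algebra finmap.
From mathcomp Require Import all_classical all_reals topology normedtype derive.
From mathcomp Require Import ring lra.
Import Defs.

(* An immersion Y -> X makes Y the mapping torus of a partial immersion of a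
   finite graph Gamma, the preimage of F, defined on a subgraph Delta: the
   horizontal cells of Y correspond to the cells of Delta through their lower
   ends.  Hence chi(Y) = V' - A', where V' and A' count the vertices and edges of
   Gamma outside Delta.  Collapsedness and the absence of isolated edges give
   every vertex of Gamma outside Delta degree at least 2, so that - 2 chi(Y) is
   at least the number b of ends, at vertices of Delta, of edges outside Delta.
   Subdivide H so that psi becomes combinatorial.  The part D of the subdivided
   Delta which is mapped into Delta immerses in the forest psi^-1(H), so reduced
   walks in D have bounded length and are determined, up to boundedly many
   choices, by their final dart.  Every 2-cell has its lower edge crossed by
   such a walk, and the walk leaves D through one of the b ends; therefore the
   number of 2-cells is at most a constant multiple of b. *)

Set Implicit Arguments.
Unset Strict Implicit.
Unset Printing Implicit Defensive.

(** * A counting inequality *)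

(** No walk is ever enumerated and no subdivision is built as a complex. A segment is an edge of [H]
    with two consecutive times at which [psi] meets a vertex, and acyclicity of the reduced-step
    relation on darts gives a rank; weights exponential in the rank stand in for the bounded number
    of walks. The rank lives on the darts of [H], which do not depend on [Y], so one constant serves
    every immersion. The main obstacle is that the characteristic maps of [Y] are arbitrary: [f]
    matches open cells with open cells, but the maps [cmap SY] need not lie over those of the
    mapping torus. The characteristic maps of the torus are therefore lifted through [f], which is
    possible because [Y] is compact and [f] has finite fibres; freeness of a face, defined through
    [cmap SY], is then compared with these lifts. The bound on degrees has one exception, a complex
    reduced to a single point, and the alternative of a trivial fundamental group is used only
    there. *)

Lemma acyclic_rank (L : finType) (r : rel L) :
  (forall x s, path r x s -> r (last x s) x -> False) ->
  exists rk : L -> nat, forall x y, r x y -> rk x < rk y.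
Proof.
(* The rank counts the elements from which [x] can be reached. Along [r x y] this set grows, and
   strictly: it gains [y], which cannot reach [x] without closing a cycle. *)
move=> acyc; exists (fun x => #|[pred y | connect r y x]|) => x y rxy.
apply: proper_card; apply/properP; split.
  apply/fintype.subsetP => z; rewrite !inE => zx.
  exact: connect_trans zx (connect1 rxy).
exists y; rewrite !inE ?connect0 //; apply/negP => /connectP[s ps ex].
by apply: (acyc y s) => //; rewrite -ex.
Qed.

(* V, A, E, C stand for the vertices, vertical edges, horizontal edges and
   2-cells of Y, and B for the darts of the top sides of the 2-cells.  Dart d
   carries weight M ^ rk (lab d); a dart over a bottom edge outweighs all its
   predecessors, so the weight escapes through the ends counted by [bad]. *)
Section Discharging.
Variables (V A E C L B : finType) (W : Type).
(** [d0] is the bottom edge of a 2-cell, [b0] the lower end of a horizontal edge, [oh] the two sides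
    of a 2-cell, [o] the end vertices of vertical edges. A dart in [B] has the underlying dart of
    [H] as [lab], its start as [top], and as [td] the end of a vertical edge along which it sets
    out. [ow] is the point at half height below its start: darts with equal [ow] issue from one
    horizontal line. *)
Variables (d0 : C -> A) (b0 : E -> V) (oh : C -> bool -> E) (o : A * bool -> V).
Variables (lab : B -> L) (lrev : L -> L) (rev : B -> B) (ow : B -> W) (top : B -> V).
Variables (td : B -> A * bool) (rk : L -> nat).
Hypotheses (d0_inj : injective d0) (b0_inj : injective b0).
Hypothesis corner : forall c i, o (d0 c, i) = b0 (oh c i).
Hypothesis td_top : forall d, o (td d) = top d.
Hypothesis ow_top : forall d d', ow d = ow d' -> top d = top d'.
Hypothesis td_rev : forall d, (td (rev d)).1 = (td d).1.
Hypothesis rev_inj : injective rev.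
Hypothesis lab_rev : forall d, lab (rev d) = lrev (lab d).
Hypothesis lab_top_inj :
  forall d d', lab d = lab d' -> top d = top d' -> d = d'.
Hypothesis td_inj : forall d d', ow d = ow d' -> td d = td d' -> d = d'.
Variable other : B -> B.
Hypothesis ow_other : forall d, ow (other d) = ow d.
Hypothesis other_neq : forall d, other d <> d.
Hypothesis bottom_covered : forall c, exists d, (td d).1 = d0 c.
Hypothesis free_vertex : forall v, v \notin codom b0 -> exists d, top d = v.
Hypothesis rk_step : forall d d', (td d).1 \in codom d0 -> (td d').1 \in codom d0 ->
  ow d' = ow (rev d) -> d' <> rev d -> rk (lab d) < rk (lab d').

Let M := #|L|.+1.
Let N := \max_(l : L) rk l.
Let lam (d : B) := M ^ rk (lab d).
Let D : {set B} := [set d | (td d).1 \in codom d0].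
Let bad : {set A * bool} := [set x | (x.1 \notin codom d0) && (o x \in codom b0)].

(** Prolongs a reduced walk: turn around at the end of [d], then leave by another dart of the same
    horizontal line. *)
Let next (d : B) : B := other (rev d).

(** The predecessors of [d'] under [next] have distinct labels, since a label and a top vertex
    determine a dart. So there are at most [M - 1] of them, each of smaller rank, and
    [1 + (M - 1) * M ^ r <= M ^ r.+1]. *)
Lemma weight_step d' : d' \in D ->
  1 + \sum_(d in D | next d == d') lam d <= lam d'.
Proof.
move=> d'D; set P := [set d in D | next d == d'].
have stp d : d \in P -> rk (lab d) < rk (lab d').
  rewrite !inE => /andP[dD /eqP nd]; apply: rk_step => //; first by rewrite inE in d'D.
    by rewrite -nd ow_other.
  by rewrite -nd; exact: other_neq.
have labP : {in P &, injective lab}.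
  move=> d e; rewrite !inE => /andP[_ /eqP nd] /andP[_ /eqP ne] de.
  apply: rev_inj; apply: lab_top_inj; first by rewrite !lab_rev de.
  by apply: ow_top; rewrite -(ow_other (rev d)) -(ow_other (rev e)) -/(next d) -/(next e) nd ne.
have cP : #|P| <= #|L| by rewrite -(card_in_imset labP) max_card.
rewrite (eq_bigl (mem P)); last by move=> d; rewrite !inE.
rewrite /lam; case rE : (rk (lab d')) stp => [|r] stp.
  rewrite big1 // => d dP; by have := stp d dP.
apply: (@leq_trans (1 + \sum_(d in P) M ^ r)).
  rewrite leq_add2l; apply: leq_sum => d dP; apply: leq_pexp2l => //.
  by rewrite -ltnS; exact: stp.
rewrite sum_nat_const expnS {2}/M mulSn leq_add ?leq_mul //.
by rewrite expn_gt0.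
Qed.

(** When [weight_step] is summed over [D], the weights of the darts whose successor stays in [D]
    cancel. What escapes pays one unit for each dart of [D]. *)
Lemma card_D_le : #|D| <= \sum_(d in D | next d \notin D) lam d.
Proof.
have h : \sum_(d' in D) (1 + \sum_(d in D | next d == d') lam d) <= \sum_(d in D) lam d.
  by apply: leq_sum => d' d'D; exact: weight_step.
rewrite big_split /= sum1_card in h.
have e : \sum_(d' in D) \sum_(d in D | next d == d') lam d =
    \sum_(d in D | next d \in D) lam d.
  rewrite (exchange_big_dep (mem D)) /=; last by move=> d' d _ /andP[].
  rewrite [RHS]big_mkcondr /=; apply: eq_bigr => d dD.
  case: ifP => nD; last first.
    by rewrite big1 // => d' /andP[d'D /andP[_ /eqP nd]]; move: nD; rewrite nd d'D.
  rewrite (big_pred1 (next d)) // => d' /=.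
  by rewrite dD /= eq_sym; case: eqP => [->|]; rewrite ?nD ?andbF.
rewrite e in h; rewrite -(leq_add2r (\sum_(d in D | next d \in D) lam d)).
apply: (leq_trans h); rewrite [X in X <= _](bigID (fun d => next d \in D)) /= addnC.
by [].
Qed.

(** The end [td (next d)] determines [top (rev d)], which together with [lab (rev d)] determines
    [d]. This end is counted by [bad]: the edge under [rev d] is the bottom of a 2-cell, so by
    [corner] its ends are lower ends of horizontal edges. *)
Lemma card_escape : #|[set d in D | next d \notin D]| <= #|bad| * #|L|.
Proof.
rewrite -cardsT -cardsX.
pose phi d := (td (next d), lab (rev d)).
have oE d : o (td (next d)) = top (rev d).
  by rewrite td_top; apply: ow_top; exact: ow_other.
have inj : injective phi.
  move=> d d' [tt ll]; apply: rev_inj; apply: lab_top_inj => //.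
  by rewrite -!oE tt.
rewrite -(card_imset _ inj); apply/subset_leq_card/fintype.subsetP => _ /imsetP[d + ->].
rewrite !inE andbT => /andP[/codomP[c ec] ->] /=.
rewrite oE -td_top; have := td_rev d; rewrite ec.
by case: (td (rev d)) => a i /= ->; rewrite corner codom_f.
Qed.

Lemma lam_le d : lam d <= M ^ N.
Proof. by rewrite /lam leq_pexp2l // /N; exact: leq_bigmax. Qed.

Lemma card_C_le : #|C| <= M ^ N * #|L| * #|bad|.
Proof.
have CD : #|C| <= #|D|.
  rewrite -(card_codom d0_inj) (leq_trans _ (leq_imset_card (fun d => (td d).1) D)) //.
  apply/subset_leq_card/fintype.subsetP => _ /codomP[c ->]; have [d dc] := bottom_covered c.
  by apply/imsetP; exists d; rewrite ?inE dc ?codom_f.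
apply: (leq_trans CD); apply: (leq_trans card_D_le).
apply: (@leq_trans (\sum_(d in D | next d \notin D) M ^ N)).
  by apply: leq_sum => d _; exact: lam_le.
rewrite (eq_bigl (mem [set d in D | next d \notin D])); last by move=> d; rewrite !inE.
by rewrite sum_nat_const mulnC -mulnA leq_mul // mulnC card_escape.
Qed.

(** The right-hand side counts the ends of the vertical edges that are not bottoms. A vertex outside
    the image of [b0] carries at least two of them, given by a dart starting there and by its
    [other]; the ends at the remaining vertices form [bad]. *)
Lemma card_bad : #|bad| + 2 * #|[set v | v \notin codom b0]| <=
  2 * #|[set a | a \notin codom d0]|.
Proof.
set V' := [set v | _]; set A' := [set a | _].
have -> : 2 * #|A'| = #|[set x : A * bool | x.1 \notin codom d0]|.
  have -> : [set x : A * bool | x.1 \notin codom d0] = finset.setX A' [set: bool].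
    by apply/setP => -[a i]; rewrite !inE andbT.
  by rewrite cardsX cardsT card_bool mulnC.
rewrite -[X in _ <= X](cardsID [set x | o x \in codom b0]).
apply: leq_add.
  by apply/subset_leq_card/fintype.subsetP => x; rewrite !inE.
rewrite -[X in _ <= X]sum1_card (partition_big o (mem V')) /=; last first.
  by move=> x; rewrite !inE => /andP[].
rewrite mulnC -sum_nat_const; apply: leq_sum => v; rewrite inE => vV.
rewrite sum1dep_card; have [d dv] := free_vertex vV.
have inS d' : ow d' = ow d -> td d' \in [set x | (x \in [set x : A * bool | x.1 \notin codom d0]
     :\: [set x | o x \in codom b0]) && (o x == v)].
  move=> e; have odv : o (td d') = v by rewrite td_top (ow_top e).
  rewrite !inE odv vV eqxx andbT /=; apply/negP => /codomP[c ec].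
  move/negP: vV; apply; rewrite -odv; case: (td d') ec => a i /= ->.
  by rewrite corner codom_f.
apply/card_gt1P; exists (td d), (td (other d)); split; [exact: inS| |].
  by apply: inS; exact: ow_other.
by apply/eqP => e; apply: (other_neq (d := d)); apply: td_inj => //; exact: ow_other.
Qed.

(** This is the inequality between [#|C|] and [- 2 * K] times the Euler characteristic, arranged so
    as to avoid subtraction in [nat]. After cancelling [#|E|] and [#|C|] it follows from [card_C_le]
    and from [K] times [card_bad]. *)
Theorem discharging K : M ^ N * #|L| <= K ->
  #|C| + 2 * K * (#|V| + #|C|) <= 2 * K * (#|A| + #|E|).
Proof.
move=> MK.
have eA : #|A| = #|C| + #|[set a | a \notin codom d0]|.
  rewrite -(card_codom d0_inj) -cardsE -(cardsC [set x in codom d0]).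
  by congr (_ + _); [rewrite !cardsE|apply: eq_card => x; rewrite !inE].
have eV : #|V| = #|E| + #|[set v | v \notin codom b0]|.
  rewrite -(card_codom b0_inj) -cardsE -(cardsC [set x in codom b0]).
  by congr (_ + _); [rewrite !cardsE|apply: eq_card => x; rewrite !inE].
rewrite eA eV.
have := leq_mul (leqnn K) card_bad; have := leq_trans card_C_le (leq_mul MK (leqnn _)).
set v := #|[set v | _]|; set a := #|[set a | _]|; set b := #|bad| => h1 h2.
have h3 : #|C| + 2 * K * v <= 2 * K * a.
  rewrite [2 * K]mulnC -!mulnA; apply: leq_trans h2.
  by rewrite mulnDr leq_add2r.
have -> : #|E| + v + #|C| = (#|E| + #|C|) + v by rewrite addnAC.
have -> : #|C| + a + #|E| = (#|E| + #|C|) + a by rewrite addnAC (addnC #|C|).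
by rewrite !(mulnDr (2 * K) (#|E| + #|C|)) addnCA leq_add2l.
Qed.

End Discharging.

Import Order.TTheory GRing.Theory Num.Theory.
Import numFieldTopology.Exports numFieldNormedType.Exports.

Local Open Scope classical_set_scope.
Local Open Scope ring_scope.

(** * General topology *)

Section GeneralTopology.
Context {R : realType}.
Implicit Types X Y Z : topologicalType.

Lemma within_continuousP Y X (A : set Y) (f : Y -> X) :
  {within A, continuous f} <->
  forall x, A x -> forall V, nbhs (f x) V -> nbhs x [set y | A y -> V (f y)].
Proof. by rewrite subspace_continuousP; split => fc x /fc. Qed.

Lemma hausdorff_sep Y (x y : Y) : hausdorff_space Y -> x <> y ->
  exists A B, [/\ open A, open B, A x, B y & A `&` B = set0].
Proof.
move=> hY /eqP xy; move: hY; rewrite open_hausdorff => /(_ _ _ xy).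
by move=> [[A B] [/set_mem Ax /set_mem By] [oA oB /eqP AB0]]; exists A, B.
Qed.

Lemma hausdorff_sep_finite Y (E : set Y) (y : Y) : hausdorff_space Y ->
  finite_set E -> ~ E y ->
  exists A B, [/\ open A, open B, A y, E `<=` B & A `&` B = set0].
Proof.
move=> hY /finite_seqP[s ->]; elim: s => [|z s IH].
  move=> _; exists setT, set0; split => //; [exact: openT|exact: open0|].
  by rewrite setI0.
rewrite /= => nzy; have ny : ~ [set` s] y.
  by move=> /= ys; apply: nzy; rewrite /= inE ys orbT.
have [A [B [oA oB Ay sB AB]]] := IH ny.
have yz : y <> z by move=> yz; apply: nzy; rewrite /= inE yz eqxx.
have [A' [B' [oA' oB' Ay' Bz AB']]] := hausdorff_sep hY yz.
exists (A `&` A'), (B `|` B'); split; [exact: openI|exact: openU|by []| |].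
  by move=> t /=; rewrite inE => /orP[/eqP->|ts]; [right|left; apply: sB].
apply/seteqP; split => // t [[At A't] [Bt|B't]].
  by rewrite -AB; split.
by rewrite -AB'; split.
Qed.

Lemma wcompact_image_closed Y X (D N : set Y) (f : Y -> X) :
  hausdorff_space X -> compact D -> {within D, continuous f} -> open N ->
  closed (f @` (D `\` N)).
Proof.
move=> hX cD fc oN; apply: compact_closed => //.
apply: continuous_compact; first by apply: continuous_subspaceW fc => x [].
by rewrite setDE; apply: compact_closedI => //; exact: open_closedC.
Qed.

(* A continuous map from a compact space is closed, so the fibres have small
   saturated neighbourhoods. *)
Lemma tube Y X (D N : set Y) (f : Y -> X) (x : X) :
  hausdorff_space X -> compact D -> {within D, continuous f} -> open N ->
  D `&` f @^-1` [set x] `<=` N ->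
  exists V, [/\ open V, V x & D `&` f @^-1` V `<=` N].
Proof.
move=> hX cD fc oN fN; exists (~` (f @` (D `\` N))); split.
- by apply: closed_openC; exact: wcompact_image_closed.
- by move=> [y [Dy nNy] fy]; apply: nNy; apply: fN.
- by move=> y [Dy /= nf]; apply: contrapT => nNy; apply: nf; exists y.
Qed.

Lemma connected_in_one Y (C A B : set Y) : connected C -> open A -> open B ->
  A `&` B = set0 -> C `<=` A `|` B -> C `&` A !=set0 -> C `<=` A.
Proof.
move=> cC oA oB AB0 CAB CA; suff : C `&` A = C by move=> <-; exact: subIsetr.
apply: cC => //; first by exists A.
exists (~` B); first exact: open_closedC.
apply/seteqP; split => x [Cx].
  by move=> Ax; split => // Bx; have : (A `&` B) x by []; rewrite AB0.
by move=> nBx; split => //; have [] := CAB _ Cx.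
Qed.

(** The set where the two lifts agree is open because [f] is locally injective and closed because
    [Y] is Hausdorff; no covering property of [f] is involved. *)
Lemma unique_lift Z Y X (A : set Z) (B : set Y) (f : Y -> X) (h1 h2 : Z -> Y)
    (z0 : Z) :
  hausdorff_space Y -> locally_injective B f -> connected A ->
  {within A, continuous h1} -> {within A, continuous h2} ->
  h1 @` A `<=` B -> h2 @` A `<=` B ->
  (forall z, A z -> f (h1 z) = f (h2 z)) -> A z0 -> h1 z0 = h2 z0 ->
  forall z, A z -> h1 z = h2 z.
Proof.
move=> hY lif cA h1c h2c h1B h2B fh Az0 e0.
pose E := [set z | A z /\ h1 z = h2 z].
suff EA : E = A by move=> z; rewrite -{1}EA => -[].
apply: cA; first by exists z0.
  exists (interior [set z | A z -> h1 z = h2 z]); first exact: open_interior.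
  apply/seteqP; split => z; last first.
    by move=> [Az /interior_subset/(_ Az) e]; split.
  move=> [Az e]; split => //; rewrite /interior /=.
  have [V nV Vinj] := lif (h1 z) (h1B _ (ex_intro2 _ _ z Az erefl)).
  have/within_continuousP/(_ z Az V nV) n1 := h1c.
  have/within_continuousP/(_ z Az V) := h2c; rewrite -e => /(_ nV) n2.
  apply: filterS (filterI n1 n2) => t [v1 v2] At.
  apply: Vinj; rewrite ?inE; [split|split|]; [|exact: v1| |exact: v2|].
  - by apply: h1B; exists t.
  - by apply: h2B; exists t.
  - exact: fh.
exists (closure E); first exact: closed_closure.
apply/seteqP; split => z; first by move=> Ez; split; [case: Ez|exact: subset_closure].
move=> [Az clz]; split => //; apply: contrapT => ne.
have [P [Q [oP oQ Pz Qz PQ0]]] := hausdorff_sep hY ne.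
have/within_continuousP/(_ z Az P (open_nbhs_nbhs (conj oP Pz))) n1 := h1c.
have/within_continuousP/(_ z Az Q (open_nbhs_nbhs (conj oQ Qz))) n2 := h2c.
have [t [[At et] [t1 t2]]] := clz _ (filterI n1 n2).
by have : (P `&` Q) (h1 t); [split; [exact: t1|rewrite et; exact: t2]|rewrite PQ0].
Qed.

(** Finitely many open sets on which [f] is injective cover [K], and each contains at most one point
    over each point of [B]. *)
Lemma finite_locally_injective_preimage Y X (K : set Y) (f : Y -> X)
    (B : set X) :
  compact K -> locally_injective K f -> finite_set B ->
  finite_set (K `&` f @^-1` B).
Proof.
move=> cK lif fB.
have /choice[U UP] : forall x, exists U : set Y,
    K x -> [/\ open U, U x & set_inj (K `&` U) f].
  move=> x; have [Kx|nKx] := pselect (K x); last by exists setT.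
  have [U nU Ui] := lif x Kx; exists (interior U) => _; split.
  - exact: open_interior.
  - by [].
  - move=> s t /set_mem[Ks /interior_subset Us] /set_mem[Kt /interior_subset Ut].
    by apply: Ui; apply: mem_set.
have [[x0 Kx0]|K0] := pselect (K !=set0); last first.
  apply: (@sub_finite_set _ _ set0) => // y [Ky _].
  by exfalso; apply: K0; exists y.
have : cover_compact K.
  pose Yp : ptopologicalType := HB.pack Y (isPointed.Build Y x0).
  suff : @cover_compact Yp K by [].
  by rewrite -compact_cover.
move=> /(_ Y K U)[x Kx|x Kx|E EK KE]; first by have [] := UP x Kx.
  by exists x => //; have [] := UP x Kx.
pose G := \bigcup_(x in [set` E]) \bigcup_(b in B) (K `&` U x `&` f @^-1` [set b]).
apply: (@sub_finite_set _ _ G).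
  by move=> y [Ky By]; have [x Ex Uy] := KE y Ky; exists x => //; exists (f y).
apply: bigcup_finite; first exact: finite_fset.
move=> x /EK/set_mem Kx; apply: bigcup_finite => // b Bb.
have [_ _ Ui] := UP x Kx.
have [[y0 Sy0]|/set0P/negP] := pselect ((K `&` U x `&` f @^-1` [set b]) !=set0); last first.
  by rewrite negbK => /eqP ->; exact: finite_set0.
apply: (@sub_finite_set _ _ [set y0]); last exact: finite_set1.
move=> y [KU fy]; case: Sy0 => KU0 fy0.
by apply: Ui; [exact/mem_set|exact/mem_set|rewrite fy fy0].
Qed.

(** Here [p] may be a boundary point of [U]. A connected trace on [U] near [p] forces a lift defined
    on [U] to approach only one point of a finite fibre. *)
Definition locally_connected_at Z (U : set Z) (p : Z) : Prop :=
  forall N, nbhs p N -> exists M,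
    [/\ nbhs p M, M `<=` N, connected (M `&` U) & M `&` U !=set0].

(** The value at [p] is a cluster point of [s] there: it exists by compactness of [K] and lies over
    [q p] because [X] is Hausdorff. Finiteness of the fibre and local connectedness of [U] make this
    choice continuous. *)
Lemma lift_extension Z Y X (D U : set Z) (K : set Y) (f : Y -> X)
    (q : Z -> X) (s : Z -> Y) :
  hausdorff_space Y -> hausdorff_space X -> compact K ->
  {within K, continuous f} ->
  (forall x, finite_set (K `&` f @^-1` [set x])) ->
  U `<=` D -> (forall p, D p -> locally_connected_at U p) ->
  {within D, continuous q} -> {within U, continuous s} ->
  (forall z, U z -> K (s z) /\ f (s z) = q z) ->
  exists h : Z -> Y, [/\ {within D, continuous h},
    forall z, D z -> K (h z) /\ f (h z) = q z & forall z, U z -> h z = s z].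
Proof.
move=> hY hX cK fc ff UD lcU qc sc sK.

have PF p : D p -> ProperFilter (within U (nbhs p)).
  move=> Dp; apply: within_nbhs_proper => N nN.
  have [M [nM MN _ [z [Mz Uz]]]] := lcU p Dp _ nN.
  by exists z; split => //; exact: MN.
have ex p : exists y, D p -> [/\ K y, f y = q p & cluster (s @ within U (nbhs p)) y].
  have [Dp|nDp] := pselect (D p); last first.
    have [[z Dz]|D0] := pselect (exists z, D z); last by exists (s p).
    by exists (s z).

  have PFp := PF p Dp.
  have [|y [Ky cly]] := cK (s @ within U (nbhs p)) _.
    by apply: filterS (withinT U (nbhs_filter p)) => z /sK[].
  exists y => _; split => //; apply: contrapT => nfq.
  have [A [B [oA oB Afy Bqp AB0]]] := hausdorff_sep hX nfq.
  have/within_continuousP/(_ y Ky A (open_nbhs_nbhs (conj oA Afy))) nA := fc.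
  have/within_continuousP/(_ p Dp B (open_nbhs_nbhs (conj oB Bqp))) nB := qc.
  have [|t [[Kt Bt] At]] := cly (K `&` f @^-1` B) [set y | K y -> A (f y)] _ nA.
    rewrite /= nbhs_simpl /within /=; apply: filterS nB => z zB Uz.
    by have [Kz fz] := sK z Uz; split => //=; rewrite fz; exact/zB/UD.
  by have : (A `&` B) (f t); [split => //; exact: At|rewrite AB0].
have /choice[h hP] := ex.

(* The other points of the fibre over [q p] are enclosed in an open [O] disjoint from a
   neighbourhood of [h p] inside [W]. By [tube], only these two open sets matter over a small
   neighbourhood of [q p]; [s] maps a connected set into their union, hence into the one containing
   its cluster point [h p]. *)
have key p W : D p -> open W -> W (h p) -> exists M, [/\ open_nbhs p M,
    forall z, (M `&` U) z -> W (s z) & forall z, (M `&` D) z -> W (h z)].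
  move=> Dp oW Wp; have [Khp fhp clp] := hP p Dp.
  pose E := (K `&` f @^-1` [set q p]) `\ h p.
  have fE : finite_set E by apply: sub_finite_set (ff (q p)) => y [].
  have [A [O [oA oO Ahp EO AO]]] : exists A B : set Y,
      [/\ open A, open B, A (h p), E `<=` B & A `&` B = set0].
    by apply: hausdorff_sep_finite => // -[_]; apply.
  have WO : W `&` A `&` O = set0.
    by apply/seteqP; split => // t [[_ At] Ot]; rewrite -AO; split.
  have WAp : (W `&` A) (h p) by [].
  have oWA : open (W `&` A) by exact: openI.
  have [|V [oV Vqp fV]] := tube (x := q p) hX cK fc (openU oWA oO).
    move=> y [Ky fy]; have [->|yp] := pselect (y = h p); first by left.
    by right; apply: EO.
  have/within_continuousP/(_ p Dp V (open_nbhs_nbhs (conj oV Vqp))) nV := qc.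
  have [M [nM MV cMU _]] := lcU p Dp _ nV.
  have sM z : (M `&` U) z -> (W `&` A) (s z).
    have : s @` (M `&` U) `<=` W `&` A.
      apply: (connected_in_one (B := O)) => //.
      - apply: connected_continuous_connected => //.
        by apply: continuous_subspaceW sc => t [].
      - move=> _ [t [Mt Ut] <-]; apply: fV; have [Ks fs] := sK t Ut.
        by split => //=; rewrite fs; exact/MV/UD.
      - have [||t [Mt WAt]] := clp (s @` (M `&` U)) (W `&` A).
        + rewrite /= nbhs_simpl /within /=; apply: filterS nM => t Mt Ut.
          by exists t.
        + exact: open_nbhs_nbhs.
        by exists t.
    by move=> sWA MUz; apply: sWA; exists z.
  exists M°; split; first by split; [exact: open_interior|].
    by move=> z [/interior_subset Mz Uz]; have [] := sM z (conj Mz Uz).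
  move=> z [Mz Dz]; have [Khz fhz clz] := hP z Dz.
  have [|[//]|Oz] := fV (h z).
    by split => //=; rewrite fhz; exact: MV (interior_subset Mz) Dz.
  have [||t [[u [Mu Uu] <-] Ot]] := clz (s @` (M `&` U)) O.
  - rewrite /= nbhs_simpl /within /=; apply: filterS Mz => t Mt Ut.
    by exists t.
  - exact: open_nbhs_nbhs.
  by have : (W `&` A `&` O) (s u); [split => //; exact: sM|rewrite WO].
exists h; split.
- apply/within_continuousP => p Dp V; rewrite nbhsE => -[W [oW Wp] WV].
  have [M [oM _ MW]] := key p W Dp oW Wp.
  by apply: filterS (open_nbhs_nbhs oM) => z Mz Dz; exact/WV/MW.
- by move=> z Dz; have [] := hP z Dz.
- move=> z Uz; apply: contrapT => ne; have [_ _ clz] := hP z (UD _ Uz).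
  have [A [B [oA oB Az Bz AB0]]] := hausdorff_sep hY ne.
  have [||t [Bt At]] := clz B A; last by have : (A `&` B) t by []; rewrite AB0.
    have/within_continuousP/(_ z Uz B (open_nbhs_nbhs (conj oB Bz))) := sc.
    by apply.
  exact: open_nbhs_nbhs.
Qed.


Lemma closed_fibre Y X (D : set Y) (f : Y -> X) (x : X) :
  hausdorff_space X -> closed D -> {within D, continuous f} ->
  closed (D `&` f @^-1` [set x]).
Proof.
move=> hX cD /continuous_closedP fc.
have /fc/closed_subspaceP[V cV] : closed [set x].
  by apply: accessible_closed_set1; exact: hausdorff_accessible.
by move=> VD; suff -> : D `&` f @^-1` [set x] = V `&` D; [exact: closedI|rewrite setIC].
Qed.

(* If mu and sigma are two parametrizations of a cell which agree inside up to
   reparametrization, and sigma passes over a exactly once, then so does mu. *)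
Lemma connected_passage Z Z' Y (D U : set Z) (D' U' : set Z') (mu : Z -> Y)
    (sigma : Z' -> Y) (a : set Y) :
  hausdorff_space Y -> hausdorff_space Z -> normal_space Z ->
  compact D -> {within D, continuous mu} -> U `<=` D -> D `<=` closure U ->
  set_inj U mu -> (mu @` (D `\` U)) `&` (mu @` U) = set0 ->
  compact D' -> {within D', continuous sigma} -> U' `<=` D' ->
  sigma @` U' = mu @` U -> a `<=` sigma @` D' ->
  let J := D' `&` sigma @^-1` a in
  set_inj J sigma -> connected J ->
  (forall p, J p -> locally_connected_at U' p) ->
  connected (D `&` mu @^-1` a).
Proof.
move=> hY hZ nZ cD muc UD Ucl mui muDU cD' sgc UD' sgU aD' J sgi cJ lcJ.
have clD : closed D by exact: compact_closed.
have [[p0 Jp0]|J0] := pselect (J !=set0); last first.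
  rewrite (_ : _ `&` _ = set0); first exact: connected0.
  apply/seteqP; split => // u [Du au]; have [z Dz zu] := aD' _ au.
  by exfalso; apply: J0; exists z; split => //=; rewrite zu.
have [u0 Uu0] : U !=set0.
  have [M [_ _ _ [z [_ Uz]]]] := lcJ p0 Jp0 setT filterT.
  have : (mu @` U) (sigma z) by rewrite -sgU; exists z.
  by move=> [u Uu _]; exists u.
(* [kap] is the change of parametrization: [sigma] followed by the inverse of [mu] on the open
   cell. *)
have /choice[kap kapP] : forall z, exists u, U' z -> U u /\ mu u = sigma z.
  move=> z; have [Uz|nUz] := pselect (U' z); last by exists u0.
  have : (mu @` U) (sigma z) by rewrite -sgU; exists z.
  by move=> [u Uu e]; exists u.
have fib u u' : D u -> U u' -> mu u = mu u' -> u = u'.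
  move=> Du Uu' e; have [Uu|nUu] := pselect (U u).
    by apply: mui; rewrite ?inE.
  suff : set0 (mu u) by [].
  by rewrite -muDU; split; [exists u|exists u'].
have kapc : {within U', continuous kap}.
  apply/within_continuousP => z Uz N; rewrite nbhsE => -[O [oO Oz] ON].
  have [Uk ek] := kapP z Uz.
  have [|V [oV Vz muV]] := tube (x := sigma z) hY cD muc oO.
    by move=> u [Du /= eu]; rewrite (fib u (kap z)) // ek.
  have/within_continuousP/(_ z (UD' _ Uz) V (open_nbhs_nbhs (conj oV Vz))) := sgc.
  apply: filterS => t tV Ut; apply: ON; apply: muV.
  by have [Ukt ekt] := kapP t Ut; split; [exact: UD|rewrite /= ekt; exact/tV/UD'].
(* A separation [E] of the preimage under [mu] will give a separation [T] of the connected set [J],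
   by sorting each [p] according to the piece that contains the whole fibre of [mu] over
   [sigma p]. *)
apply/connectedP => E [E0 EU Esep].
have Edisj b : closure (E b) `&` E (~~ b) = set0.
  by move: Esep => [sep1 sep2]; case: b => //=; rewrite setIC.
(* The two parts of the fibre are enclosed in disjoint open sets. Near [p], [kap] maps a connected
   set into one of them; every point of the fibre is a limit of such images, so the other part is
   empty. *)
have fibre p : J p -> exists b, forall u, D u -> mu u = sigma p -> E b u.
  move=> Jp; have [D'p ap] := Jp.
  pose G b := D `&` mu @^-1` [set sigma p] `&` closure (E b).
  have GE b u : G b u -> E b u.
    move=> [[Du /= eu] cEu].
    have : (D `&` mu @^-1` a) u by split => //=; rewrite eu.
    rewrite EU => Eu; apply: contrapT => nEu.
    suff : set0 u by [].
    rewrite -(Edisj b); split => //.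
    by case: b nEu {cEu} Eu => nEu [].
  have clG b : closed (G b).
    by apply: closedI; [exact: closed_fibre|exact: closed_closure].
  have G0 : G false `&` G true = set0.
    apply/seteqP; split => // u [/GE u1 /GE u2].
    by rewrite -(Edisj false); split => //; exact: subset_closure.
  have [O0 [O1 [oO0 oO1 GO0 GO1 O01]]] :
      exists O0 O1 : set Z, [/\ open O0, open O1, G false `<=` O0,
        G true `<=` O1 & O0 `&` O1 = set0].
    have /(@normal_openP R) := nZ.
    by move=> /(_ _ _ (clG false) (clG true) G0)[O0 [O1 []]]; exists O0, O1.
  have [|V [oV Vp muV]] := tube (x := sigma p) hY cD muc (openU oO0 oO1).
    move=> u [Du /= eu].
    have : (D `&` mu @^-1` a) u by split => //=; rewrite eu.
    rewrite EU => -[Eu|Eu]; [left; apply: GO0|right; apply: GO1];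
      by split => //; exact: subset_closure.
  have/within_continuousP/(_ p D'p V (open_nbhs_nbhs (conj oV Vp))) nV := sgc.
  have [M [nM MV cMU [z0 [Mz0 Uz0]]]] := lcJ p Jp _ nV.
  have kO z : M z -> U' z -> (O0 `|` O1) (kap z).
    move=> Mz Uz; have [Uk ek] := kapP z Uz.
    by apply: muV; split; [exact: UD|rewrite /= ek; exact/MV/UD'].
  (* The part of D near the fibre is swept by kap @` (M `&` U'). *)
  have sweep (O Q : set Z) : open O -> open Q -> O `&` Q = set0 ->
      (forall z, M z -> U' z -> (O `|` Q) (kap z)) -> O (kap z0) ->
      forall u, D u -> mu u = sigma p -> ~ Q u.
    move=> oO oQ OQ0 kOQ Oz0 u Du eu Qu.
    have kMO : kap @` (M `&` U') `<=` O.
      apply: (connected_in_one (B := Q)) => //.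
      - apply: connected_continuous_connected => //.
        by apply: continuous_subspaceW kapc => t [].
      - by move=> _ [t [Mt Ut] <-]; exact: kOQ.
      - by exists (kap z0); split => //; exists z0.
    have [|V' [oV' V'p sgV']] :=
        tube (x := sigma p) hY cD' sgc (@open_interior _ M).
      move=> z [Dz /= ez]; rewrite (_ : z = p) //.
      by apply: sgi; rewrite ?inE //; split => //=; rewrite ez.
    have nV' : nbhs (mu u) V' by rewrite eu; exact: open_nbhs_nbhs.
    have/within_continuousP/(_ u Du V' nV') nu := muc.
    have [w [Uw [Qw Vw]]] := Ucl _ Du _ (filterI (open_nbhs_nbhs (conj oQ Qu)) nu).
    have [z Uz ez] : (sigma @` U') (mu w) by rewrite sgU; exists w.
    have Mz : M z.
      by apply: interior_subset; apply: sgV'; split; [exact: UD'|rewrite /= ez; exact/Vw/UD].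
    have kzw : w = kap z.
      by have [Uk ek] := kapP z Uz; apply: fib; rewrite ?ek //; exact: UD.
    suff : set0 w by [].
    by rewrite -OQ0; split => //; rewrite kzw; apply: kMO; exists z.
  have inE' b u : D u -> mu u = sigma p -> ~ G (~~ b) u -> E b u.
    move=> Du eu nG; have : (D `&` mu @^-1` a) u by split => //=; rewrite eu.
    rewrite EU; case: b nG => nG [] // Eu; exfalso; apply: nG;
      by split => //; exact: subset_closure.
  have [Oz0|Oz0] := kO z0 Mz0 Uz0.
  - exists false => u Du eu; apply: inE' => // Gu.
    by apply: (sweep O0 O1) (GO1 _ Gu).
  - exists true => u Du eu; apply: inE' => // Gu.
    apply: (sweep O1 O0) (GO0 _ Gu) => //; first by rewrite setIC.
    by move=> z Mz Uz; rewrite setUC; exact: kO.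
pose T b := [set p | J p /\ forall u, D u -> mu u = sigma p -> E b u].
have over p : J p -> exists2 u, D u & mu u = sigma p.
  move=> Jp; have [D'p _] := Jp.
  have cDm : closed (mu @` D).
    by apply: compact_closed => //; exact: continuous_compact.
  suff [u Du eu] : (mu @` D) (sigma p) by exists u.
  apply: cDm => V nV.
  have/within_continuousP/(_ p D'p V nV) nM := sgc.
  have [M [_ MV _ [z [Mz Uz]]]] := lcJ p Jp _ nM.
  have [Uk ek] := kapP z Uz.
  by exists (sigma z); split; [exists (kap z); [exact: UD|]|exact/MV/UD'].
apply: ((connectedP J).1 cJ T).
have Tsep b : closure (T b) `&` T (~~ b) = set0.
  apply/seteqP; split => // p [clp [Jp Ep]]; have [D'p _] := Jp.
  have [|V [oV Vp muV]] := tube (x := sigma p) hY cD muc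
      (closed_openC (@closed_closure _ (E b))).
    move=> u [Du /= eu] clu; suff : set0 u by [].
    by rewrite -(Edisj b); split => //; exact: Ep.
  have/within_continuousP/(_ p D'p V (open_nbhs_nbhs (conj oV Vp))) nV := sgc.
  have [q [[Jq Eq] Vq]] := clp _ nV; have [D'q _] := Jq.
  have [u Du eu] := over q Jq.
  suff : (~` closure (E b)) u by apply; apply: subset_closure; exact: Eq.
  by apply: muV; split => //=; rewrite eu; exact: Vq.
split.
- move=> b; have [u Eu] := E0 b.
  have [Du au] : (D `&` mu @^-1` a) u by rewrite EU; case: b Eu; [right|left].
  have [p Dp ep] := aD' _ au.
  have Jp : J p by split => //=; rewrite ep.
  exists p; split => //; have [b' Eb'] := fibre p Jp.
  suff -> : b = b' by [].
  have Eb'u := Eb' u Du (esym ep); apply/eqP; apply: contraT => ne.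
  suff : set0 u by [].
  rewrite -(Edisj b); split; first exact: subset_closure.
  by move: Eb'u; case: (b) (b') ne => -[].
- apply/seteqP; split => p; last by case=> -[].
  by move=> Jp; have [[] Eb] := fibre p Jp; [right|left].
- by split; [exact: Tsep false|rewrite setIC; exact: Tsep true].
Qed.

End GeneralTopology.

(** * Intervals and cubes *)

Section RealLine.
Context {R : realType}.
Implicit Types (a b s t : R).

Lemma locally_connected_segment a b p : a < b -> a <= p <= b ->
  locally_connected_at `]a, b[ p.
Proof.
move=> ab /andP[ap pb] N /nbhs_ballP[e /= e0 eN]; exists (ball p e); split => //.
- exact: nbhsx_ballx.
- apply/connected_intervalP => x y /= [bx xab] [by_ yab] z /andP[xz zy].
  move: bx xab by_ yab; rewrite /ball /= !in_itv /= !ltr_norml.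
  move=> /andP[? ?] /andP[? ?] /andP[? ?] /andP[? ?].
  by split; apply/andP; split; lra.
- have [pm|pm] := leP p ((a + b) / 2).
    exists (p + Num.min (e / 2) ((b - a) / 4)).
    have [h|h] := leP (e / 2) ((b - a) / 4);
    split; rewrite /ball /= ?in_itv /= ?ltr_norml; apply/andP; split; lra.
  exists (p - Num.min (e / 2) ((b - a) / 4)).
  have [h|h] := leP (e / 2) ((b - a) / 4);
  split; rewrite /ball /= ?in_itv /= ?ltr_norml; apply/andP; split; lra.
Qed.

Lemma connectedX (X Y : topologicalType) (A : set X) (B : set Y) :
  connected A -> connected B -> connected (A `*` B).
Proof.
move=> cA cB; have [[b0 Bb0]|B0] := pselect (B !=set0); last first.
  rewrite (_ : _ `*` _ = set0); first exact: connected0.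
  by apply/seteqP; split => // -[x y] [/= _ By]; apply: B0; exists y.
have [[a0 Aa0]|A0] := pselect (A !=set0); last first.
  rewrite (_ : _ `*` _ = set0); first exact: connected0.
  by apply/seteqP; split => // -[x y] [/= Ax _]; apply: A0; exists x.
have -> : A `*` B = \bigcup_(x in A) ((pair x @` B) `|` (pair^~ b0 @` A)).
  apply/seteqP; split => [[x y] [/= Ax By]|_ [x Ax [[y By <-]|[y Ay <-]]] //].
  by exists x => //; left; exists y.
apply: bigcup_connected.
  by exists (a0, b0) => x Ax; right; exists a0.
move=> x Ax; apply: connectedU.
- by exists (x, b0); split; [exists b0|exists x].
- apply: connected_continuous_connected => //; apply: continuous_subspaceT => y.
  by apply: cvg_pair; [exact: cvg_cst|exact: cvg_id].
- apply: connected_continuous_connected => //; apply: continuous_subspaceT => y.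
  by apply: cvg_pair; [exact: cvg_id|exact: cvg_cst].
Qed.

Lemma locally_connectedX (X Y : topologicalType) (U : set X) (V : set Y) p :
  locally_connected_at U p.1 -> locally_connected_at V p.2 ->
  locally_connected_at (U `*` V) p.
Proof.
move=> lU lV N [[A B] /= [nA nB] AB].
have [M [nM MA cM [x [Mx Ux]]]] := lU A nA.
have [M' [nM' MB cM' [y [My Vy]]]] := lV B nB.
exists (M `*` M'); split.
- by exists (M, M').
- by move=> z [/= z1 z2]; apply: AB; split; [exact: MA|exact: MB].
- rewrite (_ : _ `&` _ = (M `&` U) `*` (M' `&` V)); first exact: connectedX.
  by apply/seteqP; split => [[u v] [[? ?] [? ?]]|[u v] [[? ?] [? ?]]].
- by exists (x, y).
Qed.

(** If [c] were a maximum, the larger of [f (c - d)] and [f (c + d)] would be a value below [f c]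
    taken on both sides of [c], by the intermediate value theorem, against injectivity near [c]. *)
Lemma locally_injective_not_max (f : R -> R) a b c :
  {within `[a, b], continuous f} -> locally_injective `]a, b[ f ->
  a < c < b -> exists2 x, x \in `[a, b] & f c < f x.
Proof.
move=> fc lif /andP[ac cb]; apply: contrapT => nmax.
have max x : a <= x <= b -> f x <= f c.
  by move=> xab; rewrite leNgt; apply/negP => fcx; apply: nmax; exists x.
have [|U /nbhs_ballP[e /= e0 eU] Ui] := lif c; first by rewrite /= in_itv /= ac.
pose d := Num.min (e / 2) (Num.min ((c - a) / 2) ((b - c) / 2)).
have d0 : 0 < d by rewrite !lt_min; apply/andP; split; [lra|apply/andP; split; lra].
have [de [dca dbc]] : d <= e / 2 /\ d <= (c - a) / 2 /\ d <= (b - c) / 2.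
  by rewrite /d !ge_min !lexx !orbT.
have inU x : c - d <= x <= c + d -> x \in `]a, b[%classic `&` U.
  move=> /andP[h1 h2]; apply/mem_set; split.
    by rewrite /= in_itv /=; apply/andP; split; lra.
  by apply: eU; rewrite /ball /= ltr_norml; apply/andP; split; lra.
have lt x : c - d <= x <= c + d -> x != c -> f x < f c.
  move=> xd xc; rewrite lt_neqAle max ?andbT; last by lra.
  apply: contra xc => /eqP fxc; apply/eqP; apply: Ui => //; apply: inU => //.
  by apply/andP; split; lra.
have lt1 : f (c - d) < f c by apply: lt; [|apply/eqP]; lra.
have lt2 : f (c + d) < f c by apply: lt; [|apply/eqP]; lra.
pose m := Num.max (f (c - d)) (f (c + d)).
have mc : m < f c by rewrite /m gt_max lt1.
have m1 : f (c - d) <= m by rewrite le_max lexx.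
have m2 : f (c + d) <= m by rewrite le_max lexx orbT.
have [||| x xd fx] := @IVT _ f (c - d) c m; first lra.
- by apply: continuous_subspaceW fc => x; rewrite /= !in_itv /=; lra.
- by rewrite (min_idPl (ltW lt1)) (max_idPr (ltW lt1)) m1 ltW.
have [||| y yd fy] := @IVT _ f c (c + d) m; first lra.
- by apply: continuous_subspaceW fc => z; rewrite /= !in_itv /=; lra.
- by rewrite (min_idPr (ltW lt2)) (max_idPl (ltW lt2)) m2 ltW.
move: xd yd; rewrite !in_itv /= => xd yd.
have xy : x = y by apply: Ui; [apply: inU; lra|apply: inU; lra|rewrite fx fy].
have xc : x = c by move: xd yd; rewrite xy; lra.
by move: mc; rewrite -fx xc ltxx.
Qed.

(** Extrema are never interior, so equal end values would be both maximum and minimum and [f] would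
    be constant. This is what makes a passage cross an edge from one end to the other. *)
Lemma locally_injective_ends (f : R -> R) a b : a < b ->
  {within `[a, b], continuous f} -> locally_injective `]a, b[ f -> f a != f b.
Proof.
move=> ab fc lif; apply/negP => /eqP fab.
have [c cab cmax] := @EVT_max _ f a b (ltW ab) fc.
have [d dab dmin] := @EVT_min _ f a b (ltW ab) fc.
have fac : f a = f c.
  move: cab; rewrite in_itv /= => /andP[]; rewrite le_eqVlt => /predU1P[->//|ac].
  rewrite le_eqVlt => /predU1P[->//|cb].
  have [|x xab] := locally_injective_not_max fc lif (c := c); first by rewrite ac.
  by rewrite ltNge cmax.
have fad : f a = f d.
  move: dab; rewrite in_itv /= => /andP[]; rewrite le_eqVlt => /predU1P[->//|ad].
  rewrite le_eqVlt => /predU1P[->//|db].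
  have [|||x xab] := @locally_injective_not_max (fun x => - f x) a b d.
  - by move=> x; apply: cvgN; exact: fc.
  - move=> x xab; have [U nU Ui] := lif x xab; exists U => // s t sU tU /oppr_inj.
    exact: Ui.
  - by rewrite ad.
  by rewrite ltrN2 ltNge dmin.
have cst x : a <= x <= b -> f x = f a.
  by move=> xab; apply/le_anti; rewrite {1}fac cmax //= fad dmin.
have [|x] := locally_injective_not_max fc lif (c := (a + b) / 2).
  by apply/andP; split; lra.
by rewrite in_itv /= => /cst ->; rewrite cst ?ltxx //; apply/andP; split; lra.
Qed.

Lemma open_cube_sub n : open_cube R n `<=` cube R n.
Proof. by move=> u u01 i; have /andP[h1 h2] := u01 i; rewrite !ltW. Qed.

Lemma compact_cube n : compact (cube R n).
Proof.
have -> : cube R n = [set v | forall i, `[0, 1]%classic (v ord0 i)].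
  by apply/seteqP; split => u u01 i; move: (u01 i); rewrite /= in_itv.
exact: (@rV_compact R n (fun=> `[0, 1]%classic) (fun=> @segment_compact R 0 1)).
Qed.

Lemma cube_sub_closure n : cube R n `<=` closure (open_cube R n).
Proof.
move=> u u01 N /nbhs_ballP[e /= e0 eN].
pose d := Num.min (e / 2) 2^-1.
have d0 : 0 < d by rewrite lt_min; apply/andP; split; lra.
have [de d1] : d <= e / 2 /\ d <= 2^-1 by rewrite /d !ge_min !lexx orbT.
exists (\row_i ((1 - d) * u ord0 i + d / 2)); split.
  move=> i; rewrite mxE; have /andP[h1 h2] := u01 i.
  by apply/andP; split; nra.
apply: eN; split => // i j; rewrite ord1 mxE /ball /= ltr_norml.
by have /andP[h1 h2] := u01 j; apply/andP; split; nra.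
Qed.

End RealLine.

(** * Points of a mapping torus *)

Section MappingTorusPoints.
Context {R : realType} {F : topologicalType} (A : set F) (psi : F -> F).
Local Notation X := (@mapping_torus R F A psi).
Local Notation base := (@mt_base R F A psi).
Local Notation cyl := (@mt_cyl R F A psi).

(** A normal form for points of the quotient: the base point, or the pair [(x, t)] when [t] is
    strictly inside. It is constant on glued pairs, so equalities in the mapping torus can be read
    off from it. *)
Definition mt_sum_coord (a : @mt_sum R F A) : F + F * R :=
  match a with
  | existT b v =>
    match b return @mt_summand R F A b -> F + F * R with
    | true => fun p => let: (x, t) := set_val p in
        if t == 0 then inl x else if t == 1 then inl (psi x) else inr (x, t)
    | false => fun x => inl x
    end v
  end.

Definition mt_coord (y : X) : F + F * R := mt_sum_coord (repr y).

Lemma mt_sum_coord_rel a b :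
  clos_refl_sym_trans (@mt_sum R F A) (@mt_glue R F A psi) a b ->
  mt_sum_coord a = mt_sum_coord b.
Proof.
elim=> {a b} // [a b [p|p]|a b c _ -> _ ->] //=.
- by case: (set_val p) => x t /= ->; rewrite eqxx.
- by case: (set_val p) => x t /= ->; rewrite oner_eq0 eqxx.
Qed.

Lemma mt_coord_proj a : mt_coord (mt_proj psi a) = mt_sum_coord a.
Proof.
rewrite /mt_coord; apply: mt_sum_coord_rel.
have /eqmodP/asboolP // : (repr (mt_proj psi a) = a %[mod {eq_quot (@mt_equiv R F A psi)}])%qT.
exact: (reprK (mt_proj psi a)).
Qed.

Lemma mt_proj_glue a b : @mt_glue R F A psi a b -> mt_proj psi a = mt_proj psi b.
Proof.
move=> ab; suff : (a = b %[mod {eq_quot (@mt_equiv R F A psi)}])%qT by [].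
by apply/eqmodP/asboolP; exact: rst_step.
Qed.

Lemma mt_coord_base x : mt_coord (base x) = inl x.
Proof. exact: mt_coord_proj. Qed.

Lemma mt_cylE x t (p : set_type (@cylinder R F A)) : set_val p = (x, t) ->
  cyl x t = mt_proj psi (in_cyl p).
Proof.
move=> px; rewrite /mt_cyl; case: insubP => [u _ ux|] /=.
  by congr (mt_proj _ (in_cyl _)); apply: val_inj; rewrite ux -px.
by rewrite -px => /negP; case; exact: (valP p).
Qed.

Lemma mt_cyl_in x t : A x -> 0 <= t <= 1 ->
  exists2 p : set_type (@cylinder R F A), set_val p = (x, t) &
    cyl x t = mt_proj psi (in_cyl p).
Proof.
move=> Ax t01; have xt : (x, t) \in @cylinder R F A.
  by apply/mem_set; split => //=; rewrite in_itv.
by exists (exist _ (x, t) xt) => //; exact: mt_cylE.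
Qed.

Lemma mt_coord_cyl x t : A x -> 0 < t < 1 -> mt_coord (cyl x t) = inr (x, t).
Proof.
move=> Ax /andP[t0 t1]; have [|p px ->] := @mt_cyl_in x t Ax; first by rewrite !ltW.
by rewrite mt_coord_proj /= px (gt_eqF t0) (lt_eqF t1).
Qed.

Lemma mt_cyl0 x : A x -> cyl x 0 = base x.
Proof.
move=> Ax; have [|p px ->] := @mt_cyl_in x 0 Ax; first by rewrite lexx ler01.
by apply: mt_proj_glue; have := @mt_glue0 R F A psi p; rewrite px; exact.
Qed.

Lemma mt_cyl1 x : A x -> cyl x 1 = base (psi x).
Proof.
move=> Ax; have [|p px ->] := @mt_cyl_in x 1 Ax; first by rewrite lexx ler01.
by apply: mt_proj_glue; have := @mt_glue1 R F A psi p; rewrite px; exact.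
Qed.

Lemma mt_proj_continuous : continuous (@mt_proj R F A psi).
Proof. exact: pi_continuous. Qed.

Lemma mt_base_continuous : continuous base.
Proof.
move=> x; apply: (continuous_comp _ _); last exact: mt_proj_continuous.
exact: (@existT_continuous _ (@mt_summand R F A) false x).
Qed.

Lemma mt_cyl_continuous :
  {within A `*` `[0, 1], continuous (fun p : F * R => cyl p.1 p.2)}.
Proof.
apply/subspace_sigL_continuousP.
rewrite (_ : sigL _ _ = fun p => mt_proj psi (in_cyl p)).
  move=> p; apply: (continuous_comp _ _); last exact: mt_proj_continuous.
  exact: (@existT_continuous _ (@mt_summand R F A) true p).
by apply/funext => p; apply: mt_cylE; rewrite -surjective_pairing.
Qed.

Lemma mt_pointP (y : X) : (exists x, y = base x) \/
  (exists x t, [/\ A x, 0 < t < 1 & y = cyl x t]).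
Proof.
rewrite -[y]reprK; case: (repr y) => -[p|x]; last by left; exists x.
have [Ax] := set_mem (valP p); rewrite /= in_itv /= => /andP[t0 t1].
have e : cyl (val p).1 (val p).2 = mt_proj psi (in_cyl p).
  by apply: mt_cylE; rewrite -surjective_pairing.
have -> : (\pi_X (existT (@mt_summand R F A) true p))%qT = mt_proj psi (in_cyl p).
  by [].
rewrite -e; move: t0; rewrite le_eqVlt => /predU1P[<-|t0].
  by left; rewrite mt_cyl0 //; eexists.
move: t1; rewrite le_eqVlt => /predU1P[->|t1].
  by left; rewrite mt_cyl1 //; eexists.
by right; exists (val p).1, (val p).2; rewrite t0 t1.
Qed.

Lemma mt_fun_continuous (a : F -> R) (b : F * R -> R) :
  continuous a -> {within A `*` `[0, 1], continuous b} ->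
  (forall x, A x -> b (x, 0) = a x) -> (forall x, A x -> b (x, 1) = a (psi x)) ->
  exists g : X -> R, [/\ continuous g, forall x, g (base x) = a x &
    forall x t, A x -> 0 <= t <= 1 -> g (cyl x t) = b (x, t)].
Proof.
move=> ac bc b0 b1.
pose h (s : @mt_sum R F A) : R :=
  match s with
  | existT i v =>
    match i return @mt_summand R F A i -> R with
    | true => fun p => b (set_val p) | false => fun x => a x end v end.
have hrel s s' : clos_refl_sym_trans (@mt_sum R F A) (@mt_glue R F A psi) s s' -> h s = h s'.
  elim=> {s s'} // [s s' [p|p]|s s' s'' _ -> _ ->] //=.
  - have [Ap _] := set_mem (valP p).
    by move=> p0; rewrite -b0 // -p0 -surjective_pairing.
  - have [Ap _] := set_mem (valP p).
    by move=> p1; rewrite -b1 // -p1 -surjective_pairing.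
pose g (y : X) := h (repr y).
have gp s : g (mt_proj psi s) = h s.
  apply: hrel.
  have /eqmodP/asboolP // : (repr (mt_proj psi s) = s %[mod {eq_quot (@mt_equiv R F A psi)}])%qT.
  exact: (reprK (mt_proj psi s)).
exists g; split; last 2 first.
- by move=> x; rewrite gp.
- by move=> x t Ax t01; have [p px ->] := mt_cyl_in Ax t01; rewrite gp /= px.
apply/quotient_continuous; rewrite (_ : _ \o _ = h); last first.
  by apply/funext => s; exact: gp.
rewrite (_ : h = unstable.sigT_fun (fun i v => h (existT (@mt_summand R F A) i v))); last first.
  by apply/funext => -[i v].
apply: sigT_continuous => -[].
  by move/subspace_sigL_continuousP : bc.
exact: ac.
Qed.

(* Continuous functions to R separate the points of the mapping torus. *)
Lemma mt_hausdorff : hausdorff_space F -> compact [set: F] ->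
  {within A, continuous psi} -> hausdorff_space X.
Proof.
move=> hF cF psic.
suff sep (y z : X) : y <> z -> exists2 g : X -> R, continuous g & g y != g z.
  move=> y z clyz; apply: contrapT => /sep[g gc gyz].
  have [U [V [oU oV Uy Vz UV]]] := hausdorff_sep (@Rhausdorff R) (elimN eqP gyz).
  have [||t [Ut Vt]] := clyz (g @^-1` U) (g @^-1` V).
  - by apply: gc; exact: open_nbhs_nbhs.
  - by apply: gc; exact: open_nbhs_nbhs.
  by have : (U `&` V) (g t) by []; rewrite UV.
have sepF (x x' : F) : x <> x' ->
    exists a : F -> R, [/\ continuous a, a x = 0 & a x' = 1].
  move=> xx'.
  have accF : accessible_space F by exact: hausdorff_accessible.
  have : uniform_separator [set x] [set x'].
    apply: normal_completely_regular => //; first exact: compact_normal.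
    exact: accessible_closed_set1.
  move=> /(@uniform_separatorP F R)[a [ac _ a0 a1]]; exists a; split => //.
    by apply: a0; exists x.
  by apply: a1; exists x'.
have cst0 : continuous (fun _ : F => 0 : R) by move=> ?; exact: cvg_cst.
(* The factor [t * (1 - t)] vanishes at both ends of the cylinder, so these functions extend by 0 to
   the base for any [k] and [m]. *)
have interior (k : F -> R) (m : R -> R) : continuous k -> continuous m ->
    exists g : X -> R, [/\ continuous g, forall x, g (base x) = 0 &
      forall x t, A x -> 0 < t < 1 -> g (cyl x t) = t * (1 - t) * m t * k x].
  move=> kc mc.
  have [|||g [gc gb gi]] := @mt_fun_continuous (fun=> 0)
      (fun p => p.2 * (1 - p.2) * m p.2 * k p.1) cst0.
  - apply: continuous_subspaceT => p.
    apply: cvgM; last by apply: (continuous_comp _ (kc p.1)); exact: cvg_fst.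
    apply: cvgM; last by apply: (continuous_comp _ (mc p.2)); exact: cvg_snd.
    apply: cvgM; first exact: cvg_snd.
    by apply: cvgB; [exact: cvg_cst|exact: cvg_snd].
  - by move=> x _ /=; rewrite !mul0r.
  - by move=> x _ /=; rewrite subrr mulr0 !mul0r.
  exists g; split => // x t Ax /andP[t0 t1].
  by rewrite gi // !ltW.
have cst1 : continuous (fun _ : F => 1 : R) by move=> ?; exact: cvg_cst.
have cstR : continuous (fun _ : R => 1 : R) by move=> ?; exact: cvg_cst.
have pos (t : R) : 0 < t < 1 -> 0 < t * (1 - t).
  by move=> /andP[t0 t1]; apply: mulr_gt0 => //; rewrite subr_gt0.
have half x x' t : A x' -> 0 < t < 1 ->
    exists2 g : X -> R, continuous g & g (base x) != g (cyl x' t).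
  move=> Ax' t01; have [g [gc gb gi]] := interior _ _ cst1 cstR.
  by exists g => //; rewrite gb gi // !mulr1 lt_eqF // pos.
case: (mt_pointP y) (mt_pointP z) => [[x ->]|[x [t [Ax t01 ->]]]]
  [[x' ->]|[x' [t' [Ax' t'01 ->]]]] yz.
- have [|a [ac a0 a1]] := sepF x x'; first by move=> xx'; apply: yz; rewrite xx'.
  (* For two base points, [a] is interpolated along the cylinder with its pullback by [psi], as the
     gluing at height 1 requires. *)
  have [|||g [gc gb _]] := @mt_fun_continuous a
      (fun p => (1 - p.2) * a p.1 + p.2 * a (psi p.1)) ac.
  + have c1 : {within A `*` `[0, 1],
        continuous (fun p : F * R => (1 - p.2) * a p.1)}.
      apply: continuous_subspaceT => p; apply: cvgM.
        by apply: cvgB; [exact: cvg_cst|exact: cvg_snd].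
      by apply: (continuous_comp _ (ac p.1)); exact: cvg_fst.
    have c2 : {within A `*` `[0, 1], continuous (fun p : F * R => p.2)}.
      by apply: continuous_subspaceT => p; exact: cvg_snd.
    have c3 : {within A `*` `[0, 1], continuous (fun p : F * R => a (psi p.1))}.
      apply/within_continuousP => p [Ap _] V nV.
      have/within_continuousP/(_ _ Ap _ (ac _ _ nV)) := psic.
      move=> nW; exists ([set y | A y -> V (a (psi y))], setT) => /=.
        by split => //; exact: filterT.
      by move=> q [/= q1 _] [Aq _]; exact: q1.
    by move=> p; apply: cvgD; [exact: c1|apply: cvgM; [exact: c2|exact: c3]].
  + by move=> u _ /=; rewrite subr0 mul1r mul0r addr0.
  + by move=> u _ /=; rewrite subrr mul1r mul0r add0r.
  by exists g => //; rewrite !gb a0 a1 eq_sym oner_eq0.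
- exact: half.
- by have [g gc ne] := half x' x t Ax t01; exists g => //; rewrite eq_sym.
- have [xx'|/eqP xx'] := eqVneq x x'; last first.
    have [k [kc k0 k1]] := sepF x x' xx'.
    have [g [gc gb gi]] := interior _ _ kc cstR; exists g => //.
    by rewrite !gi // k0 k1 mulr0 !mulr1 lt_eqF // pos.
  have [g [gc gb gi]] := interior _ _ cst1 cstR.
  (* Over a single [x], [t * (1 - t)] confuses [t] with [1 - t]; a further factor [t] tells them
     apart. *)
  have [gg|] := eqVneq (g (cyl x t)) (g (cyl x' t')); last by exists g.
  have idc : continuous (fun t : R => t) by move=> ?; exact: cvg_id.
  have [g' [gc' gb' gi']] := interior _ _ cst1 idc; exists g' => //.
  apply/negP => /eqP; move: gg; rewrite !gi // !gi' // !mulr1 => ->.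
  move=> /(mulfI (lt0r_neq0 (pos _ t'01))) tt'.
  by apply: yz; rewrite xx' tt'.
Qed.

End MappingTorusPoints.

(** * Cells of a graph *)

Section Misc.
Context {R : realType}.

Lemma finite_max (A : set R) : finite_set A -> A !=set0 ->
  exists2 x, A x & forall y, A y -> y <= x.
Proof.
move=> /finite_seqP[s ->]; elim: s => [[]//|z s IH] _.
have [s0|s0] := pselect ([set` s] !=set0).
  have [x xs xmax] := IH s0; exists (Num.max z x).
    by rewrite /= inE /Num.max; case: ifP; rewrite ?eqxx // xs orbT.
  by move=> y /=; rewrite inE => /orP[/eqP ->|/xmax yx]; rewrite le_max ?lexx ?yx ?orbT.
exists z; first by rewrite /= inE eqxx.
move=> y; rewrite /= inE => /orP[/eqP -> //|ys].
by exfalso; apply: s0; exists y.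
Qed.

Lemma finite_min (A : set R) : finite_set A -> A !=set0 ->
  exists2 x, A x & forall y, A y -> x <= y.
Proof.
move=> fA [a Aa].
have [||x [y Ay <-] xm] := @finite_max (-%R @` A).
- exact: finite_image.
- by exists (- a), a.
by exists y => // z Az; rewrite -lerN2; apply: xm; exists z.
Qed.

Lemma locally_injective_comp (X Y Z : topologicalType) (A : set X) (B : set Y)
    (f : X -> Y) (g : Y -> Z) :
  {within A, continuous f} -> f @` A `<=` B ->
  locally_injective A f -> locally_injective B g ->
  locally_injective A (g \o f).
Proof.
move=> fc fAB fi gi x Ax; have [U nU Ui] := fi x Ax.
have [|V nV Vi] := gi (f x); first by apply: fAB; exists x.
have/within_continuousP/(_ x Ax V nV) nf := fc.
exists (U `&` [set y | A y -> V (f y)]); first exact: filterI.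
move=> s t /set_mem[As [Us Vs]] /set_mem[At [Ut Vt]] /= gfst.
apply: Ui; [exact/mem_set|exact/mem_set|].
by apply: Vi => //; apply/mem_set; split; [apply: fAB; exists s|exact: Vs|
  apply: fAB; exists t|exact: Vt].
Qed.

Lemma row_continuous (X : topologicalType) n (f : X -> 'I_n -> R) :
  (forall j, continuous (f ^~ j)) -> continuous (fun x => \row_j f x j).
Proof.
move=> fc x; apply/cvg_ballP => e e0.
have : \forall y \near x, forall j, ball (f x j) e (f y j).
  by apply: filter_forall => j; have /cvg_ballP := fc j x; exact.
by apply: filterS => y fy; split => // i j; rewrite !mxE.
Qed.

Lemma row0_continuous n : continuous (fun s : R => const_mx s : 'rV[R]_n).
Proof.
rewrite (_ : (fun s => _) = fun s => \row_j (fun s _ => s) s j).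
  by apply: row_continuous => j s; exact: cvg_id.
by apply/funext => s; apply/rowP => j; rewrite !mxE.
Qed.

End Misc.

Lemma compact_finite_bigcup (T : topologicalType) (I : choiceType) (D : set I)
    (A : I -> set T) :
  finite_set D -> (forall i, compact (A i)) -> compact (\bigcup_(i in D) A i).
Proof.
move=> /finite_seqP[s ->] cA; elim: s => [|i s IH].
  by rewrite bigcup_seq big_nil; exact: compact0.
by rewrite bigcup_seq big_cons -bigcup_seq; exact: compactU.
Qed.

Section CWComplex.
Context {R : realType} {T : topologicalType} (S : cell_structure R T).
Hypothesis cw : is_cw_complex S.

Lemma open_cell_nonempty (c : cell S) : exists y, open_cell c y.
Proof.
exists (cmap S c (const_mx 2^-1)), (const_mx 2^-1) => // i.
by rewrite mxE; apply/andP; split; lra.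
Qed.

Lemma open_cell_ex x : exists c : cell S, open_cell c x.
Proof. by have : setT x by []; rewrite -(cw_cover cw) => -[c _ cx]; exists c. Qed.

Lemma open_cell_inj (c d : cell S) x : open_cell c x -> open_cell d x -> c = d.
Proof. by move=> cx dx; apply: (cw_disjoint cw) => //; exists x. Qed.

Lemma cmap_boundary (c : cell S) u : cube R (dim c) u -> ~ open_cube R (dim c) u ->
  exists d : cell S, (dim d < dim c)%N /\ open_cell d (cmap S c u).
Proof.
move=> cu nu; have [B [_ dB cB]] := cw_closure_finite cw c.
have [|d Bd dx] := cB (cmap S c u); first by exists u.
by exists d; split => //; exact: dB.
Qed.

Lemma compact_closed_cell (c : cell S) : compact (closed_cell c).
Proof.
by apply: continuous_compact; [exact: cw_continuous|exact: compact_cube].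
Qed.

Lemma open_sub_closed_cell (c : cell S) : open_cell c `<=` closed_cell c.
Proof. by apply: image_subset; exact: open_cube_sub. Qed.

End CWComplex.

Section Graph.
Context {R : realType} {F : topologicalType} (S : cell_structure R F).
Hypothesis F_graph : is_graph S.
Let cw : is_cw_complex S := F_graph.1.

(* Cells of dimension 0 and 1 are both parametrized by the unit interval,
   which removes the dependency on the dimension. *)
Definition chi (c : cell S) (s : R) : F := cmap S c (const_mx s).

Lemma dim_graph (c : cell S) : dim c = 0%N \/ dim c = 1%N.
Proof. by have := F_graph.2 c; case: (dim c) => [|[|]]; [left|right|]. Qed.

Lemma row_const n (P : R -> Prop) (u : 'rV[R]_n) : (n <= 1)%N ->
  (exists s, P s) -> (forall i, P (u ord0 i)) -> exists2 s, P s & u = const_mx s.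
Proof.
case: n u => [|[|//]] u _ [s Ps] Pu.
  by exists s => //; apply/rowP => -[].
by exists (u ord0 ord0) => //; apply/rowP => i; rewrite mxE ord1.
Qed.

Lemma open_cellE (c : cell S) : open_cell c = chi c @` `]0, 1[.
Proof.
apply/seteqP; split => [_ [u u01 <-]|_ [s + <-]].
  have [||s s01 ->] := @row_const _ (fun s => 0 < s < 1) u (F_graph.2 c).
  - by exists 2^-1; apply/andP; split; lra.
  - exact: u01.
  by exists s => //; rewrite /= in_itv.
by rewrite /= in_itv /= => s01; exists (const_mx s) => // i; rewrite mxE.
Qed.

Lemma closed_cellE (c : cell S) : closed_cell c = chi c @` `[0, 1].
Proof.
apply/seteqP; split => [_ [u u01 <-]|_ [s + <-]].
  have [||s s01 ->] := @row_const _ (fun s => 0 <= s <= 1) u (F_graph.2 c).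
  - by exists 0; rewrite lexx ler01.
  - exact: u01.
  by exists s => //; rewrite /= in_itv.
by rewrite /= in_itv /= => s01; exists (const_mx s) => // i; rewrite mxE.
Qed.

Lemma chi_continuous (c : cell S) : {within `[0, 1], continuous (chi c)}.
Proof.
apply/within_continuousP => s; rewrite /= in_itv /= => s01 V nV.
have cs : cube R (dim c) (const_mx s) by move=> i; rewrite mxE.
have/within_continuousP/(_ _ cs V nV) nc := @cw_continuous _ _ _ cw c.
have nW : nbhs s [set t | cube R (dim c) (const_mx t) -> V (cmap S c (const_mx t))].
  exact: @row0_continuous R (dim c) s _ nc.
apply: filterS nW => t tV.
by rewrite /= in_itv /= => t01; apply: tV => i; rewrite mxE.
Qed.

Lemma chi_inj (c : cell S) : dim c = 1%N -> set_inj `]0, 1[ (chi c).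
Proof.
move=> c1 s t /set_mem s01 /set_mem t01 st.
have o x : `]0, 1[%classic x -> const_mx x \in open_cube R (dim c).
  by rewrite /= in_itv /= => x01; apply/mem_set => i; rewrite mxE.
have /rowP := cw_injective cw (o _ s01) (o _ t01) st.
by move=> /(_ (cast_ord (esym c1) ord0)); rewrite !mxE.
Qed.

Lemma chi_cst (c : cell S) s t : dim c = 0%N -> chi c s = chi c t.
Proof.
by move=> c0; congr (cmap S c _); apply/rowP => -[i h]; exfalso; move: h; rewrite c0.
Qed.

Lemma chi_open (c : cell S) s : 0 < s < 1 -> open_cell c (chi c s).
Proof. by move=> s01; rewrite open_cellE; exists s; rewrite //= in_itv. Qed.

Lemma chi_vertex (v : cell S) s : dim v = 0%N -> open_cell v (chi v s).
Proof.
by move=> v0; rewrite (chi_cst s 2^-1 v0); apply: chi_open; apply/andP; split; lra.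
Qed.

Lemma open_cell_vertex (v : cell S) x : dim v = 0%N -> open_cell v x ->
  forall s, x = chi v s.
Proof. by move=> v0; rewrite open_cellE => -[t _ <-] s; exact: chi_cst. Qed.

Definition vertex (x : F) : Prop := exists2 v : cell S, dim v = 0%N & open_cell v x.

Lemma skeleton0 : skeleton S 0 = vertex.
Proof.
apply/seteqP; split => x; first by move=> [v /=]; rewrite leqn0 => /eqP v0 vx; exists v.
by move=> [v v0 vx]; exists v => //=; rewrite v0.
Qed.

Lemma chi_end (c : cell S) : vertex (chi c 0) /\ vertex (chi c 1).
Proof.
have [c0|c1] := dim_graph c; first by split; exists c => //; exact: chi_vertex.
suff ve s : 0 <= s <= 1 -> ~ 0 < s < 1 -> vertex (chi c s).
  by split; apply: ve; rewrite ?lexx ?ler01 ?ltxx ?andbF.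
move=> s01 ns.
have [||d [dc dx]] := @cmap_boundary _ _ _ cw c (const_mx s).
- by move=> i; rewrite mxE.
- by move=> /(_ (cast_ord (esym c1) ord0)); rewrite mxE.
by exists d => //; move: dc; rewrite c1 ltnS leqn0 => /eqP.
Qed.

(** The two ends of a loop have the same image, so injectivity holds only after removing a
    neighbourhood of one end. *)
Lemma chi_locally_injective (c : cell S) : dim c = 1%N ->
  locally_injective (`[0, 1] : set R) (chi c).
Proof.
move=> c1 s; rewrite /= in_itv /= => s01.
have disj t x : 0 < t < 1 -> vertex x -> chi c t <> x.
  move=> t01 [v v0 vx] e; move: vx; rewrite -e => vx.
  by move: c1; rewrite (open_cell_inj cw (chi_open c t01) vx) v0.
have [v0 v1] := chi_end c.
have [s0|s0] := eqVneq s 0; [|have [s1|s1] := eqVneq s 1].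
- exists `]-oo, 1[%classic.
    by apply: open_nbhs_nbhs; split; [exact: interval_open|rewrite s0 /= in_itv /= ltr01].
  move=> x y /set_mem[] + + /set_mem[]; rewrite /= !in_itv /= => /andP[x0 _] x1 /andP[y0 _] y1.
  move: x0; rewrite le_eqVlt => /predU1P[<-|x0];
  move: y0; rewrite le_eqVlt => /predU1P[<-|y0] // e.
  + by exfalso; apply: (disj y _ _ v0) => //; rewrite y0.
  + by exfalso; apply: (disj x _ _ v0) => //; rewrite x0.
  + by apply: (chi_inj c1) => //; apply/mem_set; rewrite /= in_itv /= ?x0 ?y0.
- exists `]0, +oo[%classic.
    by apply: open_nbhs_nbhs; split; [exact: interval_open|rewrite s1 /= in_itv /= ltr01].
  move=> x y /set_mem[] + + /set_mem[]; rewrite /= !in_itv /= !andbT => /andP[_ x0] x1 /andP[_ y0] y1.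
  move: x0; rewrite le_eqVlt => /predU1P[->|x0];
  move: y0; rewrite le_eqVlt => /predU1P[->|y0] // e.
  + by exfalso; apply: (disj y _ _ v1) => //; rewrite y0 andbT.
  + by exfalso; apply: (disj x _ _ v1) => //; rewrite x0 andbT.
  + by apply: (chi_inj c1) => //; apply/mem_set; rewrite /= in_itv /= ?x0 ?y0 andbT.
- exists `]0, 1[%classic.
    apply: open_nbhs_nbhs; split; [exact: interval_open|rewrite /= in_itv /=].
    by move: s01 => /andP[h0 h1]; rewrite !lt_neqAle h0 h1 eq_sym s0 s1.
  by move=> x y /set_mem[_ x01] /set_mem[_ y01]; apply: chi_inj; rewrite ?inE.
Qed.

Hypothesis F_finite : is_finite_complex S.

Lemma graph_compact : compact [set: F].
Proof.
have -> : [set: F] = \bigcup_(c in [set: cell S]) closed_cell c.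
  apply/seteqP; split => // x _; have [c cx] := open_cell_ex cw x.
  by exists c => //; exact: open_sub_closed_cell.
exact/compact_finite_bigcup/compact_closed_cell.
Qed.

Lemma finite_vertices : finite_set vertex.
Proof.
apply: (@sub_finite_set _ _ [set chi c 0 | c in [set: cell S]]).
  by move=> x [v v0 vx]; exists v => //; rewrite -(open_cell_vertex v0 vx 0).
exact: finite_image.
Qed.

(** The complement is the finite union of the other closed cells: these meet no edge but their own,
    since boundary points lie in cells of smaller dimension. *)
Lemma open_edge (e : cell S) : dim e = 1%N -> open (open_cell e).
Proof.
move=> e1; rewrite -closedC.
have -> : ~` open_cell e = \bigcup_(c in [set c : cell S | c <> e]) closed_cell c.
  apply/seteqP; split => [x nex|_ [c /= ce [u cu <-]] ex].
    have [c cx] := open_cell_ex cw x; exists c; last exact: open_sub_closed_cell.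
    by move=> ce; apply: nex; rewrite -ce.
  have [ou|nu] := pselect (open_cube R (dim c) u).
    by apply: ce; apply: (open_cell_inj cw _ ex); exists u.
  have [d [dc dx]] := cmap_boundary cw cu nu.
  have := dc; rewrite (open_cell_inj cw dx ex) e1.
  by have := F_graph.2 c; case: (dim c) => [|[]].
apply: closed_bigcup; first exact: sub_finite_set F_finite.
move=> c _; apply: compact_closed; first exact: cw_hausdorff cw.
exact: compact_closed_cell.
Qed.

(** A point inside an edge has a single preimage in the closed interval, so [tube] gives continuity
    of the coordinate. *)
Lemma chi_preimage_continuous (e : cell S) (Z : topologicalType) (U : set Z)
    (p : Z -> F) (s : Z -> R) : dim e = 1%N -> {within U, continuous p} ->
  (forall z, U z -> 0 < s z < 1 /\ chi e (s z) = p z) -> {within U, continuous s}.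
Proof.
move=> e1 pc sP; apply/within_continuousP => z Uz W; rewrite nbhsE => -[N [oN Nz] NW].
have [s01 es] := sP z Uz.
have ze : open_cell e (p z) by rewrite -es; exact: chi_open.
have [|V [oV Vz VN]] := tube (x := p z) (cw_hausdorff cw) (@segment_compact R 0 1)
    (@chi_continuous e) oN.
  move=> t [/= t01 et]; suff -> : t = s z by [].
  have t01' : 0 < t < 1.
    move: t01; rewrite in_itv /= => /andP[]; rewrite !le_eqVlt.
    have [[v v0 v0x] [w w0 w1x]] := chi_end e.
    move=> /predU1P[t0|t0].
      by move: v0 e1; rewrite (open_cell_inj cw v0x (d := e)) ?t0 ?et // => ->.
    move=> /predU1P[t1|t1]; last by rewrite t0 t1.
    by move: w0 e1; rewrite (open_cell_inj cw w1x (d := e)) -?t1 ?et // => ->.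
  by apply: (chi_inj e1); rewrite ?inE /= ?in_itv //= et es.
have/within_continuousP/(_ z Uz V (open_nbhs_nbhs (conj oV Vz))) := pc.
apply: filterS => t tV Ut; apply: NW; apply: VN; have [t01 et] := sP t Ut.
split; last by rewrite /= et; exact: tV.
by rewrite /= in_itv /=; move: t01 => /andP[h0 h1]; rewrite !ltW.
Qed.

Lemma not_vertex_edge x : ~ vertex x -> exists2 e : cell S, dim e = 1%N & open_cell e x.
Proof.
move=> nx; have [e ex] := open_cell_ex cw x; exists e => //.
by have [e0|//] := dim_graph e; exfalso; apply: nx; exists e.
Qed.

Lemma edge_not_vertex (e : cell S) x : dim e = 1%N -> open_cell e x -> ~ vertex x.
Proof.
by move=> e1 ex [v v0 vx]; move: e1; rewrite (open_cell_inj cw ex vx) v0.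
Qed.

(** Between two vertices the path stays in one open edge by connectedness. Its coordinate there
    extends to both ends by [lift_extension], and [locally_injective_ends] excludes a return to the
    initial end. *)
Lemma edge_passage (p : R -> F) a b : a < b ->
  {within `[a, b], continuous p} -> locally_injective (`]a, b[ : set R) p ->
  vertex (p a) -> vertex (p b) -> (forall s, a < s < b -> ~ vertex (p s)) ->
  exists e (theta : R -> R), [/\ dim e = 1%N, {within `[a, b], continuous theta},
    (forall s, a <= s <= b -> 0 <= theta s <= 1 /\ chi e (theta s) = p s),
    (forall s, a < s < b -> 0 < theta s < 1) &
    (theta a = 0 /\ theta b = 1) \/ (theta a = 1 /\ theta b = 0)].
Proof.
move=> ab pc pli va vb nv.
have mab : a < (a + b) / 2 < b by apply/andP; split; lra.
have [e e1 em] := not_vertex_edge (nv _ mab).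
have sub_itv : `]a, b[ `<=` `[a, b] by exact: subset_itv_oo_cc.
have pe s : a < s < b -> open_cell e (p s).
  pose B := \bigcup_(c in [set c : cell S | c <> e /\ dim c = 1%N]) open_cell c.
  have sub : p @` `]a, b[ `<=` open_cell e.
    apply: (connected_in_one (B := B)).
    - apply: connected_continuous_connected; last exact: continuous_subspaceW pc.
      apply/connected_intervalP; exact: interval_is_interval.
    - exact: open_edge.
    - by apply: bigcup_open => c [_ c1]; exact: open_edge.
    - apply/seteqP; split => // x [ex [c [ce _] cx]]; apply: ce.
      exact: open_cell_inj cx ex.
    - move=> _ [t + <-]; rewrite /= in_itv /= => tab.
      have [c c1 ct] := not_vertex_edge (nv t tab).
      by have [<-|ce] := pselect (c = e); [left|right; exists c].
    - by exists (p ((a + b) / 2)); split => //; exists ((a + b) / 2); rewrite //= in_itv.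
  by move=> sab; apply: sub; exists s; rewrite //= in_itv.
have /choice[u uP] : forall s, exists t, a < s < b -> 0 < t < 1 /\ chi e t = p s.
  move=> s; have [sab|nsab] := pselect (a < s < b); last by exists 0.
  have := pe s sab; rewrite open_cellE => -[t + et]; rewrite /= in_itv /= => t01.
  by exists t.
have [||||||h [hc hK hu]] := @lift_extension R R F `[a, b]%classic `]a, b[%classic
    `[0, 1]%classic (chi e) p u (@Rhausdorff R) (cw_hausdorff cw) (@segment_compact _ _ _)
    (@chi_continuous e).
- move=> x; apply: finite_locally_injective_preimage.
  + exact: segment_compact.
  + exact: chi_locally_injective.
  + exact: finite_set1.
- exact: sub_itv.
- by move=> q; rewrite /= in_itv /=; exact: locally_connected_segment.
- exact: pc.
- apply: (chi_preimage_continuous e1); first exact: continuous_subspaceW pc.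
  by move=> z; rewrite /= in_itv /= => /uP.
- move=> z; rewrite /= in_itv /= => /uP[/andP[h0 h1] ez].
  by rewrite in_itv /= !ltW.
have hK' s : a <= s <= b -> 0 <= h s <= 1 /\ chi e (h s) = p s.
  by move=> sab; have := hK s; rewrite /= !in_itv; apply.
have ho s : a < s < b -> 0 < h s < 1.
  by move=> sab; rewrite hu ?in_itv //; have [] := uP s sab.
exists e, h; split => //.
have hne : h a != h b.
  apply: locally_injective_ends => // x xab; have [U nU Ui] := pli x xab.
  exists U => // s t sU tU hst; apply: Ui => //.
  move: sU tU => /set_mem[/sub_itv sab _] /set_mem[/sub_itv tab _].
  move: sab tab; rewrite /= !in_itv /= => sab tab.
  by have [_ <-] := hK' s sab; have [_ <-] := hK' t tab; rewrite hst.
have end01 s : a <= s <= b -> vertex (p s) -> h s = 0 \/ h s = 1.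
  move=> sab vs; have [/andP[]] := hK' s sab.
  rewrite le_eqVlt => /predU1P[<-|h0]; first by left.
  rewrite le_eqVlt => /predU1P[->|h1] es; first by right.
  exfalso; apply: (edge_not_vertex e1 _ vs); rewrite -es.
  by apply: chi_open; rewrite h0.
move: hne; have [||->|->] := end01 a; rewrite ?lexx ?ltW //;
have [||->|->] := end01 b; rewrite ?lexx ?ltW //; rewrite ?eqxx //; by [left|right].
Qed.

End Graph.

(** * Segments and darts *)

Section Segments.
Context {R : realType} {F : topologicalType} (S : cell_structure R F).
Context (H : set (cell S)) (psi : F -> F).
Hypotheses (F_graph : is_graph S) (F_finite : is_finite_complex S).
Hypotheses (H_subgraph : is_subcomplex H) (psi_cellular : cellular_on S S H psi).
Hypothesis psi_immersion : immersion (space_of H) psi.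
Let cw : is_cw_complex S := F_graph.1.
Local Notation chi := (@chi R F S).

Lemma chi_space (c : cell S) s : H c -> 0 <= s <= 1 -> space_of H (chi c s).
Proof.
move=> Hc s01; apply: (H_subgraph Hc).
by rewrite (closed_cellE F_graph); exists s; rewrite //= in_itv.
Qed.

Lemma psi_vertex x : space_of H x -> vertex S x -> vertex S (psi x).
Proof.
move=> Hx vx; rewrite -skeleton0; apply: (@psi_cellular 0%N).
by exists x => //; split => //; rewrite skeleton0.
Qed.

Lemma psi_chi_continuous (c : cell S) : H c ->
  {within (`[0, 1] : set R), continuous (psi \o chi c)}.
Proof.
move=> Hc; apply/within_continuousP => s /= s01 V nV.
have s01' : 0 <= s <= 1 by move: s01; rewrite in_itv.
have/within_continuousP/(_ _ (chi_space Hc s01') V nV) nW := psi_immersion.1.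
have/within_continuousP/(_ s s01 _ nW) := @chi_continuous _ _ _ F_graph c.
apply: filterS => t tV t01; apply: tV => //; apply: chi_space => //.
Qed.

Lemma psi_chi_locally_injective (c : cell S) : H c -> dim c = 1%N ->
  locally_injective (`[0, 1] : set R) (psi \o chi c).
Proof.
move=> Hc c1; apply: (locally_injective_comp (B := space_of H)).
- exact: chi_continuous.
- by move=> _ [s + <-]; rewrite /= in_itv /=; exact: chi_space.
- exact: chi_locally_injective.
- exact: psi_immersion.2.
Qed.

Definition vertex_times (e : cell S) : set R :=
  (`[0, 1] : set R) `&` (psi \o chi e) @^-1` vertex S.

Lemma vertex_timesP e s : vertex_times e s <-> 0 <= s <= 1 /\ vertex S (psi (chi e s)).
Proof. by rewrite /vertex_times /setI /= in_itv. Qed.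

Lemma finite_vertex_times (e : cell S) : H e -> dim e = 1%N ->
  finite_set (vertex_times e).
Proof.
move=> He e1; apply: finite_locally_injective_preimage.
- exact: segment_compact.
- exact: psi_chi_locally_injective.
- exact: finite_vertices.
Qed.

Lemma vertex_times_end (e : cell S) : H e -> vertex_times e 0 /\ vertex_times e 1.
Proof.
move=> He; have [v0 v1] := chi_end F_graph e.
split; apply/vertex_timesP; (split; first by rewrite ?lexx ?ler01);
  by apply: psi_vertex => //; apply: chi_space; rewrite ?lexx ?ler01.
Qed.

(* A segment (e, a, b) is an edge of the subdivision of H for which psi becomes
   combinatorial; a dart is a segment with a direction, starting at b if the
   boolean is true. *)
Definition segment : Type := (cell S * R * R)%type.
Definition dart : Type := (segment * bool)%type.

Definition is_segment (m : segment) : Prop :=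
  let: (e, a, b) := m in
  [/\ H e, dim e = 1%N, a < b, vertex_times e a /\ vertex_times e b &
      forall s, a < s < b -> ~ vertex_times e s].

Lemma segment_bounds e a b : is_segment (e, a, b) -> 0 <= a /\ b <= 1.
Proof. by move=> [_ _ _ [/vertex_timesP[/andP[? _] _] /vertex_timesP[/andP[_ ?] _]] _]. Qed.

Lemma finite_segments : finite_set is_segment.
Proof.
pose E := [set e : cell S | H e /\ dim e = 1%N].
have fE : finite_set E by exact: sub_finite_set F_finite.
apply: (@sub_finite_set _ _
  (\bigcup_(e in E) ((fun p : R * R => (e, p.1, p.2)) @` (vertex_times e `*` vertex_times e)))).
  by move=> [[e a] b] [He e1 _ [va vb] _]; exists e => //; exists (a, b).
apply: bigcup_finite => // e [He e1]; apply: finite_image.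
by apply: finite_setX; exact: finite_vertex_times.
Qed.

Lemma segment_right e r : H e -> dim e = 1%N -> vertex_times e r -> r < 1 ->
  exists b, is_segment (e, r, b).
Proof.
move=> He e1 vr r1.
have [||b [vb rb] bmin] := @finite_min R (vertex_times e `&` [set s | r < s]).
- by apply: sub_finite_set (finite_vertex_times He e1) => s [].
- by exists 1; split => //; exact: (vertex_times_end He).2.
exists b; split => // s /andP[rs sb] vs.
by have := bmin s (conj vs rs); rewrite leNgt sb.
Qed.

Lemma segment_left e r : H e -> dim e = 1%N -> vertex_times e r -> 0 < r ->
  exists a, is_segment (e, a, r).
Proof.
move=> He e1 vr r0.
have [||a [va ar] amax] := @finite_max R (vertex_times e `&` [set s | s < r]).
- by apply: sub_finite_set (finite_vertex_times He e1) => s [].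
- by exists 0; split => //; exact: (vertex_times_end He).1.
exists a; split => // s /andP[as_ sr] vs.
by have := amax s (conj vs sr); rewrite leNgt as_.
Qed.

Lemma segment_around e s : H e -> dim e = 1%N -> 0 <= s <= 1 ->
  ~ vertex S (psi (chi e s)) -> exists a b, is_segment (e, a, b) /\ a < s < b.
Proof.
move=> He e1 /andP[s0 s1] nv.
have [v0 v1] := vertex_times_end He.
have nvs : ~ vertex_times e s by move=> /vertex_timesP[].
have {}s0 : 0 < s.
  by rewrite lt_neqAle s0 andbT; apply/eqP => s0'; apply: nvs; rewrite -s0'.
have {}s1 : s < 1.
  by rewrite lt_neqAle s1 andbT; apply/eqP => s1'; apply: nvs; rewrite s1'.
have [||a [va as_] amax] := @finite_max R (vertex_times e `&` [set t | t < s]).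
- by apply: sub_finite_set (finite_vertex_times He e1) => t [].
- by exists 0.
have [||b [vb sb] bmin] := @finite_min R (vertex_times e `&` [set t | s < t]).
- by apply: sub_finite_set (finite_vertex_times He e1) => t [].
- by exists 1.
exists a, b; split; last by rewrite as_ sb.
split => //; first exact: lt_trans sb.
move=> t /andP[at_ tb] vt; have [ts|st|ts] := ltgtP t s.
- by have := amax t (conj vt ts); rewrite leNgt at_.
- by have := bmin t (conj vt st); rewrite leNgt tb.
- by apply: nvs; rewrite -ts.
Qed.

Lemma segment_unique e a b a' b' s : is_segment (e, a, b) -> is_segment (e, a', b') ->
  a < s < b -> a' < s < b' -> (e, a, b) = (e, a', b').
Proof.
move=> [_ _ _ [va vb] nv] [_ _ _ [va' vb'] nv'] /andP[as_ sb] /andP[as' sb'].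
have -> : a = a'.
  have [aa|aa|//] := ltgtP a a'.
  - by exfalso; apply: (nv a') => //; rewrite aa (lt_trans as').
  - by exfalso; apply: (nv' a) => //; rewrite aa (lt_trans as_).
suff -> : b = b' by [].
have [bb|bb|//] := ltgtP b b'.
- by exfalso; apply: (nv' b) => //; rewrite bb (lt_trans as').
- by exfalso; apply: (nv b') => //; rewrite bb (lt_trans as_).
Qed.

(** The image of a segment crosses one edge, [u.1], with coordinate [u.2]. The hypothesis stands
    under the existential so that a choice can be made for every triple. *)
Lemma segment_passage (m : segment) : exists u : cell S * (R -> R),
  is_segment m -> let: (e, a, b) := m in
  [/\ dim u.1 = 1%N, {within `[a, b], continuous u.2},
    (forall s, a <= s <= b -> 0 <= u.2 s <= 1 /\ chi u.1 (u.2 s) = psi (chi e s)),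
    (forall s, a < s < b -> 0 < u.2 s < 1) &
    (u.2 a = 0 /\ u.2 b = 1) \/ (u.2 a = 1 /\ u.2 b = 0)].
Proof.
case: m => -[e a] b; have [sm|] := pselect (is_segment (e, a, b)); last first.
  by exists (e, id).
have [a0 b1] := segment_bounds sm.
case: sm => He e1 ab [/vertex_timesP[_ va] /vertex_timesP[_ vb]] nv.
have sub : `[a, b] `<=` (`[0, 1] : set R) by move=> s; rewrite /= !in_itv /= => /andP[? ?]; apply/andP; split; lra.
have [|||||e' [th [? ? ? ? ?]]] := @edge_passage _ _ _ F_graph F_finite (psi \o chi e) a b ab.
- by apply: continuous_subspaceW (psi_chi_continuous He).
- move=> s sab; have [|U nU Ui] := psi_chi_locally_injective He e1 (x := s).
    by apply: sub; exact: subset_itv_oo_cc.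
  exists U => // x y /set_mem[xab xU] /set_mem[yab yU]; apply: Ui; apply/mem_set.
    by split => //; apply: sub; exact: subset_itv_oo_cc.
  by split => //; apply: sub; exact: subset_itv_oo_cc.
- by [].
- by [].
- move=> s sab vs; apply: (nv s sab); apply/vertex_timesP; split => //.
  by move: sab => /andP[h1 h2]; apply/andP; split; lra.
by exists (e', th).
Qed.

Definition passage (m : segment) : cell S * (R -> R) := projT1 (cid (segment_passage m)).
Definition target (m : segment) : cell S := (passage m).1.
Definition theta (m : segment) : R -> R := (passage m).2.

Lemma passageP e a b : is_segment (e, a, b) ->
  let m := (e, a, b) in
  [/\ dim (target m) = 1%N, {within `[a, b], continuous (theta m)},
    (forall s, a <= s <= b -> 0 <= theta m s <= 1 /\
       chi (target m) (theta m s) = psi (chi e s)),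
    (forall s, a < s < b -> 0 < theta m s < 1) &
    (theta m a = 0 /\ theta m b = 1) \/ (theta m a = 1 /\ theta m b = 0)].
Proof.
by move=> sm m; rewrite /target /theta /passage; case: cid => u /= /(_ sm).
Qed.


Definition dsource (d : dart) : cell S := d.1.1.1.
Definition dstart (d : dart) : R := if d.2 then d.1.2 else d.1.1.2.
Definition dend (d : dart) : R := if d.2 then d.1.1.2 else d.1.2.
Definition drev (d : dart) : dart := (d.1, ~~ d.2).
Definition dpt (d : dart) : F := chi (dsource d) (dstart d).

Lemma drevK : involutive drev.
Proof. by move=> [m b]; rewrite /drev /= negbK. Qed.

Lemma dstart_rev d : dstart (drev d) = dend d.
Proof. by case: d => m [] . Qed.

Lemma theta_start01 d : is_segment d.1 ->
  theta d.1 (dstart d) = 0 \/ theta d.1 (dstart d) = 1.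
Proof.
by case: d => -[[e a] b] [] /= sm; have [_ _ _ _ [[h1 h2]|[h1 h2]]] := passageP sm; auto.
Qed.

(** By the intermediate value theorem, [theta] takes near the start of the dart all the values close
    to its initial value 0 or 1. *)
Lemma dart_near d (U : set F) : is_segment d.1 -> nbhs (dpt d) U ->
  exists2 eps : R, 0 < eps & forall y, 0 < y < 1 ->
    `|y - theta d.1 (dstart d)| < eps ->
    exists s, [/\ d.1.1.2 < s < d.1.2, U (chi (dsource d) s) & theta d.1 s = y].
Proof.
case: d => -[[e a] b] i /= sm nU; rewrite /dstart /dsource /=.
have [a0 b1] := segment_bounds sm.
have [e1 thc thE tho thab] := passageP sm; set th := theta _ in thc thE tho thab *.
have ab : a < b by case: sm.
pose r := if i then b else a.
have r01 : `[0, 1]%classic r by rewrite /= in_itv /= /r; case: (i); apply/andP; split; lra.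
have/within_continuousP/(_ r r01 U nU)/nbhs_ballP[eta /= eta0 etaU] :=
  @chi_continuous _ _ _ F_graph e.
pose d := Num.min (eta / 2) ((b - a) / 2).
have d0 : 0 < d by rewrite lt_min; apply/andP; split; lra.
have [de dab] : d <= eta / 2 /\ d <= (b - a) / 2 by rewrite /d !ge_min !lexx orbT.
pose s1 := if i then b - d else a + d.
have s1ab : a < s1 < b by rewrite /s1; case: (i); apply/andP; split; lra.
have /andP[ths0 ths1] := tho _ s1ab.
have thr : th r = 0 \/ th r = 1 by have := @theta_start01 (e, a, b, i) sm.
exists `|th s1 - th r|; first by rewrite normr_gt0 subr_eq0; case: thr => ->; apply/eqP; lra.
move=> y /andP[y0 y1] yr.
have inU s : a < s < b -> `|s - r| <= d -> U (chi e s).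
  move=> sab srd; apply: etaU; last by rewrite /= in_itv /=; move: sab => /andP[h1 h2]; apply/andP; split; lra.
  by rewrite /ball /= distrC; apply: le_lt_trans srd _; lra.
have ivt (u v : R) : a <= u -> v <= b -> u <= v -> Num.min (th u) (th v) <= y <= Num.max (th u) (th v) ->
    exists2 s, s \in `[u, v] & th s = y.
  move=> au vb uv huv; apply: (IVT uv) => //.
  apply: continuous_subspaceW thc => x; rewrite /= !in_itv /= => /andP[h1 h2].
  by apply/andP; split; lra.
have yne : y != th r by case: thr => ->; apply/eqP; lra.
have [s [sab [sr es]]] : exists s, a <= s <= b /\ `|s - r| <= d /\ th s = y.
  have hy : Num.min (th s1) (th r) <= y <= Num.max (th s1) (th r).
    case: thr yr => ->.
      by rewrite !subr0 !gtr0_norm // (min_idPr (ltW ths0)) (max_idPl (ltW ths0)) => h; rewrite !ltW.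
    rewrite !ltr0_norm ?subr_lt0 // (min_idPl (ltW ths1)) (max_idPr (ltW ths1)) => h.
    by apply/andP; split; lra.
  move: hy; rewrite /s1 /r; case: (i) => /= hy.
    have [||||s] := ivt (b - d) b; [lra|lra|lra|exact: hy|].
    rewrite in_itv /= => /andP[h1 h2] es; exists s; split; first by apply/andP; split; lra.
    by split => //; rewrite ler_norml; apply/andP; split; lra.
  have [||||s] := ivt a (a + d); [lra|lra|lra|by rewrite minC maxC|].
  rewrite in_itv /= => /andP[h1 h2] es; exists s; split; first by apply/andP; split; lra.
  by split => //; rewrite ler_norml; apply/andP; split; lra.
have sab' : a < s < b.
  move: sab => /andP[]; rewrite !le_eqVlt => h1 h2.
  have ysr : s != r by apply: contra yne => /eqP <-; rewrite es.
  have : s != a /\ s != b.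
    split; apply/eqP => sE; have := y0; have := y1; rewrite -es sE;
    case: thab => -[ea eb]; rewrite ?ea ?eb ltxx //.
  move=> [sa sb]; move: h1 h2; rewrite [a == s]eq_sym (negPf sa) (negPf sb) /=.
  by move=> -> ->.
by exists s; split => //; exact: inU.
Qed.

(** Local injectivity of [psi] at the common start: darts whose images set out from the same end of
    the same edge share an image point near the start, hence an interior point, hence the segment;
    the initial value of [theta] fixes the direction. *)
Lemma dart_target_inj d d' : is_segment d.1 -> is_segment d'.1 -> dpt d = dpt d' ->
  target d.1 = target d'.1 -> theta d.1 (dstart d) = theta d'.1 (dstart d') -> d = d'.
Proof.
move=> sd sd' ee tt hh.
have Hd : space_of H (dpt d).
  case: d sd {ee tt hh} => -[[e a] b] i /= sm; apply: chi_space; first by case: sm.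
  have [a0 b1] := segment_bounds sm; have ab : a < b by case: sm.
  by rewrite /dstart /=; case: (i); apply/andP; split; lra.
have [U nU Ui] := psi_immersion.2 _ Hd.
have [ep ep0 epU] := dart_near sd nU.
rewrite ee in nU; have [ep' ep0' epU'] := dart_near sd' nU.
(* A coordinate so close to the common initial value that both darts reach it inside the set where
   [psi] is injective. *)
have [y y01 [y1 y2]] : exists2 y, 0 < y < 1 & `|y - theta d.1 (dstart d)| < ep /\
    `|y - theta d'.1 (dstart d')| < ep'.
  rewrite -hh; pose m := Num.min (Num.min ep ep') 1 / 2.
  have m0 : 0 < m by rewrite divr_gt0 // !lt_min ep0 ep0' ltr01.
  have [m1 [m2 m3]] : m < ep /\ m < ep' /\ m < 1.
    have : Num.min (Num.min ep ep') 1 <= ep /\ Num.min (Num.min ep ep') 1 <= ep' /\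
      Num.min (Num.min ep ep') 1 <= 1 by rewrite !ge_min !lexx !orbT.
    by rewrite /m; move: (Num.min _ _) => q; lra.
  case: (theta_start01 sd) => ->.
    by exists m; [rewrite m0|rewrite subr0 gtr0_norm].
  exists (1 - m); first by apply/andP; split; lra.
  have -> : 1 - m - 1 = - m by lra.
  by rewrite normrN gtr0_norm.
have [s [sab Us es]] := epU _ y01 y1.
have [s' [sab' Us' es']] := epU' _ y01 y2.
move: sd sd' sab sab' Us Us' es es' {epU epU' ee nU Hd y1 y2} tt hh.
case: d => -[[e a] b] i; case: d' => -[[e' a'] b'] i'; rewrite /dsource /dstart /=.
move=> sm sm' sab sab' Us Us' es es' tt hh.
have [a0 b1] := segment_bounds sm; have [a0' b1'] := segment_bounds sm'.
have s01 : 0 < s < 1 by move: sab => /andP[h1 h2]; apply/andP; split; lra.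
have s01' : 0 < s' < 1 by move: sab' => /andP[h1 h2]; apply/andP; split; lra.
have [_ _ thE _ _] := passageP sm; have [_ _ thE' _ _] := passageP sm'.
have [] := thE s; first by move: sab => /andP[h1 h2]; rewrite !ltW.
have [] := thE' s'; first by move: sab' => /andP[h1 h2]; rewrite !ltW.
rewrite es es' -tt => _ -> _ psie.
have [[He e1 _ _ _] [He' e1' _ _ _]] := (sm, sm').
have cc : chi e s = chi e' s'.
  apply: Ui => //; apply/mem_set; split => //; apply: chi_space => //.
    by move: s01 => /andP[h1 h2]; rewrite !ltW.
  by move: s01' => /andP[h1 h2]; rewrite !ltW.
have ee : e = e'.
  apply: (open_cell_inj cw (x := chi e s)); first exact: chi_open.
  by rewrite cc; exact: chi_open.
subst e'; have ss : s = s' by apply: (chi_inj F_graph e1) => //; rewrite inE /= in_itv.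
subst s'; have mm := segment_unique sm sm' sab sab'.
rewrite mm; congr (_, _); move: hh; rewrite mm.
case: mm => ? ?; subst a' b'; have [_ _ _ _ ends] := passageP sm.
by case: i i' => -[] //=; case: ends => -[-> ->] /eqP; rewrite ?oner_eq0 // eq_sym oner_eq0.
Qed.

End Segments.

(** * Closed walks *)

Section Walks.
Context {R : realType} {F : topologicalType} (S : cell_structure R F).
Context (H : set (cell S)) (psi : F -> F).
Hypotheses (F_graph : is_graph S).
Let cw : is_cw_complex S := F_graph.1.
Local Notation chi := (@chi R F S).
Local Notation is_segment := (@is_segment R F S H psi).
Local Notation dart := (@dart R F S).
Local Notation dpt := (@dpt R F S).
Local Notation drev := (@drev R F S).

Variables (G : set (segment S)) (Q : set F).
Hypothesis G_segment : forall m, G m -> is_segment m.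
Hypothesis G_Q : forall e a b s, G (e, a, b) -> a <= s <= b -> Q (chi e s).

Definition arc (d : dart) (u : R) : F :=
  chi (dsource d) (dstart d + u * (dend d - dstart d)).

Lemma arc0 d : arc d 0 = dpt d.
Proof. by rewrite /arc mul0r addr0. Qed.

Lemma arc1 d : arc d 1 = dpt (drev d).
Proof. by rewrite /arc mul1r addrC subrK /dpt dstart_rev. Qed.

Lemma arc_inside d u : is_segment d.1 -> 0 < u < 1 -> exists2 s,
  d.1.1.2 < s < d.1.2 & s = dstart d + u * (dend d - dstart d).
Proof.
case: d => -[[e a] b] i [/= _ _ ab _ _] /andP[u0 u1].
eexists; last reflexivity; rewrite /dstart /dend /=.
by case: i => /=; apply/andP; split; nra.
Qed.

Lemma arc_closed d u : is_segment d.1 -> 0 <= u <= 1 -> exists2 s,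
  d.1.1.2 <= s <= d.1.2 & s = dstart d + u * (dend d - dstart d).
Proof.
case: d => -[[e a] b] i [/= _ _ ab _ _] /andP[u0 u1].
eexists; last reflexivity; rewrite /dstart /dend /=.
by case: i => /=; apply/andP; split; nra.
Qed.

Lemma arc_Q d u : G d.1 -> 0 <= u <= 1 -> Q (arc d u).
Proof.
move=> Gd u01; have [s sab es] := arc_closed (G_segment Gd) u01.
by rewrite /arc -es; move: Gd sab; case: (d) => -[[e a] b] i /= Gd sab; exact: G_Q Gd sab.
Qed.

Lemma arc_continuous d : is_segment d.1 -> {within (`[0, 1] : set R), continuous (arc d)}.
Proof.
move=> sd; apply/within_continuousP => u u01 V nV.
have u01' : 0 <= u <= 1 by move: u01; rewrite /= in_itv.
have in01 v : 0 <= v <= 1 -> `[0, 1]%classic (dstart d + v * (dend d - dstart d)).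
  move=> v01; have [s sab <-] := arc_closed sd v01.
  move: sd sab; case: (d) => -[[e a] b] i /= sm /andP[h1 h2].
  have [a0 b1] := segment_bounds sm.
  by rewrite in_itv /=; apply/andP; split; lra.
have/within_continuousP/(_ _ (in01 _ u01') V nV) nW := @chi_continuous _ _ _ F_graph (dsource d).
have ac : continuous (fun v : R => dstart d + v * (dend d - dstart d)).
  by move=> v; apply: cvgD; [exact: cvg_cst|apply: cvgM; [exact: cvg_id|exact: cvg_cst]].
have nu : nbhs u [set v | `[0, 1]%classic (dstart d + v * (dend d - dstart d)) ->
   V (chi (dsource d) (dstart d + v * (dend d - dstart d)))] := ac u _ nW.
by apply: filterS nu => v vV v01; apply: vV; apply: in01; move: v01; rewrite /= in_itv.
Qed.

Definition half_arc (d : dart) : set F := arc d @` `[0, 1[.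

Lemma vertex_dpt d : is_segment d.1 -> vertex S (psi (dpt d)).
Proof.
case: d => -[[e a] b] i [/= _ _ ab [/vertex_timesP[_ va] /vertex_timesP[_ vb]] _].
by rewrite /dpt /dstart /dsource /=; case: i.
Qed.

Lemma arc_not_vertex d u : is_segment d.1 -> 0 < u < 1 -> ~ vertex S (psi (arc d u)).
Proof.
move=> sd u01; have [s sab es] := arc_inside sd u01; rewrite /arc -es.
move: sd sab {es}; case: (d) => -[[e a] b] i /= sm sab vs.
have [a0 b1] := segment_bounds sm; case: sm => _ _ _ _ /(_ s sab); apply.
by apply/vertex_timesP; split => //; move: sab => /andP[h1 h2]; apply/andP; split; lra.
Qed.

Lemma arc_open_eq d d' u u' : is_segment d.1 -> is_segment d'.1 -> 0 < u < 1 ->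
  0 < u' < 1 -> arc d u = arc d' u' -> d.1 = d'.1 /\ (d = d' -> u = u').
Proof.
move=> sd sd' u01 u01'; have [s sab es] := arc_inside sd u01.
have [s' sab' es'] := arc_inside sd' u01'; rewrite /arc -es -es' => cc.
have inj : d = d' -> s = s' -> u = u'.
  move=> dd; subst d'; rewrite es es' => /addrI/mulIf; apply.
  move: sd; case: (d) => -[[e a] b] [] [/= _ _ ab _ _];
  by rewrite /dend /dstart /= subr_eq0 ?(lt_eqF ab) ?(gt_eqF ab).
move: sd sd' sab sab' cc inj {es es'}; case: d => -[[e a] b] i; case: d' => -[[e' a'] b'] i'.
rewrite /dsource /= => sm sm' sab sab' cc inj.
have [a0 b1] := segment_bounds sm; have [a0' b1'] := segment_bounds sm'.
have s01 : 0 < s < 1 by move: sab => /andP[h1 h2]; apply/andP; split; lra.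
have s01' : 0 < s' < 1 by move: sab' => /andP[h1 h2]; apply/andP; split; lra.
have ee : e = e'.
  apply: (open_cell_inj cw (x := chi e s)); first exact: chi_open.
  by rewrite cc; exact: chi_open.
have [_ e1 _ _ _] := sm; subst e'.
have ss : s = s' by apply: (chi_inj F_graph e1) => //; rewrite inE /= in_itv.
split; last by move=> dd; exact: inj.
by subst s'; exact: segment_unique sm sm' sab sab'.
Qed.

Lemma arc_inj d : is_segment d.1 -> set_inj `[0, 1[ (arc d).
Proof.
move=> sd u v /set_mem + /set_mem; rewrite /= !in_itv /= => /andP[u0 u1] /andP[v0 v1].
move: u0 v0; rewrite !le_eqVlt => /predU1P[<-|u0] /predU1P[<-|v0] //.
- rewrite arc0 => e; exfalso; apply: (@arc_not_vertex d v) => //; first by rewrite v0.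
  by rewrite -e; exact: vertex_dpt.
- rewrite arc0 => e; exfalso; apply: (@arc_not_vertex d u) => //; first by rewrite u0.
  by rewrite e; exact: vertex_dpt.
- by move=> e; have [|| _] := arc_open_eq sd sd _ _ e; rewrite ?u0 ?v0 //; apply.
Qed.

Lemma half_arc_disjoint d d' x : is_segment d.1 -> is_segment d'.1 ->
  dpt d <> dpt d' -> d.1 <> d'.1 -> half_arc d x -> half_arc d' x -> False.
Proof.
move=> sd sd' ne ne1 [u + <-] [v +]; rewrite /= !in_itv /= => /andP[u0 u1] /andP[v0 v1].
move: u0 v0; rewrite !le_eqVlt => /predU1P[<-|u0] /predU1P[<-|v0] //.
- by rewrite !arc0 => /esym.
- rewrite arc0 => e; apply: (@arc_not_vertex d' v) => //; first by rewrite v0.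
  by rewrite e; exact: vertex_dpt.
- rewrite arc0 => e; apply: (@arc_not_vertex d u) => //; first by rewrite u0.
  by rewrite -e; exact: vertex_dpt.
- by move=> e; have [|| /ne1] := arc_open_eq sd sd' _ _ (esym e); rewrite ?u0 ?v0.
Qed.

Definition step (d d' : dart) : bool := `[< dpt d' = dpt (drev d) /\ d' <> drev d >].

(** With distinct start points a segment could only recur reversed. But [drev d] starts where the
    dart after [d] starts, so it would be that dart, which a reduced walk forbids. *)
Lemma uniq_segments d s : path step d s -> uniq [seq dpt m | m <- d :: s] ->
  uniq [seq m.1 | m <- d :: s].
Proof.
elim: s d => [//|m s IH] d /= /andP[/asboolP[dm ndm] ps] /andP[nd us].
apply/andP; split; last exact: IH.
rewrite -[_ :: _]/([seq m.1 | m <- m :: s]); apply/negP => /mapP[m' m'in mm]; have [m'd|m'd] := pselect (m' = d).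
  by move/negP: nd; apply; rewrite -m'd; exact: (map_f _ m'in).
have m'r : m' = drev d.
  move: d m' mm m'd {IH dm ndm ps nd us m'in} => [x i] [y j] /= -> h.
  by rewrite /drev /=; case: i j h => -[].
have mm' : dpt m' = dpt m by rewrite m'r.
move: m'in; rewrite inE => /orP[/eqP m'm|m's]; first by apply: ndm; rewrite -m'm.
by move: us => /= /andP[/negP + _]; apply; rewrite -mm'; exact: map_f.
Qed.

(** The arcs are run through in one unit of time each. Distinct start points make them disjoint; the
    final time is left out of the injectivity so that the walk may close up. *)
Lemma walk_path d s : (forall m, m \in d :: s -> G m.1) -> path step d s ->
  uniq [seq dpt m | m <- d :: s] ->
  exists g : R -> F, [/\ {within `[0, (size s).+1%:R], continuous g},
    g 0 = dpt d /\ g (size s).+1%:R = dpt (drev (last d s)),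
    forall u, 0 <= u <= (size s).+1%:R -> Q (g u),
    forall u, 0 <= u < (size s).+1%:R -> exists2 m, m \in d :: s & half_arc m (g u) &
    set_inj (`[0, (size s).+1%:R[ : set R) g].
Proof.
elim: s d => [|m s IH] d Gs.
  move=> _ _; have Gd : G d.1 by apply: Gs; rewrite mem_head.
  exists (arc d); split.
  - exact/arc_continuous/G_segment.
  - by rewrite arc0 arc1.
  - by move=> u; exact: arc_Q.
  - by move=> u u01; exists d; rewrite ?mem_head //; exists u; rewrite //= in_itv.
  - exact/arc_inj/G_segment.
move=> pms ums.
have us := uniq_segments pms ums.
have Gd : G d.1 by apply: Gs; rewrite mem_head.
move: pms ums => /= /andP[/asboolP[dm _] pms] /andP[nd ums].
have [m' m's|g' [gc [g0 g1] gQ gh gi]] := IH m _ pms ums.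
  by apply: Gs; rewrite inE m's orbT.
set n := (size s).+1; have n0 : (0 : R) < n%:R by rewrite ltr0n.
have nS : n.+1%:R = n%:R + 1 :> R by rewrite -natr1.
pose g u := if u <= 1 then arc d u else g' (u - 1).
have gE2 u : 1 <= u -> g u = g' (u - 1).
  rewrite /g le_eqVlt => /predU1P[<-|u1]; last by rewrite leNgt u1.
  by rewrite lexx subrr arc1 g0 dm.
have gE1 u : u <= 1 -> g u = arc d u by rewrite /g => ->.
have disj u v : 0 <= u < 1 -> 1 <= v < n.+1%:R -> g u <> g v.
  move=> /andP[u0 u1] /andP[v1 vn]; rewrite gE1 ?ltW // gE2 // => e.
  have [|m' m'in hm'] := gh (v - 1); first by apply/andP; split; rewrite -?/n; lra.
  apply: (@half_arc_disjoint d m' (arc d u)).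
  - exact: G_segment.
  - by apply/G_segment/Gs; rewrite inE m'in orbT.
  - by move=> e'; move/negP: nd; apply; rewrite e'; exact: (map_f _ m'in).
  - move=> e'; move: us => /= /andP[/negP + _]; apply; rewrite e'; exact: (map_f _ m'in).
  - by exists u; rewrite //= in_itv /= u0.
  - by rewrite e.
exists g; split.
- have -> : `[0, n.+1%:R]%classic = `[0, 1]%classic `|` `[1, n.+1%:R]%classic :> set R.
    apply/seteqP; split => u; rewrite /= !in_itv /=.
      by move=> /andP[u0 un]; have [u1|u1] := leP u 1; [left|right]; rewrite ?u0 ?un ?ltW.
    by move=> [/andP[u0 u1]|/andP[u1 un]]; apply/andP; split; lra.
  apply: withinU_continuous; [exact: interval_closed|exact: interval_closed| |].
    apply/within_continuousP => u u01 V; rewrite gE1; last by move: u01; rewrite /= in_itv /= => /andP[].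
    have/within_continuousP/(_ u u01 V) := arc_continuous (G_segment Gd).
    move=> h /h; apply: filterS => v vV v01; rewrite gE1; first exact: vV.
    by move: v01; rewrite /= in_itv /= => /andP[].
  apply/within_continuousP => u; rewrite /= in_itv /= => /andP[u1 un] V; rewrite gE2 // => nV.
  have u0 : `[0, n%:R]%classic (u - 1) by rewrite /= in_itv /=; apply/andP; split; lra.
  have/within_continuousP/(_ _ u0 V nV) nW := gc.
  have sc : continuous (fun v : R => v - 1).
    by move=> v; apply: cvgB; [exact: cvg_id|exact: cvg_cst].
  have nu : nbhs u [set v | `[0, n%:R]%classic (v - 1) -> V (g' (v - 1))] := sc u _ nW.
  apply: filterS nu => v vV; rewrite /= in_itv /= => /andP[v1 vn]; rewrite gE2 //.
  by apply: vV; rewrite /= in_itv /=; apply/andP; split; lra.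
- split; first by rewrite gE1 ?ler01 // arc0.
  by rewrite gE2 ?nS ?lerDr ?ler0n // addrK g1.
- move=> u /andP[u0 un]; have [u1|u1] := leP u 1.
    by rewrite gE1 //; apply: arc_Q => //; rewrite u0.
  by rewrite gE2 ?ltW //; apply: gQ; apply/andP; split; rewrite -?/n; lra.
- move=> u /andP[u0 un]; have [u1|u1] := ltP u 1.
    rewrite gE1 ?ltW //; exists d; first exact: mem_head.
    by exists u; rewrite //= in_itv /= u0.
  rewrite gE2 //; have [|m' m'in hm'] := gh (u - 1).
    by apply/andP; split; rewrite -?/n; lra.
  by exists m' => //; rewrite inE m'in orbT.
- move=> u v /set_mem + /set_mem; rewrite /= !in_itv /= => /andP[u0 un] /andP[v0 vn].
  have [u1|u1] := ltP u 1; have [v1|v1] := ltP v 1 => e.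
  + by apply: (arc_inj (G_segment Gd)); rewrite ?inE /= ?in_itv /= ?u0 ?v0 // -!gE1 ?ltW.
  + by exfalso; apply: (disj u v) => //; rewrite ?u0 ?v1.
  + by exfalso; apply: (disj v u) => //; rewrite ?v0 ?u1.
  + apply: (addIr (-1)); apply: gi; rewrite ?inE /= ?in_itv /= -?gE2 //;
    by apply/andP; split; rewrite -?/n; lra.
Qed.

(* A closed walk is only required to be reduced away from its base point. *)
Lemma closed_walk_circle d s : (forall m, m \in d :: s -> G m.1) -> path step d s ->
  dpt (drev (last d s)) = dpt d ->
  exists g : R -> F, [/\ {within `[0, 1], continuous g}, g 0 = g 1,
    set_inj (`[0, 1[ : set R) g & forall u, 0 <= u <= 1 -> Q (g u)].
Proof.
have [n] := ubnP (size s); elim: n d s => // n IH d s sn Gs ps cl.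
have [us|/negP nus] := boolP (uniq [seq dpt m | m <- d :: s]).
  have [g [gc [g0 g1] gQ _ gi]] := walk_path Gs ps us.
  set N := (size s).+1 in gc g1 gQ gi; have N0 : (0 : R) < N%:R by rewrite ltr0n.
  have sc (u v : R) : N%:R * u <= N%:R * v = (u <= v) by rewrite ler_pM2l.
  have scl (u v : R) : N%:R * u < N%:R * v = (u < v) by rewrite ltr_pM2l.
  exists (fun u => g (N%:R * u)); split.
  - apply/within_continuousP => u; rewrite /= in_itv /= => /andP[u0 u1] V nV.
    have uN : `[0, N%:R]%classic (N%:R * u).
      by rewrite /= in_itv /= -[X in _ <= _ <= X](mulr1 N%:R) -[X in X <= _](mulr0 N%:R) !sc u0.
    have/within_continuousP/(_ _ uN V nV) nW := gc.
    have mc : continuous (fun v : R => N%:R * v).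
      by move=> v; apply: cvgM; [exact: cvg_cst|exact: cvg_id].
    have nu : nbhs u [set v | `[0, N%:R]%classic (N%:R * v) -> V (g (N%:R * v))] := mc u _ nW.
    apply: filterS nu => v vV; rewrite /= in_itv /= => /andP[v0 v1]; apply: vV.
    by rewrite /= in_itv /= -[X in _ <= _ <= X](mulr1 N%:R) -[X in X <= _](mulr0 N%:R) !sc v0.
  - by rewrite mulr0 mulr1 g0 g1.
  - move=> u v /set_mem + /set_mem; rewrite /= !in_itv /= => /andP[u0 u1] /andP[v0 v1] e.
    apply: (mulfI (lt0r_neq0 N0)); apply: gi => //; rewrite inE /= in_itv /=;
    by rewrite -[X in _ <= _ < X](mulr1 N%:R) -[X in X <= _](mulr0 N%:R) sc scl ?u0 ?v0.
  - move=> u /andP[u0 u1]; apply: gQ.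
    by rewrite -[X in _ <= _ <= X](mulr1 N%:R) -[X in X <= _](mulr0 N%:R) !sc u0.
(* A repeated start point cuts out a shorter closed walk, from [x] to just before [y]. It may
   backtrack at its new base point, which the statement tolerates. *)
have [w1 [x [w2 [y [w3 [ws xy]]]]]] : exists w1 x w2 y w3,
    d :: s = w1 ++ x :: w2 ++ y :: w3 /\ dpt x = dpt y.
  elim: (d :: s) nus => [//|x w IHw] /=; have [/mapP[y yw xy] _|_ nus] := boolP (_ \in _).
    by have [w2 w3] := splitPr yw; exists [::], x, w2, y, w3.
  have [w1 [z [w2 [y [w3 [-> zy]]]]]] := IHw nus.
  by exists (x :: w1), z, w2, y, w3.
have [px2 lx] : path step x w2 /\ step (last x w2) y.
  have : path step d s by [].
  case: w1 ws => [|z w1] /= [-> ->].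
    by rewrite cat_path /= => /andP[-> /andP[-> _]].
  by rewrite cat_path /= cat_path /= => /andP[_ /andP[_ /andP[-> /andP[-> _]]]].
apply: (IH x w2) => //.
- have : size (d :: s) = size (w1 ++ x :: w2 ++ y :: w3) by rewrite ws.
  rewrite /= !size_cat /= size_cat /=.
  rewrite addnS => -[es]; rewrite ltnS in sn; apply: leq_trans sn.
  by rewrite es addnCA -[X in (X < _)%N]addn0 ltn_add2l addnS.
- by move=> m mx; apply: Gs; rewrite ws mem_cat -cat_cons mem_cat mx orbT.
- by move: lx => /asboolP[<- _].
Qed.

End Walks.

(** * Lifting characteristic maps *)

Lemma finite_inj (T U : Type) (A : set T) (f : T -> U) :
  set_inj A f -> finite_set (f @` A) -> finite_set A.
Proof. by move=> fi; rewrite (eq_finite_set (inj_card_eq fi)). Qed.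

Section MappingTorusComplex.
Context {R : realType} {F : topologicalType} (S : cell_structure R F).
Context (H : set (cell S)) (psi : F -> F).
Hypotheses (F_graph : is_graph S) (F_finite : is_finite_complex S).
Hypotheses (H_subgraph : is_subcomplex H) (psi_continuous : {within space_of H, continuous psi}).
Let cw : is_cw_complex S := F_graph.1.
Local Notation chi := (@chi R F S).
Local Notation SX := (mapping_torus_cells H psi).
Local Notation X := (mt_space H psi).
Local Notation base := (@mt_base R F (space_of H) psi).
Local Notation cyl := (@mt_cyl R F (space_of H) psi).
Local Notation unit_itv := (`[0, 1]%classic : set R).
Local Notation open_itv := (`]0, 1[%classic : set R).

(** [vchar] and [hchar] parametrize vertical and horizontal cells by the interval and by the square
    in all dimensions. When [c] is a vertex, [hchar c] depends only on its first coordinate, the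
    height, so horizontal edges and 2-cells are treated alike. *)
Definition vchar (c : cell S) (s : R) : X := base (chi c s).
Definition hchar (c : cell S) (p : R * R) : X := cyl (chi c p.2) p.1.

Lemma open_cell_inl (c : cell S) : open_cell (inl c : cell SX) = vchar c @` open_itv.
Proof.
rewrite /vchar -(image_comp (chi c) base) -open_cellE //.
by rewrite /open_cell image_comp.
Qed.

Lemma open_cell_inr (c : set_type H) :
  open_cell (inr c : cell SX) = hchar (set_val c) @` (open_itv `*` open_itv).
Proof.
apply/seteqP; split.
  move=> _ [u u01 <-] /=.
  have : open_cell (set_val c) (cmap S (set_val c) (col' ord0 u)).
    by exists (col' ord0 u) => // i; rewrite mxE; exact: u01.
  rewrite open_cellE // => -[s s01 es]; exists (u ord0 ord0, s).
    by split => //=; rewrite in_itv /=; exact: u01.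
  by rewrite /hchar /= es.
move=> _ [[t s] [/= t01 s01] <-]; rewrite in_itv /= in t01; rewrite in_itv /= in s01.
exists (\row_j (if j == ord0 then t else s)).
  by move=> i; rewrite mxE; case: ifP.
rewrite /= mxE eqxx /hchar /chi /=; congr (cyl (cmap S _ _) t).
by apply/rowP => j; rewrite !mxE.
Qed.

Lemma hchar_space (d : set_type H) s : 0 <= s <= 1 -> space_of H (chi (set_val d) s).
Proof.
move=> s01; have Hd : H (set_val d) by exact: set_mem (valP d).
by apply: (H_subgraph Hd); rewrite (closed_cellE F_graph); exists s; rewrite //= in_itv.
Qed.

Lemma vchar_continuous c : {within unit_itv, continuous (vchar c)}.
Proof.
apply/within_continuousP => s s01 V nV.
have/within_continuousP/(_ s s01) := @chi_continuous _ _ _ F_graph c.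
by move=> /(_ _ (mt_base_continuous nV)).
Qed.

Lemma hchar_continuous (d : set_type H) :
  {within unit_itv `*` unit_itv, continuous (hchar (set_val d))}.
Proof.
apply/within_continuousP => -[t s] [/= t01 s01] V nV.
have s01' : 0 <= s <= 1 by move: s01; rewrite /= in_itv.
have in_cyl : (space_of H `*` unit_itv) (chi (set_val d) s, t).
  by split => //; exact: hchar_space.
have/within_continuousP/(_ _ in_cyl V nV)[[/= A B] [nA nB] AB] := @mt_cyl_continuous R F (space_of H) psi.
have/within_continuousP/(_ s s01 A nA) nA' := @chi_continuous _ _ _ F_graph (set_val d).
exists (B, [set s | unit_itv s -> A (chi (set_val d) s)]); first by split.
move=> [t' s'] [/= Bt As] [/= t01' s01''].
apply: (AB (chi (set_val d) s', t')); first by split => //; exact: As.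
by split => //; apply: hchar_space; move: s01''; rewrite /= in_itv.
Qed.

Lemma vchar_eq c s d t : vchar c s = vchar d t -> chi c s = chi d t.
Proof. by move=> /(congr1 (@mt_coord _ _ _ _)); rewrite !mt_coord_base => -[]. Qed.

Lemma hchar_eq (c d : set_type H) p p' : 0 < p.1 < 1 -> 0 <= p.2 <= 1 ->
  0 < p'.1 < 1 -> 0 <= p'.2 <= 1 -> hchar (set_val c) p = hchar (set_val d) p' ->
  p.1 = p'.1 /\ chi (set_val c) p.2 = chi (set_val d) p'.2.
Proof.
move=> h1 h2 h3 h4 /(congr1 (@mt_coord _ _ _ _)).
by rewrite !mt_coord_cyl //; [case|exact: hchar_space|exact: hchar_space].
Qed.

Lemma open_cell_baseP (c : cell SX) x d : open_cell c (base x) -> open_cell d x ->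
  c = inl d.
Proof.
case: c => c; rewrite ?open_cell_inl ?open_cell_inr.
  move=> [s]; rewrite /= in_itv /= => s01 /(congr1 (@mt_coord _ _ _ _)).
  rewrite !mt_coord_base => -[cx] dx; congr inl; apply: (open_cell_inj cw _ dx).
  by rewrite -cx; exact: chi_open.
move=> [[t s] [/=]]; rewrite !in_itv /= => t01 /andP[s0 s1] /(congr1 (@mt_coord _ _ _ _)).
rewrite mt_coord_base mt_coord_cyl //; apply: hchar_space.
by rewrite !ltW.
Qed.

Lemma open_cell_cylP (c : cell SX) x t (d : set_type H) : 0 < t < 1 ->
  open_cell c (cyl x t) -> open_cell (set_val d) x -> c = inr d.
Proof.
move=> t01 cxt dx.
have Hx : space_of H x by exists (set_val d) => //; exact: set_mem (valP d).
move: cxt; case: c => c; rewrite ?open_cell_inl ?open_cell_inr.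
  move=> [s _] /(congr1 (@mt_coord _ _ _ _)).
  by rewrite mt_coord_base mt_coord_cyl.
move=> [[t' s'] [/=]]; rewrite !in_itv /= => t01' s01 /(congr1 (@mt_coord _ _ _ _)).
rewrite !mt_coord_cyl //; last by apply: hchar_space; move: s01 => /andP[h1 h2]; rewrite !ltW.
move=> [ex _]; congr inr; apply: val_inj.
by apply: (open_cell_inj cw _ dx); rewrite -ex; exact: chi_open.
Qed.

Lemma mt_space_hausdorff : hausdorff_space X.
Proof.
by apply: mt_hausdorff => //; [exact: cw_hausdorff cw|exact: graph_compact F_graph F_finite].
Qed.

(** * Cells of a complex immersed in the mapping torus *)

Section Immersion.
Context (Y : topologicalType) (SY : cell_structure R Y) (f : Y -> X).
Hypotheses (Y_complex : is_2_complex SY) (f_comb : combinatorial SY SX f).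
Hypotheses (f_imm : immersion [set: Y] f) (Y_compact : compact [set: Y]).
Let cwY : is_cw_complex SY := Y_complex.1.
Let hY : hausdorff_space Y := cw_hausdorff cwY.

Lemma f_within (A : set Y) : {within A, continuous f}.
Proof. exact: continuous_subspaceT f_comb.1. Qed.

Lemma f_finite_fibre x : finite_set ([set: Y] `&` f @^-1` [set x]).
Proof.
by apply: finite_locally_injective_preimage => //; exact: f_imm.2.
Qed.

Lemma over_cell_ex (c : cell SY) : exists d : cell SX,
  dim d = dim c /\ homeomorphic_onto (open_cell c) (open_cell d) f.
Proof. by have [d h1 h2] := f_comb.2 c; exists d. Qed.

Definition tau (c : cell SY) : cell SX := projT1 (cid (over_cell_ex c)).

Lemma dim_tau c : dim (tau c) = dim c.
Proof. by rewrite /tau; case: cid => d []. Qed.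

Lemma tau_homeo c : homeomorphic_onto (open_cell c) (open_cell (tau c)) f.
Proof. by rewrite /tau; case: cid => d []. Qed.

Lemma open_cell_tau c y : open_cell c y -> open_cell (tau c) (f y).
Proof. by move=> cy; have [[fun_ _ _] _ _] := tau_homeo c; exact: fun_. Qed.

(** On the open cell the lift is [q] followed by the inverse of the homeomorphism [f], and
    [lift_extension] carries it to the boundary. Its image is closed and contains the open cell,
    hence covers the closed cell. *)
Lemma cell_lift (Z : topologicalType) (D U : set Z) (q : Z -> X) (c : cell SY) :
  U `<=` D -> (forall p, D p -> locally_connected_at U p) ->
  {within D, continuous q} -> q @` U = open_cell (tau c) -> compact D ->
  exists h : Z -> Y, [/\ {within D, continuous h}, forall z, D z -> f (h z) = q z,
    h @` U = open_cell c & closed_cell c `<=` h @` D].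
Proof.
move=> UD lc qc qU cD; have [[fF finj fsurj] _ [g gc gK]] := tau_homeo c.
have fK x : open_cell (tau c) x -> f (g x) = x /\ open_cell c (g x).
  by move=> /fsurj[y cy <-]; rewrite gK.
have qo z : U z -> open_cell (tau c) (q z) by move=> Uz; rewrite -qU; exists z.
have [||h [hc hf hU]] := @lift_extension Z Y X D U [set: Y] f q (g \o q) hY
    mt_space_hausdorff Y_compact (@f_within setT) f_finite_fibre UD lc qc.
- apply/within_continuousP => z Uz V nV.
  have/within_continuousP/(_ _ (qo _ Uz) V nV) nW := gc.
  have/within_continuousP/(_ _ (UD _ Uz) _ nW) := qc.
  by apply: filterS => t tV Ut; apply: tV; [exact: UD|exact: qo].
- by move=> z Uz; split => //; have [] := fK _ (qo _ Uz).
have hUc : h @` U = open_cell c.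
  apply/seteqP; split => [_ [z Uz <-]|y cy].
    by rewrite hU //; have [] := fK _ (qo _ Uz).
  have : (q @` U) (f y) by rewrite qU; exact: open_cell_tau.
  by move=> [z Uz ez]; exists z => //; rewrite hU //= ez gK.
exists h; split => //; first by move=> z Dz; have [] := hf z Dz.
have clD : closed (h @` D) by apply: compact_closed => //; exact: continuous_compact.
move=> _ [u cu <-]; apply: clD => V nV.
have/within_continuousP/(_ u cu V nV) nW := @cw_continuous _ _ _ cwY c.
have [w [Uw Vw]] := cube_sub_closure cu nW.
exists (cmap SY c w); split; last by apply: Vw; exact: open_cube_sub.
have : (h @` U) (cmap SY c w) by rewrite hUc; exists w.
by move=> [z Uz <-]; exists z => //; exact: UD.
Qed.

(** Mark one point in each open cell of the torus. Each cell of [Y] contains a preimage of a marked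
    point, and there are finitely many of these. *)
Lemma finite_cells : finite_set [set: cell SY].
Proof.
have /choice[y yP] : forall d : cell SX, exists x : X, open_cell d x.
  case=> d; first by exists (vchar d 2^-1); rewrite open_cell_inl;
    exists 2^-1 => //; rewrite /= in_itv /=; apply/andP; split; lra.
  exists (hchar (set_val d) (2^-1, 2^-1)); rewrite open_cell_inr; exists (2^-1, 2^-1) => //.
  by split; rewrite /= in_itv /=; apply/andP; split; lra.
have fX : finite_set [set: cell SX].
  have -> : [set: cell SX] = (inl @` [set: cell S]) `|` (inr @` [set: set_type H]).
    by apply/seteqP; split => // -[d _|d _]; [left|right]; exists d.
  rewrite finite_setU; split; apply: finite_image => //.
  apply: (@finite_inj _ _ _ set_val); first by move=> a b _ _; exact: val_inj.
  by apply: sub_finite_set F_finite.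
have /choice[z zP] : forall c : cell SY, exists z, open_cell c z /\ f z = y (tau c).
  move=> c; have [[_ _ fsurj] _ _] := tau_homeo c.
  by have [z cz ez] := fsurj _ (yP (tau c)); exists z.
have : finite_set ([set: Y] `&` f @^-1` (y @` [set: cell SX])).
  apply: finite_locally_injective_preimage => //; first exact: f_imm.2.
  exact: finite_image.
move=> /(sub_finite_set (A := z @` [set: cell SY])) fz.
have : finite_set (z @` [set: cell SY]).
  by apply: fz => _ [c _ <-]; split => //=; rewrite (zP c).2; exists (tau c).
apply: finite_inj => c d _ _ zcd; apply: (open_cell_inj cwY (x := z c)).
  by have [] := zP c.
by rewrite zcd; have [] := zP d.
Qed.

Local Notation sq := (unit_itv `*` unit_itv).
Local Notation osq := (open_itv `*` open_itv).

Lemma unitP (s : R) : unit_itv s <-> 0 <= s <= 1.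
Proof. by rewrite /= in_itv. Qed.

Lemma open_unitP (s : R) : open_itv s <-> 0 < s < 1.
Proof. by rewrite /= in_itv. Qed.

Lemma open_unit_sub : open_itv `<=` unit_itv.
Proof. by move=> s /open_unitP/andP[s0 s1]; apply/unitP; rewrite !ltW. Qed.

Lemma locally_connected_unit p : unit_itv p -> locally_connected_at open_itv p.
Proof. by move=> /unitP; apply: locally_connected_segment; exact: ltr01. Qed.

Lemma locally_connected_sq p : sq p -> locally_connected_at osq p.
Proof. by move=> [p1 p2]; apply: locally_connectedX; exact: locally_connected_unit. Qed.

Lemma compact_sq : compact sq.
Proof. by apply: compact_setX; exact: segment_compact. Qed.

Lemma connected_unit : connected unit_itv.
Proof. exact: segment_connected. Qed.

Lemma connected_sq : connected sq.
Proof. by apply: connectedX; exact: connected_unit. Qed.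

Lemma sigv_ex (c : cell SY) : exists h : R -> Y, forall d, tau c = inl d ->
  [/\ {within unit_itv, continuous h},
      forall s, unit_itv s -> f (h s) = vchar d s,
      h @` open_itv = open_cell c & closed_cell c `<=` h @` unit_itv].
Proof.
have [[d cd]|nd] := pselect (exists d, tau c = inl d); last first.
  have [y _] := open_cell_nonempty c.
  by exists (fun=> y) => d cd; exfalso; apply: nd; exists d.
have [|||||h hP] := @cell_lift R unit_itv open_itv (vchar d) c.
- exact: open_unit_sub.
- exact: locally_connected_unit.
- exact: vchar_continuous.
- by rewrite -open_cell_inl cd.
- exact: segment_compact.
by exists h => d'; rewrite cd => -[<-].
Qed.

Lemma sigh_ex (c : cell SY) : exists h : R * R -> Y, forall d : set_type H,
  tau c = inr d ->
  [/\ {within sq, continuous h}, forall p, sq p -> f (h p) = hchar (set_val d) p,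
      h @` osq = open_cell c & closed_cell c `<=` h @` sq].
Proof.
have [[d cd]|nd] := pselect (exists d, tau c = inr d); last first.
  have [y _] := open_cell_nonempty c.
  by exists (fun=> y) => d cd; exfalso; apply: nd; exists d.
have [|||||h hP] := @cell_lift _ sq osq (hchar (set_val d)) c.
- by move=> p [p1 p2]; split; exact: open_unit_sub.
- exact: locally_connected_sq.
- exact: hchar_continuous.
- by rewrite -open_cell_inr cd.
- exact: compact_sq.
by exists h => d'; rewrite cd => -[<-].
Qed.

(* The maps cmap SY need not be compatible with those of the mapping torus; the
   lifts sigv and sigh are. *)
Definition sigv (c : cell SY) : R -> Y := projT1 (cid (sigv_ex c)).
Definition sigh (c : cell SY) : R * R -> Y := projT1 (cid (sigh_ex c)).

Lemma sigvP c d : tau c = inl d ->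
  [/\ {within unit_itv, continuous (sigv c)},
      forall s, unit_itv s -> f (sigv c s) = vchar d s,
      sigv c @` open_itv = open_cell c & closed_cell c `<=` sigv c @` unit_itv].
Proof. by rewrite /sigv; case: cid => h /= hP; exact: hP. Qed.

Lemma sighP c (d : set_type H) : tau c = inr d ->
  [/\ {within sq, continuous (sigh c)},
      forall p, sq p -> f (sigh c p) = hchar (set_val d) p,
      sigh c @` osq = open_cell c & closed_cell c `<=` sigh c @` sq].
Proof. by rewrite /sigh; case: cid => h /= hP; exact: hP. Qed.

Lemma f_unique_lift (Z : topologicalType) (A : set Z) (h1 h2 : Z -> Y) z0 :
  connected A -> {within A, continuous h1} -> {within A, continuous h2} ->
  (forall z, A z -> f (h1 z) = f (h2 z)) -> A z0 -> h1 z0 = h2 z0 ->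
  forall z, A z -> h1 z = h2 z.
Proof.
by move=> cA c1 c2; apply: (unique_lift (B := [set: Y]) hY f_imm.2 cA c1 c2).
Qed.

Lemma tau_base c y x d : open_cell c y -> f y = base x -> open_cell d x -> tau c = inl d.
Proof. by move=> /open_cell_tau + fy; rewrite fy; exact: open_cell_baseP. Qed.

Lemma tau_cyl c y x t (d : set_type H) : open_cell c y -> f y = cyl x t -> 0 < t < 1 ->
  open_cell (set_val d) x -> tau c = inr d.
Proof. by move=> /open_cell_tau + fy t01; rewrite fy; exact: open_cell_cylP. Qed.

Lemma H_cell x : space_of H x -> exists d : set_type H, open_cell (set_val d) x.
Proof. by move=> [d Hd dx]; exists (exist _ d (mem_set Hd)). Qed.

(** Both maps lift the same [hchar], so agreement at one parameter, possibly on the boundary,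
    propagates to the centre of the square, which lies in both open cells. *)
Lemma sigh_same c c' (d : set_type H) p : tau c = inr d -> tau c' = inr d -> sq p ->
  sigh c p = sigh c' p -> c = c'.
Proof.
move=> cd cd' pS e; have [hc hf ho _] := sighP cd; have [hc' hf' ho' _] := sighP cd'.
have pm : osq (2^-1, 2^-1) by split => /=; apply/open_unitP; apply/andP; split; lra.
have pm' : sq (2^-1, 2^-1) by case: pm => h1 h2; split; exact: open_unit_sub.
have em := f_unique_lift connected_sq hc hc' (fun z zS => etrans (hf z zS) (esym (hf' z zS)))
  pS e pm'.
apply: (open_cell_inj cwY (x := sigh c (2^-1, 2^-1))); first by rewrite -ho; exists (2^-1, 2^-1).
by rewrite em -ho'; exists (2^-1, 2^-1).
Qed.

Lemma vertex_cell_unique (c : cell SY) y y' : dim c = 0%N -> open_cell c y ->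
  open_cell c y' -> y = y'.
Proof.
move=> c0 [u _ <-] [u' _ <-]; congr (cmap SY c _); apply/rowP => -[i h].
by exfalso; move: h; rewrite c0.
Qed.

Lemma sigv_lift (P : R -> Y) (th : R -> R) a b c d s0 :
  {within `[a, b], continuous P} -> {within `[a, b], continuous th} ->
  (forall s, a <= s <= b -> 0 <= th s <= 1) ->
  (forall s, a <= s <= b -> f (P s) = vchar d (th s)) ->
  tau c = inl d -> dim d = 1%N -> a <= s0 <= b -> open_cell c (P s0) -> 0 < th s0 < 1 ->
  forall s, a <= s <= b -> P s = sigv c (th s).
Proof.
move=> Pc thc th01 fP cd d1 s0ab cP ths0 s sab.
have [vc vf vo _] := sigvP cd.
have cc : {within `[a, b], continuous (sigv c \o th)}.
  apply/within_continuousP => t; rewrite /= in_itv /= => tab V nV.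
  have /within_continuousP/(_ (th t) _ V nV) nW := vc.
  have tu : unit_itv (th t) by apply/unitP; exact: th01.
  have tab' : (`[a, b]%classic : set R) t by rewrite /= in_itv.
  have /within_continuousP/(_ t tab' _ (nW tu)) := thc.
  apply: filterS => u uV uab; apply: uV => //; apply/unitP; apply: th01.
  by move: uab; rewrite in_itv.
apply: (f_unique_lift (A := `[a, b]%classic) (z0 := s0) _ Pc cc).
- exact: segment_connected.
- move=> t; rewrite /= in_itv /= => tab; rewrite fP // vf //; apply/unitP; exact: th01.
- by rewrite /= in_itv.
- move: cP; rewrite -vo => -[t /open_unitP t01 et] /=; rewrite -et; congr (sigv c _).
  apply: (chi_inj F_graph d1); rewrite ?inE /= ?in_itv //=.
  apply: vchar_eq; rewrite -vf -?fP // ?et //.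
  by apply/unitP; move: t01 => /andP[h1 h2]; rewrite !ltW.
- by rewrite /= in_itv.
Qed.

(** In the second coordinate, [sigh h] lifts a constant path, and so does the constant path
    itself. *)
Lemma sigh_vertex h (v : set_type H) t s s' : tau h = inr v -> dim (set_val v) = 0%N ->
  unit_itv t -> unit_itv s -> unit_itv s' -> sigh h (t, s) = sigh h (t, s').
Proof.
move=> hv v0 t01 s01 s01'; have [hc hf _ _] := sighP hv.
apply: (f_unique_lift (A := unit_itv) (h1 := fun s => sigh h (t, s))
  (h2 := fun=> sigh h (t, s')) (z0 := s') connected_unit) => //.
- apply/within_continuousP => u u01 V nV.
  have/within_continuousP/(_ _ (conj t01 u01 : sq (t, u)) V nV)[[/= A B] [nA nB] AB] := hc.
  apply: filterS nB => w Bw w01; apply: (AB (t, w)); last by split.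
  by split => //=; exact: nbhs_singleton.
- by apply: continuous_subspaceT => ?; exact: cvg_cst.
- move=> u u01; rewrite (hf (t, u) (conj t01 u01)) (hf (t, s') (conj t01 s01')).
  by rewrite /hchar /=; congr (cyl _ _); exact: chi_cst.
Qed.

Lemma sigh_slice c (d : set_type H) s : tau c = inr d -> unit_itv s ->
  {within unit_itv, continuous (fun t => sigh c (t, s))}.
Proof.
move=> cd s01; have [hc _ _ _] := sighP cd; apply/within_continuousP => u u01 V nV.
have/within_continuousP/(_ _ (conj u01 s01 : sq (u, s)) V nV)[[/= A B] [nA nB] AB] := hc.
apply: filterS nA => w Aw w01; apply: (AB (w, s)); last by split.
by split => //=; exact: nbhs_singleton.
Qed.

Lemma sigh_row c (d : set_type H) t : tau c = inr d -> unit_itv t ->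
  {within unit_itv, continuous (fun s => sigh c (t, s))}.
Proof.
move=> cd t01; have [hc _ _ _] := sighP cd; apply/within_continuousP => u u01 V nV.
have/within_continuousP/(_ _ (conj t01 u01 : sq (t, u)) V nV)[[/= A B] [nA nB] AB] := hc.
apply: filterS nB => w Bw w01; apply: (AB (t, w)); last by split.
by split => //=; exact: nbhs_singleton.
Qed.

(** Both paths lift the same horizontal edge of the torus and agree at height [t0], so meeting [h]
    at one interior height is enough for the side to run along it. *)
Lemma sigh_side c h (d v : set_type H) i t0 : tau c = inr d -> tau h = inr v ->
  dim (set_val v) = 0%N -> unit_itv i -> 0 < t0 < 1 -> open_cell h (sigh c (t0, i)) ->
  forall t, unit_itv t -> sigh c (t, i) = sigh h (t, 0).
Proof.
move=> cd hv v0 i01 t01 hm; have [_ hf _ _] := sighP cd; have [_ hf' ho' _] := sighP hv.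
have z01 : unit_itv 0 by apply/unitP; rewrite lexx ler01.
have m01 : unit_itv t0 by apply/open_unit_sub/open_unitP.
have := hm; rewrite -ho' => -[[t s] [/= /open_unitP t01' /open_unitP s01] e].
have s01' : unit_itv s by apply/open_unit_sub/open_unitP.
have tu : unit_itv t by apply/open_unit_sub/open_unitP.
have := hf (t0, i) (conj m01 i01); rewrite -e (hf' (t, s) (conj tu s01')).
have st01 : 0 <= s <= 1 by exact/unitP.
have it01 : 0 <= i <= 1 by exact/unitP.
move=> /hchar_eq[||||/= tm cc] //.
have em : sigh c (t0, i) = sigh h (t0, 0).
  by rewrite -e -tm; exact: sigh_vertex hv v0 tu s01' z01.
apply: (f_unique_lift (A := unit_itv) (h1 := fun t => sigh c (t, i))
  (h2 := fun t => sigh h (t, 0)) connected_unit _ _ _ m01 em).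
- exact: sigh_slice cd i01.
- exact: sigh_slice hv z01.
- move=> u u01; rewrite (hf (u, i) (conj u01 i01)) (hf' (u, 0) (conj u01 z01)).
  rewrite /hchar /=; congr (cyl _ _).
  by rewrite -cc; exact: chi_cst.
Qed.

Lemma dim_inl c d : tau c = inl d -> dim c = dim d.
Proof. by move=> cd; rewrite -dim_tau cd. Qed.

Lemma dim_inr c (d : set_type H) : tau c = inr d -> dim c = (dim (set_val d)).+1.
Proof. by move=> cd; rewrite -dim_tau cd. Qed.

Lemma unit_half : unit_itv 2^-1.
Proof. by apply/unitP; apply/andP; split; lra. Qed.

Lemma unit_bool (i : bool) : unit_itv i%:R.
Proof. by apply/unitP; case: i; rewrite ?lexx ?ler01. Qed.

Lemma sigh_in_inr c (d v : set_type H) h t s : tau c = inr d -> tau h = inr v ->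
  sq (t, s) -> open_cell h (sigh c (t, s)) ->
  0 < t < 1 /\ open_cell (set_val v) (chi (set_val d) s).
Proof.
move=> cd hv ts hts; have [_ hf _ _] := sighP cd; have [t01 s01] := ts.
have := open_cell_tau hts; rewrite (hf _ ts) hv /hchar /= => vts.
have Hx : space_of H (chi (set_val d) s) by apply: hchar_space; apply/unitP.
have nb x : ~ open_cell (inr v : cell SX) (base x).
  by move=> vx; have [e ex] := open_cell_ex cw x; have := open_cell_baseP vx ex.
move: t01 => /unitP/andP[]; rewrite le_eqVlt => /predU1P[t0|t0].
  by exfalso; apply: (nb (chi (set_val d) s)); rewrite -mt_cyl0 // t0.
rewrite le_eqVlt => /predU1P[t1|t1].
  by exfalso; apply: (nb (psi (chi (set_val d) s))); rewrite -mt_cyl1 // -t1.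
have t01' : 0 < t < 1 by rewrite t0.
split => //; have [e ex] := H_cell Hx.
by have [->] := open_cell_cylP t01' vts ex.
Qed.

Lemma sigh_in_inl c (d : set_type H) a e t s : tau c = inr d -> tau a = inl e ->
  sq (t, s) -> open_cell a (sigh c (t, s)) ->
  (t = 0 /\ open_cell e (chi (set_val d) s)) \/
  (t = 1 /\ open_cell e (psi (chi (set_val d) s))).
Proof.
move=> cd ae ts ats; have [_ hf _ _] := sighP cd; have [t01 s01] := ts.
have := open_cell_tau ats; rewrite (hf _ ts) ae /hchar /= => ets.
have Hx : space_of H (chi (set_val d) s) by apply: hchar_space; apply/unitP.
have bs x : open_cell (inl e : cell SX) (base x) -> open_cell e x.
  by move=> ex; have [e' ex'] := open_cell_ex cw x; have [->] := open_cell_baseP ex ex'.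
move: t01 => /unitP/andP[]; rewrite le_eqVlt => /predU1P[t0|t0].
  by move=> _; left; split => //; apply: bs; rewrite -mt_cyl0 // t0.
rewrite le_eqVlt => /predU1P[t1|t1].
  by right; split => //; apply: bs; rewrite -mt_cyl1 // -t1.
have t01' : 0 < t < 1 by rewrite t0.
by have [e' ex] := H_cell Hx; have := open_cell_cylP t01' ets ex.
Qed.

Lemma vertex_end (v d : cell S) s : dim v = 0%N -> dim d = 1%N -> unit_itv s ->
  open_cell v (chi d s) -> exists i : bool, s = i%:R.
Proof.
move=> v0 d1 /unitP/andP[]; rewrite le_eqVlt => /predU1P[<- _ _|s0]; first by exists false.
rewrite le_eqVlt => /predU1P[-> _|s1 vs]; first by exists true.
have ds : open_cell d (chi d s) by apply: chi_open; rewrite ?s0.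
by move: d1; rewrite (open_cell_inj cw ds vs) v0.
Qed.

Lemma edge_unit (e : cell S) s : dim e = 1%N -> unit_itv s -> open_cell e (chi e s) ->
  0 < s < 1.
Proof.
move=> e1 /unitP/andP[s0 s1] es; have [[v v0 v0x] [w w0 w1x]] := chi_end F_graph e.
rewrite !lt_neqAle s0 s1 !andbT; apply/andP; split; apply/eqP => se.
  by move: e1; rewrite -se in es; rewrite (open_cell_inj cw es v0x) v0.
by move: e1; rewrite se in es; rewrite (open_cell_inj cw es w1x) w0.
Qed.

Lemma side_ex c (d : set_type H) (i : bool) : tau c = inr d -> exists h (v : set_type H),
  [/\ tau h = inr v, dim (set_val v) = 0%N, open_cell h (sigh c (2^-1, i%:R)) &
      open_cell (set_val v) (chi (set_val d) i%:R)].
Proof.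
move=> cd; have [_ hf _ _] := sighP cd.
have i01 := unit_bool i; have ei := hf _ (conj unit_half i01 : sq (2^-1, i%:R)).
have Hx : space_of H (chi (set_val d) i%:R) by apply: hchar_space; apply/unitP.
have [v vx] := H_cell Hx; have [h hx] := open_cell_ex cwY (sigh c (2^-1, i%:R)).
exists h, v; split => //; first by apply: tau_cyl hx ei _ vx; apply/andP; split => /=; lra.
have [[w w0 wx] [w' w0' wx']] := chi_end F_graph (set_val d).
by case: (i) vx => vx; [rewrite (open_cell_inj cw vx wx')|rewrite (open_cell_inj cw vx wx)].
Qed.

Lemma bottom_ex c (d : set_type H) : tau c = inr d -> dim (set_val d) = 1%N ->
  exists2 a, tau a = inl (set_val d) & forall s, unit_itv s -> sigh c (0, s) = sigv a s.
Proof.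
move=> cd d1; have [_ hf _ _] := sighP cd.
have z01 : unit_itv 0 := unit_bool false.
have [a am] := open_cell_ex cwY (sigh c (0, 2^-1)).
have fE s : unit_itv s -> f (sigh c (0, s)) = vchar (set_val d) s.
  move=> s01; rewrite (hf (0, s) (conj z01 s01)) /hchar /= mt_cyl0 //.
  by apply: hchar_space; apply/unitP.
have mo : open_cell (set_val d) (chi (set_val d) 2^-1).
  by apply: chi_open => //; apply/andP; split; lra.
have ad : tau a = inl (set_val d) by apply: tau_base am (fE _ unit_half) mo.
exists a => // s /unitP s01.
apply: (@sigv_lift (fun s => sigh c (0, s)) id 0 1 a (set_val d) 2^-1) => //.
- exact: sigh_row cd z01.
- by apply: continuous_subspaceT => ?; exact: cvg_id.
- by apply/andP; split; lra.
- by apply/andP; split; lra.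
Qed.

(** Free faces are defined through [cmap SY], but passages are computed with [sigh];
    [connected_passage] transfers the count when the passage is single. *)
Lemma cmap_connected c (d : set_type H) (a : cell SY) : tau c = inr d ->
  open_cell a `<=` closed_cell c ->
  let J := sq `&` sigh c @^-1` open_cell a in set_inj J (sigh c) -> connected J ->
  connected (cube R (dim c) `&` cmap SY c @^-1` open_cell a).
Proof.
move=> cd ac J Ji cJ; have [hc hf ho hcl] := sighP cd.
apply: (@connected_passage R _ _ _ (cube R (dim c)) (open_cube R (dim c)) sq osq
  (cmap SY c) (sigh c)) => //.
- exact: pseudometric_normal.
- exact: compact_cube.
- exact: cw_continuous.
- exact: open_cube_sub.
- exact: cube_sub_closure.
- exact: cw_injective.
- apply/seteqP; split => // _ [[u [cu nu] <-] cu'].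
  have [b [bc bx]] := cmap_boundary cwY cu nu.
  by move: bc; rewrite (open_cell_inj cwY bx cu') ltnn.
- exact: compact_sq.
- by move=> p [p1 p2]; split; exact: open_unit_sub.
- by move=> y /ac/hcl.
- by move=> p [pS _]; exact: locally_connected_sq.
Qed.

(** * Consequences of collapsedness and of the absence of isolated edges *)

Hypothesis Y_collapsed : collapsed SY.
Hypothesis Y_not_isolated : forall e : cell SY, ~ isolated_edge e.

Lemma two_cell c : dim c = 2%N -> exists2 d : set_type H, tau c = inr d & dim (set_val d) = 1%N.
Proof.
move=> c2; case cd : (tau c) => [d|d].
  by have := F_graph.2 d; rewrite -(dim_inl cd) c2.
by exists d => //; move: c2; rewrite (dim_inr cd) => -[].
Qed.

Lemma face_ex (e : cell SY) : dim e = 1%N -> exists c (d : set_type H), [/\ tau c = inr d,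
  dim (set_val d) = 1%N, is_face e c & open_cell e `<=` sigh c @` sq].
Proof.
move=> e1; apply: contrapT => ne; apply: (@Y_not_isolated e); split => // c c2 ec.
apply: ne; have [d cd d1] := two_cell c2; exists c, d; split => //.
by have [_ hcl] := ec; have [_ _ _ h] := sighP cd; move=> y /hcl/h.
Qed.

Lemma face_two_cell (e c : cell SY) : dim e = 1%N -> is_face e c -> exists d : set_type H,
  [/\ tau c = inr d, dim (set_val d) = 1%N & open_cell e `<=` sigh c @` sq].
Proof.
move=> e1 [ec ecl]; have c2 : dim c = 2%N.
  by have := Y_complex.2 c; move: ec; rewrite e1; case: (dim c) => [|[|[|]]].
have [d cd d1] := two_cell c2; exists d; split => //.
by have [_ _ _ h] := sighP cd; move=> y /ecl/h.
Qed.

Lemma horizontal_corner c (d v : set_type H) h y : tau c = inr d -> dim (set_val d) = 1%N ->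
  tau h = inr v -> dim (set_val v) = 0%N -> open_cell h y -> (sigh c @` sq) y ->
  exists2 i : bool, open_cell h (sigh c (2^-1, i%:R)) &
    exists2 t, 0 < t < 1 & y = sigh c (t, i%:R).
Proof.
move=> cd d1 hv v0 hy [[t s] ts ey]; rewrite -ey in hy.
have [t01 vs] := sigh_in_inr cd hv ts hy; have [_ s01] := ts.
have [i si] := vertex_end v0 d1 s01 vs; exists i; last by exists t; rewrite // -si.
rewrite -si (sigh_side cd hv v0 s01 t01 hy unit_half).
have [_ _ ho _] := sighP hv; rewrite -ho; exists (2^-1, 2^-1).
  by split; apply/open_unitP => /=; apply/andP; split; lra.
exact: sigh_vertex hv v0 unit_half unit_half (unit_bool false).
Qed.

(** If [(c, i)] were the only corner along [h], then [h] would be a face of [c] alone, with preimage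
    the single side [s = i] without its ends, hence a free face. *)
Lemma two_corners c (d v : set_type H) h (i : bool) : tau c = inr d ->
  dim (set_val d) = 1%N -> tau h = inr v -> dim (set_val v) = 0%N ->
  open_cell h (sigh c (2^-1, i%:R)) ->
  exists c' (d' : set_type H) (i' : bool), [/\ tau c' = inr d', dim (set_val d') = 1%N,
    open_cell h (sigh c' (2^-1, i'%:R)) & (c', i') <> (c, i)].
Proof.
move=> cd d1 hv v0 hci; apply: contrapT => no.
have one c' d' (i' : bool) : tau c' = inr d' -> dim (set_val d') = 1%N ->
    open_cell h (sigh c' (2^-1, i'%:R)) -> (c', i') = (c, i).
  by move=> h1 h2 h3; apply: contrapT => ne; apply: no; exists c', d', i'.
have h1 : dim h = 1%N by rewrite (dim_inr hv) v0.
have [y hy] := open_cell_nonempty h.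
have faceE c' : is_face h c' -> c' = c.
  move=> hc'; have [d' [cd' d1' sub]] := face_two_cell h1 hc'.
  have [i' hi' _] := horizontal_corner cd' d1' hv v0 hy (sub _ hy).
  by have [] := one _ _ _ cd' d1' hi'.
have hc : is_face h c.
  by have [c' [_ [_ _ hc' _]]] := face_ex h1; rewrite -(faceE _ hc').
apply: (@Y_collapsed h c); split => //.
  by rewrite (dim_inr cd) d1 h1.
have [_ hf _ _] := sighP cd.
have JE : sq `&` sigh c @^-1` open_cell h = open_itv `*` [set i%:R].
  apply/seteqP; split => [[t s] [ts /= hts]|[t s] [/= t01 ->]].
    have [t01 vs] := sigh_in_inr cd hv ts hts; have [_ s01] := ts.
    have hx : (sigh c @` sq) (sigh c (t, s)) by exists (t, s).
    split => /=; first exact/open_unitP.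
    have [j sj] := vertex_end v0 d1 s01 vs.
    suff hj : open_cell h (sigh c (2^-1, j%:R)) by have [<-] := one c d j cd d1 hj.
    rewrite -sj (sigh_side cd hv v0 s01 t01 hts unit_half).
    have [_ _ ho _] := sighP hv; rewrite -ho; exists (2^-1, 2^-1).
      by split; apply/open_unitP => /=; apply/andP; split; lra.
    exact: sigh_vertex hv v0 unit_half unit_half (unit_bool false).
  split; first by split => //=; [exact: open_unit_sub|exact: unit_bool].
  have m01 : 0 < (2^-1 : R) < 1 by apply/andP; split; lra.
  rewrite /= (sigh_side cd hv v0 (unit_bool i) m01 hci (open_unit_sub t01)).
  have [_ _ ho _] := sighP hv; rewrite -ho; exists (t, 2^-1).
    by split => //; apply/open_unitP => /=; apply/andP; split; lra.
  exact: sigh_vertex hv v0 (open_unit_sub t01) unit_half (unit_bool false).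
have [_ hcl] := hc.
apply: (cmap_connected cd hcl); rewrite JE.
  move=> [t s] [t' s'] /set_mem[/= t01 ->] /set_mem[/= t01' ->] e.
  have := congr1 f e; rewrite (hf (t, i%:R) (conj (open_unit_sub t01) (unit_bool i))).
  rewrite (hf (t', i%:R) (conj (open_unit_sub t01') (unit_bool i))).
  have iu : 0 <= (i%:R : R) <= 1 by apply/unitP; exact: unit_bool.
  by move=> /hchar_eq[||||/= -> _] //; exact/open_unitP.
by apply: connectedX; [apply/connected_intervalP; exact: interval_is_interval|exact: connected1].
Qed.

(** If no top side met [a], only bottom sides over the same edge [d] would; by [sigh_same] these all
    belong to [c], so [a] would be a free face of [c]. *)
Lemma bottom_crossed c (d : set_type H) a : tau c = inr d -> dim (set_val d) = 1%N ->
  tau a = inl (set_val d) -> (forall s, unit_itv s -> sigh c (0, s) = sigv a s) ->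
  exists c' (d' : set_type H) s, [/\ tau c' = inr d', dim (set_val d') = 1%N,
    unit_itv s & open_cell a (sigh c' (1, s))].
Proof.
move=> cd d1 ad bot; apply: contrapT => no.
have a1 : dim a = 1%N by rewrite (dim_inl ad).
have [_ vf vo _] := sigvP ad.
have z01 : unit_itv 0 := unit_bool false.
have point c' d' t s : tau c' = inr d' -> dim (set_val d') = 1%N -> sq (t, s) ->
    open_cell a (sigh c' (t, s)) -> [/\ t = 0, c' = c & open_itv s].
  move=> cd' d1' ts ats; have [_ s01] := ts.
  have [_ hf' _ _] := sighP cd'.
  have [[t0 es]|[t1 es]] := sigh_in_inl cd' ad ts ats; last first.
    by exfalso; apply: no; exists c', d', s; split => //; rewrite -t1.
  subst t; have dd : d' = d.
    apply: val_inj; apply: (open_cell_inj cw _ es).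
    have := es; case: (pselect (0 < s < 1)) => [s01' _|ns]; first exact: chi_open.
    move=> es'; exfalso; have [[v v0 v0x] [w w0 w1x]] := chi_end F_graph (set_val d').
    have [s0|s1] : s = 0 \/ s = 1.
      have [->|s0] := eqVneq s 0; [by left|have [->|s1] := eqVneq s 1; first by right].
      exfalso; apply: ns; move: s01 => /unitP/andP[h0 h1].
      by rewrite !lt_neqAle [0 == s]eq_sym s0 s1 h0 h1.
    + by move: d1; rewrite s0 in es'; rewrite (open_cell_inj cw es' v0x) v0.
    + by move: d1; rewrite s1 in es'; rewrite (open_cell_inj cw es' w1x) w0.
  subst d'; have s01' := edge_unit d1 s01 es.
  split => //.
  apply: (sigh_same cd' cd ts); rewrite bot //.
  move: ats; rewrite -vo => -[u u01 eu]; rewrite -eu; congr (sigv a _).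
  apply: (chi_inj F_graph d1); rewrite ?inE //.
  apply: vchar_eq; rewrite -vf; last exact: open_unit_sub.
  rewrite eu (hf' _ ts) /hchar /= mt_cyl0 //.
  by apply: hchar_space; apply/unitP.
have [y ay] := open_cell_nonempty a.
have faceE c' : is_face a c' -> c' = c.
  move=> ac'; have [d' [cd' d1' sub]] := face_two_cell a1 ac'.
  have [[t s] ts ey] := sub _ ay; rewrite -ey in ay.
  by have [] := point _ _ _ _ cd' d1' ts ay.
have ac : is_face a c.
  by have [c' [_ [_ _ ac' _]]] := face_ex a1; rewrite -(faceE _ ac').
apply: (@Y_collapsed a c); split => //.
  by rewrite (dim_inr cd) d1 a1.
have JE : sq `&` sigh c @^-1` open_cell a = [set 0] `*` open_itv.
  apply/seteqP; split => [[t s] [ts /= hts]|[t s] [/= -> s01]].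
    by have [-> _ s01] := point _ _ _ _ cd d1 ts hts.
  split; first by split => //=; exact: open_unit_sub.
  by rewrite /= bot; [rewrite -vo; exists s|exact: open_unit_sub].
have [_ acl] := ac.
apply: (cmap_connected cd acl); rewrite JE.
  move=> [t s] [t' s'] /set_mem[/= -> s01] /set_mem[/= -> s01'].
  rewrite !bot; [|exact: open_unit_sub|exact: open_unit_sub].
  move=> /(congr1 f); rewrite !vf; [|exact: open_unit_sub|exact: open_unit_sub].
  by move=> /vchar_eq/(chi_inj F_graph d1) -> //; rewrite inE.
by apply: connectedX; [exact: connected1|apply/connected_intervalP; exact: interval_is_interval].
Qed.

End Immersion.
End MappingTorusComplex.

(** * Darts of the immersed complex *)

Section Darts.
Context {R : realType} {F : topologicalType} (S : cell_structure R F).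
Context (H : set (cell S)) (psi : F -> F).
Hypotheses (F_graph : is_graph S) (F_finite : is_finite_complex S).
Hypotheses (H_subgraph : is_subcomplex H) (psi_cellular : cellular_on S S H psi).
Hypothesis psi_immersion : immersion (space_of H) psi.
Context (Y : topologicalType) (SY : cell_structure R Y) (f : Y -> mt_space H psi).
Hypotheses (Y_complex : is_2_complex SY).
Hypotheses (f_comb : combinatorial SY (mapping_torus_cells H psi) f).
Hypotheses (f_imm : immersion [set: Y] f) (Y_compact : compact [set: Y]).
Hypotheses (Y_collapsed : collapsed SY).
Hypotheses (Y_not_isolated : forall e : cell SY, ~ isolated_edge e).
Let cw : is_cw_complex S := F_graph.1.
Let cwY : is_cw_complex SY := Y_complex.1.

Local Notation chi := (@chi R F S).
Local Notation is_segment := (@is_segment R F S H psi).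
Local Notation tau := (tau f_comb).
Local Notation sigv := (sigv F_graph F_finite psi_immersion.1 Y_complex f_comb f_imm Y_compact).
Local Notation sigh := (sigh F_graph F_finite H_subgraph psi_immersion.1 Y_complex f_comb f_imm Y_compact).
Local Notation sigvP := (sigvP F_graph F_finite psi_immersion.1 Y_complex f_imm Y_compact).
Local Notation sighP := (sighP F_graph F_finite H_subgraph psi_immersion.1 Y_complex f_imm Y_compact).
Local Notation sigh_vertex := (sigh_vertex F_graph F_finite H_subgraph psi_immersion.1
  Y_complex f_imm Y_compact).
Local Notation target := (target F_graph F_finite H_subgraph psi_immersion).
Local Notation theta := (theta F_graph F_finite H_subgraph psi_immersion).
Local Notation passageP := (passageP F_graph F_finite H_subgraph psi_immersion).
Local Notation base := (@mt_base R F (space_of H) psi).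
Local Notation unit_itv := (`[0, 1]%classic : set R).

Lemma H_val (d : set_type H) : H (set_val d).
Proof. exact: set_mem (valP d). Qed.

Lemma vertex_over y x : f y = base x -> vertex S x ->
  exists v : cell SY, [/\ dim v = 0%N, open_cell v y &
    forall w, open_cell w x -> tau v = inl w].
Proof.
move=> fy [w w0 wx]; have [v vy] := open_cell_ex cwY y.
have vw := tau_base F_graph H_subgraph f_comb vy fy wx; exists v; split => //.
  by rewrite (dim_inl vw).
by move=> w' w'x; rewrite (open_cell_inj cw w'x wx).
Qed.

Lemma dart_from (d : cell S) r : H d -> dim d = 1%N -> vertex_times psi d r ->
  exists l : dart S, [/\ is_segment l.1, dsource l = d & dstart l = r].
Proof.
move=> Hd d1 vr; have /vertex_timesP[/andP[r0 r1] _] := vr.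
have [r1'|r1'] := ltP r 1.
  have [b sb] := segment_right F_graph F_finite H_subgraph psi_cellular psi_immersion Hd d1 vr r1'.
  by exists ((d, r, b), false).
have r0' : 0 < r by apply: lt_le_trans r1'; exact: ltr01.
have [a sa] := segment_left F_graph F_finite H_subgraph psi_cellular psi_immersion Hd d1 vr r0'.
by exists ((d, a, r), true).
Qed.

Lemma dart_at_end (d : cell S) (i : bool) : H d -> dim d = 1%N ->
  exists l : dart S, [/\ is_segment l.1, dsource l = d & dstart l = i%:R].
Proof.
move=> Hd d1; have [v0 v1] := vertex_times_end F_graph H_subgraph psi_cellular Hd.
by apply: dart_from => //; case: i.
Qed.

(* The dart l of H lifts to the top side of the 2-cell c. *)
Definition lifted (c : cell SY) (l : dart S) : Prop :=
  is_segment l.1 /\ exists2 d : set_type H, tau c = inr d & set_val d = dsource l.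

Lemma dstart_unit (l : dart S) : is_segment l.1 -> unit_itv (dstart l).
Proof.
case: l => -[[e a] b] i /= sm; have [a0 b1] := segment_bounds sm.
have ab : a < b by case: sm.
by rewrite in_itv /= /dstart; case: i; apply/andP; split => /=; lra.
Qed.

Lemma dsource_dim (l : dart S) : is_segment l.1 -> dim (dsource l) = 1%N.
Proof. by case: l => -[[e a] b] i []. Qed.

(** An interior parameter: its image on the top side tells which vertical edge the lift of the
    segment crosses. *)
Definition smid (m : segment S) : R := (m.1.2 + m.2) / 2.

Lemma sigh_top c (d : set_type H) s : tau c = inr d -> unit_itv s ->
  f (sigh c (1, s)) = base (psi (chi (set_val d) s)).
Proof.
move=> cd s01; have [_ hf _ _] := sighP cd.
have o01 : unit_itv 1 by apply/unitP; rewrite lexx ler01.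
rewrite (hf (1, s) (conj o01 s01)) /hchar /= mt_cyl1 //.
by apply: hchar_space => //; apply/unitP.
Qed.

Lemma sigh_bottom c (d : set_type H) s : tau c = inr d -> unit_itv s ->
  f (sigh c (0, s)) = base (chi (set_val d) s).
Proof.
move=> cd s01; have [_ hf _ _] := sighP cd.
have o01 : unit_itv 0 by apply/unitP; rewrite lexx ler01.
rewrite (hf (0, s) (conj o01 s01)) /hchar /= mt_cyl0 //.
by apply: hchar_space => //; apply/unitP.
Qed.

(** Since [psi] maps a segment across a single edge, unique lifting keeps the top side over it in a
    single vertical edge, with coordinate [theta]. *)
Lemma top_edge c l a : lifted c l -> open_cell a (sigh c (1, smid l.1)) ->
  tau a = inl (target l.1) /\
  forall s, l.1.1.2 <= s <= l.1.2 -> sigh c (1, s) = sigv a (theta l.1 s).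
Proof.
case: l => -[[e x] y] i [/= sm [d cd ed]] am; rewrite /smid /dsource /= in am ed *.
have [x0 y1] := segment_bounds sm; have xy : x < y by case: sm.
have [e1 thc thE tho _] := passageP sm.
have mxy : x < (x + y) / 2 < y by apply/andP; split; lra.
have mxy' : x <= (x + y) / 2 <= y by apply/andP; split; lra.
have in01 s : x <= s <= y -> unit_itv s.
  by move=> /andP[h1 h2]; apply/unitP; apply/andP; split; lra.
have fE s : x <= s <= y -> f (sigh c (1, s)) = vchar H psi (target (e, x, y)) (theta (e, x, y) s).
  move=> sxy; rewrite (sigh_top cd (in01 _ sxy)) /vchar ed.
  by have [_ ->] := thE s sxy.
have ae : tau a = inl (target (e, x, y)).
  apply: (tau_base F_graph H_subgraph f_comb am (fE _ mxy')); apply: chi_open => //; exact: tho.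
split => // s sxy.
have o01 : unit_itv 1 by apply/unitP; rewrite lexx ler01.
apply: (sigv_lift F_graph F_finite psi_immersion.1 Y_complex f_imm Y_compact
  (P := fun s => sigh c (1, s)) _ thc _ fE ae e1 mxy' am (tho _ mxy)) => //.
  apply: continuous_subspaceW (@sigh_row _ _ _ _ _ _ _ _ _ _ _ _ _ _ _ _ _ _ _ cd o01).
  by move=> t; rewrite /= in_itv /= => /in01.
by move=> t txy; have [] := thE t txy.
Qed.

(** At a subdivision point inside the edge, the other dart is the neighbouring segment of the same
    2-cell; at a corner, [two_corners] supplies another corner along the same horizontal edge. *)
Lemma other_dart c l : lifted c l -> exists c' l', [/\ lifted c' l',
  sigh c' (2^-1, dstart l') = sigh c (2^-1, dstart l) & (c', l') <> (c, l)].
Proof.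
move=> [sl [d cd ed]]; have l1 := dsource_dim sl.
have d1 : dim (set_val d) = 1%N by rewrite ed.
have /unitP/andP[r0 r1] := dstart_unit sl.
have [inner|[i ei]] : 0 < dstart l < 1 \/ exists i : bool, dstart l = i%:R.
  move: r0 r1; rewrite !le_eqVlt => /predU1P[<- _|r0]; first by right; exists false.
  by move=> /predU1P[->|r1]; [right; exists true|left; rewrite r0].
- move: inner sl {r0 r1} ed l1; case: l => -[[e a] b] []; rewrite /dstart /dsource /=.
    move=> /andP[_ b1] sl ed l1.
    have [He _ _ [_ vb] _] := sl.
    have [b' sb] := segment_right F_graph F_finite H_subgraph psi_cellular psi_immersion He l1 vb b1.
    by exists c, ((e, b, b'), false); split => //; split => //; exists d.
  move=> /andP[a0 _] sl ed l1.
  have [He _ _ [va _] _] := sl.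
  have [a' sa] := segment_left F_graph F_finite H_subgraph psi_cellular psi_immersion He l1 va a0.
  by exists c, ((e, a', a), true); split => //; split => //; exists d.
have [h [v [hv v0 hm _]]] := side_ex F_graph F_finite H_subgraph psi_immersion.1 Y_complex
  f_imm Y_compact i cd.
have [c' [d' [i' [cd' d1' hm' ne]]]] := two_corners Y_collapsed Y_not_isolated cd d1 hv v0 hm.
have [l' [sl' el' il']] := dart_at_end i' (H_val d') d1'.
exists c', l'; split; first by split => //; exists d'.
  have m01 : 0 < (2^-1 : R) < 1 by apply/andP; split; lra.
  have mu : unit_itv 2^-1 := unit_half.
  rewrite il' ei (sigh_side cd' hv v0 (unit_bool i') m01 hm' mu) //.
  by rewrite (sigh_side cd hv v0 (unit_bool i) m01 hm mu).
move=> [cc ll]; apply: ne; rewrite cc; congr (_, _).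
move: il'; rewrite ll ei; case: (i) (i') => -[] //= /eqP; rewrite ?oner_eq0 //.
by rewrite eq_sym oner_eq0.
Qed.

Lemma crossing_dart c (d : set_type H) a e s : tau c = inr d -> dim (set_val d) = 1%N ->
  tau a = inl e -> dim e = 1%N -> unit_itv s -> open_cell a (sigh c (1, s)) ->
  exists2 l, lifted c l & open_cell a (sigh c (1, smid l.1)) /\ l.1.1.2 <= s <= l.1.2.
Proof.
move=> cd d1 ae e1 s01 as_.
have nv : ~ vertex S (psi (chi (set_val d) s)).
  move=> vx; have [v [v0 vs _]] := vertex_over (sigh_top cd s01) vx.
  have := dim_inl ae; rewrite e1 (open_cell_inj cwY as_ vs) v0.
  by [].
have s01' : 0 <= s <= 1 by apply/unitP.
have [x [y [sm sxy]]] := segment_around F_graph F_finite H_subgraph psi_cellular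
  psi_immersion (H_val d) d1 s01' nv.
pose l : dart S := ((set_val d, x, y), false).
have cl : lifted c l by split => //; exists d.
exists l => //; have [b bm] := open_cell_ex cwY (sigh c (1, smid l.1)).
have [be bE] := top_edge cl bm.
have sxy' : x <= s <= y by move: sxy => /andP[h1 h2]; rewrite !ltW.
suff -> : a = b by [].
apply: (open_cell_inj cwY as_); rewrite bE //.
have [_ _ _ tho _] := passageP sm.
have [_ _ vo _] := sigvP be; rewrite -vo; exists (theta l.1 s) => //.
by rewrite /= in_itv /=; exact: tho.
Qed.

Lemma bottom_dart c (d : set_type H) a : tau c = inr d -> dim (set_val d) = 1%N ->
  tau a = inl (set_val d) -> (forall s, unit_itv s -> sigh c (0, s) = sigv a s) ->
  exists c' l, lifted c' l /\ open_cell a (sigh c' (1, smid l.1)).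
Proof.
move=> cd d1 ad bot.
have [c' [d' [s [cd' d1' s01 as_]]]] := bottom_crossed Y_collapsed Y_not_isolated cd d1 ad bot.
by have [l cl [am _]] := crossing_dart cd' d1' ad d1 s01 as_; exists c', l.
Qed.

Lemma vertex_image (v : cell SY) y : dim v = 0%N -> open_cell v y ->
  exists w : cell S, [/\ tau v = inl w, dim w = 0%N & forall s, f y = base (chi w s)].
Proof.
move=> v0 vy; have := open_cell_tau f_comb vy; case vw : (tau v) => [w|w].
  have w0 : dim w = 0%N by rewrite -(dim_inl vw).
  rewrite open_cell_inl // => -[s _ <-]; exists w; split => // t.
  by congr base; exact: chi_cst.
by have := dim_inr vw; rewrite v0.
Qed.

Lemma base_end y x c (d : set_type H) t s : f y = base x -> tau c = inr d ->
  unit_itv t -> unit_itv s -> sigh c (t, s) = y -> t = 0 \/ t = 1.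
Proof.
move=> fy cd t01 s01 e; have [_ hf _ _] := sighP cd.
have := hf (t, s) (conj t01 s01); rewrite e fy /hchar /= => bc.
move: t01 => /unitP/andP[]; rewrite le_eqVlt => /predU1P[<-|t0 t1]; first by left.
move: t1; rewrite le_eqVlt => /predU1P[->|t1]; first by right.
have Hx : space_of H (chi (set_val d) s) by apply: hchar_space => //; apply/unitP.
have [e' ex] := H_cell Hx; have [e'' ex'] := open_cell_ex cw x.
have t01 : 0 < t < 1 by rewrite t0.
have := congr1 (@mt_coord _ _ _ _) bc.
by rewrite mt_coord_base mt_coord_cyl.
Qed.

(** If no horizontal edge starts at [y] and no top side has a dart there, then no closed cell other
    than [v] contains [y]. So the point [y] is open as well as closed, and connectedness leaves
    nothing else. *)
Lemma vertex_reached (v : cell SY) y : connected [set: Y] -> dim v = 0%N ->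
  open_cell v y ->
  (forall h (u : set_type H), tau h = inr u -> dim (set_val u) = 0%N ->
    sigh h (0, 0) <> y) ->
  (exists c l, lifted c l /\ sigh c (1, dstart l) = y) \/ [set: Y] = [set y].
Proof.
move=> Y_conn v0 vy nout; apply: contrapT => /not_orP[ntop nsing]; apply: nsing.
have [w [vw w0 fy]] := vertex_image v0 vy.
have wx : open_cell w (chi w 0) by exact: chi_vertex.
have [z01 o01] : unit_itv 0 /\ unit_itv 1 by split; apply/unitP; rewrite lexx ler01.
have m01 : 0 < (2^-1 : R) < 1 by apply/andP; split; lra.
have base_inj x x' : base x = base x' -> x = x'.
  by move=> /(congr1 (@mt_coord _ _ _ _)); rewrite !mt_coord_base => -[].
have corner0 c (d : set_type H) (i : bool) : tau c = inr d -> sigh c (0, i%:R) <> y.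
  move=> cd; have [h [u [hu u0 hm _]]] := side_ex F_graph F_finite H_subgraph
    psi_immersion.1 Y_complex f_imm Y_compact i cd.
  by rewrite (sigh_side cd hu u0 (unit_bool i) m01 hm z01); exact: nout hu u0.
have top1 c (d : set_type H) s : tau c = inr d -> dim (set_val d) = 1%N ->
    unit_itv s -> sigh c (1, s) <> y.
  move=> cd d1 s01 ey; apply: ntop.
  have vs : vertex_times psi (set_val d) s.
    apply/vertex_timesP; split; first exact/unitP.
    exists w => //; suff -> : psi (chi (set_val d) s) = chi w 0 by [].
    by apply: base_inj; rewrite -(sigh_top cd s01) ey.
  have [l [sl el il]] := dart_from (H_val d) d1 vs.
  by exists c, l; rewrite il; split => //; split => //; exists d.
(* A vertical edge ending at [y] lies on a 2-cell: at the top, its end starts a dart; at the bottom,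
   its end is a lower corner, the lower end of a horizontal edge. A horizontal edge or a 2-cell can
   reach [y] only at height 0 or 1, which leads to the same two contradictions. *)
have notin c : c <> v -> ~ closed_cell c y.
  move=> cv; case ce : (tau c) => [e|d] cy.
  - have [e0|e1] := dim_graph F_graph e.
      apply: cv; apply: (open_cell_inj cwY _ vy).
      move: cy => [u cu <-]; exists u => // -[j jlt].
      by exfalso; move: jlt; rewrite (dim_inl ce) e0.
    have [_ vf vo vcl] := sigvP ce.
    have [s s01 es] := vcl _ cy.
    have [i si] : exists i : bool, s = i%:R.
      apply: (vertex_end F_graph w0 e1 s01).
      by suff -> : chi e s = chi w 0 by []; apply: base_inj; rewrite -fy -es vf.
    have c1 : dim c = 1%N by rewrite (dim_inl ce).
    have [c' [d' [cd' d1' _ sub]]] := face_ex F_graph F_finite H_subgraph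
      psi_immersion.1 Y_complex f_comb f_imm Y_compact Y_not_isolated c1.
    have cm : open_cell c (sigv c 2^-1) by rewrite -vo; exists 2^-1 => //; apply/open_unitP.
    have [[t s'] ts em] := sub _ cm; have [t01 s01'] := ts.
    rewrite -em in cm.
    have [[t0 es']|[t1 _]] := sigh_in_inl cd' ce ts cm; last first.
      rewrite t1 /= in cm.
      have [l cl [lm _]] := crossing_dart cd' d1' ce e1 s01' cm.
      have [_ lE] := top_edge cl lm.
      have [[sl _] [x0 y1]] : lifted c' l /\ (0 <= l.1.1.2 /\ l.1.2 <= 1).
        split => //; case: cl => sl _; move: sl; case: (l) => -[[? ?] ?] ? sl.
        exact: segment_bounds sl.
      have [r rl er] : exists2 r, l.1.1.2 <= r <= l.1.2 & theta l.1 r = i%:R.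
        move: sl; case: (l) => -[[ee x] z] ? /= sl; have xz : x < z by case: sl.
        have [_ _ _ _ ends] := passageP sl.
        case: (i) ends => -[[h1 h2]|[h1 h2]]; [exists z|exists x|exists x|exists z] => //;
        by apply/andP; split; lra.
      apply: (@top1 c' d' r cd' d1'); first by apply/unitP; move: rl => /andP[? ?]; apply/andP; split; lra.
      by rewrite lE // er -si es.
    have s01o : 0 < s' < 1.
      have [ve0 ve1] := chi_end F_graph (set_val d').
      have := edge_not_vertex F_graph e1 es'; move: s01' => /unitP/andP[h0 h1] nv.
      rewrite !lt_neqAle h0 h1 !andbT; apply/andP; split; apply/eqP => ss; apply: nv;
      by rewrite ?ss // -ss.
    have [a ad aE] := bottom_ex F_graph F_finite H_subgraph psi_immersion.1 Y_complex
      f_imm Y_compact cd' d1'.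
    have ac : a = c.
      apply: (open_cell_inj cwY _ cm); rewrite t0 aE //.
      by have [_ _ ao _] := sigvP ad; rewrite -ao; exists s' => //; apply/open_unitP.
    by apply: (@corner0 c' d' i cd'); rewrite aE ?ac -?si // -si.
  - have [_ hf ho hcl] := sighP ce; have [[t s] ts ey] := hcl _ cy.
    have [t01 s01] : unit_itv t /\ unit_itv s := ts.
    have te := base_end (fy 0) ce t01 s01 ey.
    have [d0|d1] := dim_graph F_graph (set_val d).
      case: te => tE; rewrite tE in ey.
        by apply: (nout _ _ ce d0); rewrite -ey; exact: (sigh_vertex ce d0 z01 z01 s01).
      have c1 : dim c = 1%N by rewrite (dim_inr ce) d0.
      have [c' [d' [cd' d1' _ sub]]] := face_ex F_graph F_finite H_subgraph
        psi_immersion.1 Y_complex f_comb f_imm Y_compact Y_not_isolated c1.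
      have [p cp] := open_cell_nonempty c.
      have [i hi _] := horizontal_corner cd' d1' ce d0 cp (sub _ cp).
      apply: (@top1 c' d' i%:R cd' d1' (unit_bool i)).
      rewrite (sigh_side cd' ce d0 (unit_bool i) m01 hi o01) -ey.
      exact: (sigh_vertex ce d0 o01 z01 s01).
    case: te => tE; rewrite tE in ey; last exact: top1 ce d1 s01 ey.
    have [i si] : exists i : bool, s = i%:R.
      apply: (vertex_end F_graph w0 d1 s01).
      suff -> : chi (set_val d) s = chi w 0 by [].
      by apply: base_inj; rewrite -fy -ey (sigh_bottom ce).
    by apply: (@corner0 c d i ce); rewrite -si.
have oy : open [set y].
  rewrite -closedC.
  have -> : ~` [set y] = \bigcup_(c in [set c : cell SY | c <> v]) closed_cell c.
    apply/seteqP; split => [z /= zy|z [c /= cv cz] zy]; last first.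
      by apply: (notin c cv); rewrite -zy.
    have [c cz] := open_cell_ex cwY z; exists c; last exact: open_sub_closed_cell.
    by move=> cv; apply: zy; subst c; exact: vertex_cell_unique v0 cz vy.
  apply: closed_bigcup.
    apply: sub_finite_set (finite_cells F_graph F_finite Y_complex f_comb f_imm Y_compact).
    by [].
  move=> c _; apply: compact_closed; first exact: cw_hausdorff cwY.
  exact: compact_closed_cell.
apply/esym; apply: Y_conn.
- by exists y.
- by exists [set y] => //; rewrite setTI.
- exists [set y]; last by rewrite setTI.
  apply: accessible_closed_set1; apply: hausdorff_accessible; exact: cw_hausdorff cwY.
Qed.

Lemma lifted_same c c' l t : lifted c l -> lifted c' l -> unit_itv t ->
  sigh c (t, dstart l) = sigh c' (t, dstart l) -> c = c'.
Proof.
move=> [sl [d cd ed]] [_ [d' cd' ed']] t01.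
have dd : d = d' by apply: val_inj; rewrite [LHS]ed [RHS]ed'.
by move=> e; apply: (sigh_same (p := (t, dstart l)) cd _ (conj t01 (dstart_unit sl)) e); rewrite dd.
Qed.

(** Half height is interior to the cylinder, so a common point there gives the same point of [H];
    the two vertical slices then lift one path of the torus and agree up to height 1. *)
Lemma lifted_mid c l c' l' : lifted c l -> lifted c' l' ->
  sigh c (2^-1, dstart l) = sigh c' (2^-1, dstart l') ->
  dpt l = dpt l' /\ sigh c (1, dstart l) = sigh c' (1, dstart l').
Proof.
move=> [sl [d cd ed]] [sl' [d' cd' ed']] e.
have r01 := dstart_unit sl; have r01' := dstart_unit sl'.
have m01 : 0 < (2^-1 : R) < 1 by apply/andP; split; lra.
have mu : unit_itv 2^-1 := unit_half.
have o01 : unit_itv 1 by apply/unitP; rewrite lexx ler01.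
have [_ hf _ _] := sighP cd; have [_ hf' _ _] := sighP cd'.
have cc : dpt l = dpt l'.
  have := congr1 f e; rewrite (hf (2^-1, dstart l) (conj mu r01)).
  rewrite (hf' (2^-1, dstart l') (conj mu r01')) => /(hchar_eq F_graph H_subgraph).
  by rewrite /dpt -ed -ed' => -[||||_ ->] //=; exact/unitP.
split => //.
have s1 : {within unit_itv, continuous (fun t => sigh c (t, dstart l))}.
  exact: sigh_slice cd r01.
have s2 : {within unit_itv, continuous (fun t => sigh c' (t, dstart l'))}.
  exact: sigh_slice cd' r01'.
apply: (f_unique_lift Y_complex f_imm (@connected_unit R) s1 s2 _ mu e o01).
move=> t t01; rewrite (hf (t, dstart l) (conj t01 r01)) (hf' (t, dstart l') (conj t01 r01')).
by rewrite /hchar /= ed ed' -/(dpt l) cc.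
Qed.

End Darts.

(** * Absence of circles and the rank of darts *)

Section Forest.
Context {R : realType} {F : topologicalType}.

Lemma forest_no_circle (Q : set F) :
  (exists (T : topologicalType) (ST : cell_structure R T),
     is_forest ST /\ homeomorphic (set_type Q) T) ->
  ~ exists g : R -> F, [/\ {within `[0, 1], continuous g}, g 0 = g 1,
    set_inj (`[0, 1[ : set R) g & forall u, 0 <= u <= 1 -> Q (g u)].
Proof.
move=> [T [ST [[_ nocirc] [h [h' [hc _ hK _]]]]]] [g [gc g01 gi gQ]].
have /choice[q qP] : forall u : R, exists x : set_type Q, 0 <= u <= 1 -> set_val x = g u.
  move=> u; have [u01|nu] := pselect (0 <= u <= 1).
    by exists (exist _ (g u) (mem_set (gQ u u01))).
  have z01 : 0 <= (0 : R) <= 1 by rewrite lexx ler01.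
  by exists (exist _ (g 0) (mem_set (gQ 0 z01))).
have qc : {within (`[0, 1] : set R), continuous q}.
  apply/within_continuousP => u u01 V [_ [[W oW <-] /= Wu WV]].
  have qu : set_val (q u) = g u by apply: qP; move: u01; rewrite /= in_itv.
  have nW : nbhs (g u) W by apply: open_nbhs_nbhs; split => //; rewrite -qu.
  have/within_continuousP/(_ u u01 W nW) := gc.
  apply: filterS => t tW t01; apply: WV => /=.
  rewrite (_ : set_val (q t) = g t); first exact: tW.
  by apply: qP; move: t01; rewrite in_itv.
apply: nocirc; exists (h \o q); split.
- apply/within_continuousP => u u01 V nV.
  by have/within_continuousP/(_ u u01 _ (hc _ _ nV)) := qc.
- congr (h _); apply: val_inj; change (set_val (q 0) = set_val (q 1)).
  by rewrite !qP ?lexx ?ler01.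
- move=> u v uI vI /(can_inj hK)/(congr1 set_val).
  have in01 w : w \in (`[0, 1[%classic : set R) -> 0 <= w <= 1.
    by move=> /set_mem; rewrite /= in_itv /= => /andP[-> /ltW ->].
  by rewrite !qP; [exact: gi|exact: in01|exact: in01].
Qed.

End Forest.

Section Acyclic.
Context {R : realType} {F : topologicalType} (S : cell_structure R F).
Context (H : set (cell S)) (psi : F -> F).
Hypotheses (F_graph : is_graph S) (F_finite : is_finite_complex S).
Hypotheses (H_subgraph : is_subcomplex H).
Hypothesis psi_immersion : immersion (space_of H) psi.
Hypothesis psi_forest : exists (T : topologicalType) (ST : cell_structure R T),
  is_forest ST /\ homeomorphic (set_type (space_of H `&` psi @^-1` space_of H)) T.
Local Notation target := (target F_graph F_finite H_subgraph psi_immersion).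

Definition is_dart (l : dart S) : Prop := is_segment H psi l.1.

(** The finite set of labels for the discharging; it involves only [H] and [psi], which makes the
    final constant independent of [Y]. *)
Definition darts : {fset (cell S * R * R * bool)} := fset_set is_dart.

Lemma dartsP (l : cell S * R * R * bool) : l \in darts <-> is_segment H psi l.1.
Proof.
rewrite /darts in_fset_set; first by split=> [/set_mem|/mem_set].
have -> : is_dart = is_segment H psi `*` [set: bool].
  by apply/seteqP; split => -[m i] // [].
apply: finite_setX; last exact: finite_finset.
exact: finite_segments.
Qed.

(** A cycle of steps would be a closed walk along segments of [H] whose images lie in [H]. It would
    contain an embedded circle in the preimage of [H], which the forest excludes. *)
Lemma dart_rank : exists rk : darts -> nat, forall l l' : darts,
  step (val l) (val l') -> H (target (val l).1) -> H (target (val l').1) ->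
  (rk l < rk l')%N.
Proof.
pose r (l l' : darts) := [&& step (val l) (val l'), `[< H (target (val l).1) >] &
  `[< H (target (val l').1) >]].
have [|rk rkP] := @acyclic_rank darts r; last first.
  by exists rk => l l' h1 h2 h3; apply: rkP; apply/and3P; split => //; exact/asboolP.
move=> x s ps lx; pose G (m : segment S) := is_segment H psi m /\ H (target m).
pose Q := space_of H `&` psi @^-1` space_of H.
apply: (forest_no_circle psi_forest).
have seg (l : darts) : is_segment H psi (val l).1 by apply/dartsP; exact: (valP l).
apply: (@closed_walk_circle _ _ _ H psi F_graph G Q _ _ (val x) (map val s)).
- by move=> m [].
- move=> e a b t [sm Ht] tab; have [a0 b1] := segment_bounds sm.
  have [He _ _ _ _] := sm; split.
    apply: chi_space => //; move: tab => /andP[h1 h2]; apply/andP; split; lra.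
  have [_ _ thE _ _] := passageP F_graph F_finite H_subgraph psi_immersion sm.
  by have [th01 /= <-] := thE t tab; exact: chi_space.
- have Gall l : l \in x :: s -> G (val l).1.
    rewrite inE => /orP[/eqP ->|ls]; first by move: lx => /and3P[_ _ /asboolP].
    have : all (fun l => `[< H (target (val l).1) >]) s.
      elim: s x ps {lx ls} => [//|m s IH] x /= /andP[/and3P[_ _ hm] ps].
      by rewrite hm; exact: IH ps.
    by move=> /allP/(_ l ls)/asboolP.
  by move=> m; rewrite -[_ :: _]/(map val (x :: s)) => /mapP[l ls ->]; exact: Gall.
- rewrite path_map; apply: sub_path ps => l l' /and3P[] //.
- by rewrite last_map; move: lx => /and3P[/asboolP[<- _] _ _].
Qed.

End Acyclic.

(** * The theorem *)

Section Inequality.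
Context {R : realType} {F : topologicalType} (S : cell_structure R F).
Context (H : set (cell S)) (psi : F -> F).
Hypotheses (F_graph : is_graph S) (F_finite : is_finite_complex S).
Hypotheses (H_subgraph : is_subcomplex H) (psi_cellular : cellular_on S S H psi).
Hypothesis psi_immersion : immersion (space_of H) psi.
Context (Y : topologicalType) (SY : cell_structure R Y) (f : Y -> mt_space H psi).
Hypotheses (Y_complex : is_2_complex SY).
Hypotheses (f_comb : combinatorial SY (mapping_torus_cells H psi) f).
Hypotheses (f_imm : immersion [set: Y] f) (Y_compact : compact [set: Y]).
Hypotheses (Y_connected : connected [set: Y]).
Hypotheses (Y_collapsed : collapsed SY).
Hypotheses (Y_not_isolated : forall e : cell SY, ~ isolated_edge e).
Let cwY : is_cw_complex SY := Y_complex.1.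

Local Notation chi := (@chi R F S).
Local Notation tau := (tau f_comb).
Local Notation sigv := (sigv F_graph F_finite psi_immersion.1 Y_complex f_comb f_imm Y_compact).
Local Notation sigh := (sigh F_graph F_finite H_subgraph psi_immersion.1 Y_complex f_comb f_imm Y_compact).
Local Notation sigvP := (sigvP F_graph F_finite psi_immersion.1 Y_complex f_imm Y_compact).
Local Notation target := (target F_graph F_finite H_subgraph psi_immersion).
Local Notation theta := (theta F_graph F_finite H_subgraph psi_immersion).
Local Notation passageP := (passageP F_graph F_finite H_subgraph psi_immersion).
Local Notation base := (@mt_base R F (space_of H) psi).
Local Notation lifted := (lifted f_comb).
Local Notation unit_itv := (`[0, 1]%classic : set R).
Local Notation darts := (darts H psi).
Local Notation dartsP := (dartsP F_graph F_finite H_subgraph psi_immersion).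

Definition cells0 : {fset cell SY} := fset_set [set c : cell SY | dim c = 0%N].
Definition cells1v : {fset cell SY} :=
  fset_set [set c : cell SY | dim c = 1%N /\ exists e, tau c = inl e].
Definition cells1h : {fset cell SY} :=
  fset_set [set c : cell SY | dim c = 1%N /\ exists u, tau c = inr u].
Definition cells2 : {fset cell SY} := fset_set [set c : cell SY | dim c = 2%N].

Let fin (P : set (cell SY)) : finite_set P.
Proof.
exact: sub_finite_set (finite_cells F_graph F_finite Y_complex f_comb f_imm Y_compact).
Qed.

Let in_fin (P : set (cell SY)) (c : cell SY) : c \in fset_set P <-> P c.
Proof. by rewrite in_fset_set //; split=> [/set_mem|/mem_set]. Qed.

Let ex_fin (P : set (cell SY)) (c : cell SY) : P c -> exists c' : fset_set P, val c' = c.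
Proof. by move=> /in_fin cP; exists [` cP]%fset. Qed.

Let val_fin (P : set (cell SY)) (c : fset_set P) : P (val c).
Proof. by apply/in_fin; exact: (valP c). Qed.

Let z01 : unit_itv 0. Proof. by apply/unitP; rewrite lexx ler01. Qed.
Let o01 : unit_itv 1. Proof. by apply/unitP; rewrite lexx ler01. Qed.
Let m01 : 0 < (2^-1 : R) < 1. Proof. by apply/andP; split; lra. Qed.
Let mu : unit_itv 2^-1 := unit_half.

Lemma horizontal_vertex (h : cells1h) :
  exists2 u : set_type H, tau (val h) = inr u & dim (set_val u) = 0%N.
Proof.
have [h1 [u hu]] := val_fin h; exists u => //.
by move: h1; rewrite (dim_inr hu) => -[].
Qed.

Lemma two_cell_edge (c : cells2) :
  exists2 d : set_type H, tau (val c) = inr d & dim (set_val d) = 1%N.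
Proof. by apply: two_cell => //; exact: (val_fin c). Qed.

Lemma vertical_edge (a : cells1v) : exists2 e : cell S, tau (val a) = inl e & dim e = 1%N.
Proof. by have [a1 [e ae]] := val_fin a; exists e => //; rewrite -(dim_inl ae). Qed.

Lemma bottom_fun : exists d0 : cells2 -> cells1v, forall c (d : set_type H),
  tau (val c) = inr d -> tau (val (d0 c)) = inl (set_val d) /\
  forall s, unit_itv s -> sigh (val c) (0, s) = sigv (val (d0 c)) s.
Proof.
suff /choice[d0 d0P] : forall c : cells2, exists a : cells1v, forall d : set_type H,
  tau (val c) = inr d -> tau (val a) = inl (set_val d) /\
  forall s, unit_itv s -> sigh (val c) (0, s) = sigv (val a) s by exists d0.
move=> c; have [d cd d1] := two_cell_edge c.
have [a ad aE] := bottom_ex F_graph F_finite H_subgraph psi_immersion.1 Y_complex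
  f_imm Y_compact cd d1.
have [|a' a'E] := @ex_fin [set c : cell SY | dim c = 1%N /\ exists e, tau c = inl e] a.
  by split; [rewrite (dim_inl ad)|exists (set_val d)].
by exists a' => d'; rewrite cd => -[<-]; rewrite a'E.
Qed.

Lemma vertex_ex y x : f y = base x -> vertex S x -> exists v : cells0,
  open_cell (val v) y /\ forall w, open_cell w x -> tau (val v) = inl w.
Proof.
move=> fy vx; have [v [v0 vy vw]] := vertex_over F_graph H_subgraph Y_complex f_comb fy vx.
by have [v' v'E] := @ex_fin [set c : cell SY | dim c = 0%N] v v0; exists v'; rewrite v'E.
Qed.

Lemma horizontal_bottom_fun : exists b0 : cells1h -> cells0, forall h (u : set_type H),
  tau (val h) = inr u -> open_cell (val (b0 h)) (sigh (val h) (0, 0)) /\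
  tau (val (b0 h)) = inl (set_val u).
Proof.
suff /choice[b0 b0P] : forall h : cells1h, exists v : cells0, forall u : set_type H,
  tau (val h) = inr u -> open_cell (val v) (sigh (val h) (0, 0)) /\
  tau (val v) = inl (set_val u) by exists b0.
move=> h; have [u hu u0] := horizontal_vertex h.
have ux : open_cell (set_val u) (chi (set_val u) 0) by exact: chi_vertex.
have [|v [vy vw]] := vertex_ex (sigh_bottom F_graph F_finite H_subgraph psi_immersion
  Y_complex f_imm Y_compact hu z01); first by exists (set_val u).
by exists v => u'; rewrite hu => -[<-]; split => //; exact: vw.
Qed.

Lemma corner_fun : exists oh : cells2 -> bool -> cells1h, forall c i,
  open_cell (val (oh c i)) (sigh (val c) (2^-1, i%:R)).
Proof.
suff /choice[oh ohP] : forall x : cells2 * bool, exists h : cells1h,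
    open_cell (val h) (sigh (val x.1) (2^-1, x.2%:R)).
  by exists (fun c i => oh (c, i)) => c i; exact: ohP.
move=> [c i]; have [d cd d1] := two_cell_edge c.
have [h [u [hu u0 hm _]]] := side_ex F_graph F_finite H_subgraph psi_immersion.1 Y_complex
  f_imm Y_compact i cd.
have [|h' h'E] := @ex_fin [set c : cell SY | dim c = 1%N /\ exists u, tau c = inr u] h.
  by split; [rewrite (dim_inr hu) u0|exists u].
by exists h'; rewrite h'E.
Qed.

Lemma origin_fun : exists o : cells1v * bool -> cells0, forall x,
  open_cell (val (o x)) (sigv (val x.1) x.2%:R).
Proof.
suff /choice[o oP] : forall x : cells1v * bool, exists v : cells0,
  open_cell (val v) (sigv (val x.1) x.2%:R) by exists o.
move=> [a i]; have [e ae e1] := vertical_edge a.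
have [_ vf _ _] := sigvP ae.
have [|v [vy _]] := vertex_ex (vf _ (unit_bool i)); last by exists v.
by have [v0 v1] := chi_end F_graph e; case: (i).
Qed.

Definition top_darts := {x : cells2 * darts | `[< lifted (val x.1) (val x.2) >]}.

Local Notation B := top_darts.
Let bc (b : B) : cell SY := val (val b).1.
Let bl (b : B) : dart S := val (val b).2.

Let blift (b : B) : lifted (bc b) (bl b).
Proof. by apply/asboolP; exact: (valP b). Qed.

Let mkB (c : cell SY) (l : dart S) : lifted c l -> exists b : B, bc b = c /\ bl b = l.
Proof.
move=> cl; have [sl [d cd ed]] := cl.
have c2 : dim c = 2%N by rewrite (dim_inr cd) ed (dsource_dim sl).
have [c' c'E] := @ex_fin [set c : cell SY | dim c = 2%N] c c2.
have lD : l \in darts by apply/(dartsP l).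
have P : `[< lifted (val c') (val [` lD]%fset) >] by apply/asboolP; rewrite c'E.
by exists (exist _ (c', [` lD]%fset) P).
Qed.

Let B_eq (b b' : B) : bc b = bc b' -> bl b = bl b' -> b = b'.
Proof.
move=> h1 h2; apply: val_inj; move: h1 h2; rewrite /bc /bl.
by case: (val b) (val b') => [c l] [c' l'] /= /val_inj -> /val_inj ->.
Qed.

(** The one-point complex is set apart because its vertex starts no dart, so [free_vertex] fails
    there. *)
Lemma discharging_cells (rk : darts -> nat) (K : nat) :
  (forall l l' : darts, step (val l) (val l') -> H (target (val l).1) ->
    H (target (val l').1) -> (rk l < rk l')%N) ->
  (#|{: darts}|.+1 ^ (\max_(l : darts) rk l) * #|{: darts}| <= K)%N ->
  (exists y : Y, [set: Y] = [set y]) \/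
  (#|` cells2| + 2 * K * (#|` cells0| + #|` cells2|) <=
    2 * K * (#|` cells1v| + #|` cells1h|))%N.
Proof.
move=> rkP hK; have [|nsing] := pselect (exists y : Y, [set: Y] = [set y]); first by left.
right; rewrite !cardfE.
have [d0 d0P] := bottom_fun; have [b0 b0P] := horizontal_bottom_fun.
have [oh ohP] := corner_fun; have [o oP] := origin_fun.
have vuniq (v : cells0) y y' : open_cell (val v) y -> open_cell (val v) y' -> y = y'.
  by apply: vertex_cell_unique; exact: (val_fin v).
have veq (v v' : cells0) y : open_cell (val v) y -> open_cell (val v') y -> v = v'.
  by move=> vy vy'; apply: val_inj; exact: (open_cell_inj cwY vy vy').
have /choice[lrev lrevP] : forall l : darts, exists l' : darts, val l' = drev (val l).
  move=> l; have sl : is_segment H psi (val l).1 by apply/(dartsP (val l)); exact: (valP l).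
  have lD : drev (val l) \in darts by apply/(dartsP (drev (val l))).
  by exists [` lD]%fset.
have /choice[rev revP] : forall b : B, exists b' : B, bc b' = bc b /\ bl b' = drev (bl b).
  by move=> b; apply: mkB; exact: blift b.
(* The boolean is the initial value of [theta]: it names the end of the vertical edge at which the
   lifted dart starts. *)
have /choice[td tdP] : forall b : B, exists x : cells1v * bool,
    open_cell (val x.1) (sigh (bc b) (1, smid (bl b).1)) /\
    theta (bl b).1 (dstart (bl b)) = x.2%:R.
  move=> b; have bL := blift b; have [sl _] := bL.
  have [a am] := open_cell_ex cwY (sigh (bc b) (1, smid (bl b).1)).
  have [at_ _] := top_edge bL am.
  have t1 : dim (target (bl b).1) = 1%N.
    by move: sl; case: (bl b) => -[[e x] y] i /= sm; have [] := passageP sm.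
  have [|a' a'E] := @ex_fin [set c : cell SY | dim c = 1%N /\ exists e, tau c = inl e] a.
    by split; [rewrite (dim_inl at_)|exists (target (bl b).1)].
  by case: (theta_start01 F_graph F_finite H_subgraph psi_immersion sl) => th;
    [exists (a', false)|exists (a', true)]; rewrite /= a'E.
have /choice[top topP] : forall b : B, exists v : cells0,
    open_cell (val v) (sigh (bc b) (1, dstart (bl b))).
  move=> b; have [sl [d cd ed]] := blift b; have r01 := dstart_unit sl.
  have [|v [vx _]] := vertex_ex (sigh_top F_graph F_finite H_subgraph psi_immersion
    Y_complex f_imm Y_compact cd r01); last by exists v.
  by have := vertex_dpt sl; rewrite /dpt -ed.
(* The point at half height lies on a horizontal edge if the dart starts at a corner, and inside the
   2-cell if it starts at an inner subdivision point; both kinds of start are thus handled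
   together. *)
pose ow b := sigh (bc b) (2^-1, dstart (bl b)).
have /choice[other otherP] : forall b : B, exists b' : B, ow b' = ow b /\ b' <> b.
  move=> b; have [c' [l' [cl' e ne]]] := other_dart F_graph F_finite H_subgraph psi_cellular
    psi_immersion Y_complex f_imm Y_compact Y_collapsed Y_not_isolated (blift b).
  have [b' [b1 b2]] := mkB cl'; exists b'; split; first by rewrite /ow b1 b2.
  by move=> bb; apply: ne; rewrite -b1 -b2 bb.
have d0_inj : injective d0.
  move=> c c' e; apply: val_inj.
  have [d cd _] := two_cell_edge c; have [d' cd' _] := two_cell_edge c'.
  have [t1 E1] := d0P c d cd; have [t2 E2] := d0P c' d' cd'.
  have dd : d = d' by apply: val_inj; move: t1; rewrite e t2 => -[].
  subst d'; have ss : sigh (val c) (0, 2^-1) = sigh (val c') (0, 2^-1).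
    by rewrite (E1 _ mu) (E2 _ mu) e.
  exact: (sigh_same (p := (0, 2^-1)) cd cd' (conj z01 mu) ss).
have b0_inj : injective b0.
  move=> h h' e; apply: val_inj.
  have [u hu _] := horizontal_vertex h; have [u' hu' _] := horizontal_vertex h'.
  have [p1 t1] := b0P h u hu; have [p2 t2] := b0P h' u' hu'.
  have uu : u = u' by apply: val_inj; move: t1; rewrite e t2 => -[].
  subst u'; have ss : sigh (val h) (0, 0) = sigh (val h') (0, 0).
    by apply: (vuniq (b0 h)) => //; rewrite e.
  exact: (sigh_same (p := (0, 0)) hu hu' (conj z01 z01) ss).
have corner c i : o (d0 c, i) = b0 (oh c i).
  have [d cd d1] := two_cell_edge c; have [_ E] := d0P c d cd.
  have [u hu u0] := horizontal_vertex (oh c i); have [p1 _] := b0P _ u hu.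
  have := oP (d0 c, i); rewrite /= -E; last exact: unit_bool.
  rewrite (sigh_side cd hu u0 (unit_bool i) m01 (ohP c i) z01) => p2.
  exact: veq p2 p1.
have td_top b : o (td b) = top b.
  have bL := blift b; have [sl _] := bL.
  have [am th] := tdP b; have [_ E] := top_edge bL am.
  apply: (veq _ _ _ (oP (td b))); rewrite -th -E; first exact: topP.
  move: sl; case: (bl b) => -[[e x] y] [] [/= _ _ xy _ _]; rewrite /dstart /=;
  by apply/andP; split; lra.
have ow_top b b' : ow b = ow b' -> top b = top b'.
  move=> e; have [_ e1] := lifted_mid (blift b) (blift b') e.
  by apply: (veq _ _ _ (topP b)); rewrite e1; exact: topP.
have td_rev b : (td (rev b)).1 = (td b).1.
  have [am _] := tdP b; have [am' _] := tdP (rev b); have [e1 e2] := revP b.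
  by apply: val_inj; apply: (open_cell_inj cwY am'); rewrite e1 e2.
have rev_inj : injective rev.
  move=> b b' e; have [e1 e2] := revP b; have [e1' e2'] := revP b'.
  apply: B_eq; first by rewrite -e1 -e1' e.
  by rewrite -[LHS]drevK -[RHS]drevK -e2 -e2' e.
have lab_rev b : (val (rev b)).2 = lrev (val b).2.
  by apply: val_inj; rewrite lrevP; have [_] := revP b.
have lab_top_inj b b' : (val b).2 = (val b').2 -> top b = top b' -> b = b'.
  move=> e te; have ll : bl b = bl b' by rewrite /bl e.
  apply: B_eq => //; have bL := blift b; have bL' := blift b'.
  have ss : sigh (bc b) (1, dstart (bl b)) = sigh (bc b') (1, dstart (bl b)).
    by apply: (vuniq (top b)); [exact: topP|rewrite te ll; exact: topP].
  by rewrite -ll in bL'; exact: (lifted_same bL bL' o01 ss).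
(* Equal [ow] gives a common start in [H] and equal [td] a common initial direction of the images,
   so [dart_target_inj] identifies the darts; unique lifting identifies the 2-cells. *)
have td_inj b b' : ow b = ow b' -> td b = td b' -> b = b'.
  move=> e te; have bL := blift b; have bL' := blift b'; have [sl _] := bL; have [sl' _] := bL'.
  have [dd _] := lifted_mid bL bL' e.
  have [am th] := tdP b; have [am' th'] := tdP b'.
  have [tt _] := top_edge bL am; have [tt' _] := top_edge bL' am'.
  have ll : bl b = bl b'.
    apply: (dart_target_inj sl sl' dd).
      by move: tt; rewrite te tt' => -[].
    by rewrite th th' te.
  have ss : sigh (bc b) (2^-1, dstart (bl b)) = sigh (bc b') (2^-1, dstart (bl b)).
    by move: e; rewrite /ow ll.
  by apply: B_eq => //; rewrite -ll in bL'; exact: (lifted_same bL bL' mu ss).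
have bottom_covered c : exists b, (td b).1 = d0 c.
  have [d cd d1] := two_cell_edge c; have [t1 E] := d0P c d cd.
  have [c' [l [cl am]]] := bottom_dart psi_cellular Y_collapsed Y_not_isolated cd d1 t1 E.
  have [b [b1 b2]] := mkB cl; exists b; have [am' _] := tdP b.
  by apply: val_inj; apply: (open_cell_inj cwY am'); rewrite b1 b2.
have free_vertex v : v \notin codom b0 -> exists b, top b = v.
  move=> vb; have [y vy] := open_cell_nonempty (val v).
  have nout h (u : set_type H) : tau h = inr u -> dim (set_val u) = 0%N ->
      sigh h (0, 0) <> y.
    move=> hu u0 ey; move/negP: vb; apply.
    have [|h' h'E] := @ex_fin [set c : cell SY | dim c = 1%N /\ exists u, tau c = inr u] h.
      by split; [rewrite (dim_inr hu) u0|exists u].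
    apply/codomP; exists h'; apply: (veq _ _ _ vy); rewrite -ey -h'E.
    by have [] := b0P h' u; rewrite ?h'E.
  have [[c [l [cl ey]]]|sing] := vertex_reached psi_cellular Y_not_isolated Y_connected
    (val_fin v) vy nout.
    have [b [b1 b2]] := mkB cl; exists b; apply: (veq _ _ _ (topP b)).
    by rewrite b1 b2 ey.
  by exfalso; apply: nsing; exists y.
(* The bottom of a 2-cell lies over an edge of [H]. This puts the darts over bottom edges in the
   part of [H] mapped into [H], where the rank increases. *)
have target_H b : (td b).1 \in codom d0 -> H (target (bl b).1).
  move=> /codomP[c ec]; have [d cd _] := two_cell_edge c; have [t1 _] := d0P c d cd.
  have [am _] := tdP b; have [tt _] := top_edge (blift b) am.
  by move: tt; rewrite ec t1 => -[<-]; exact: H_val.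
have rk_step b b' : (td b).1 \in codom d0 -> (td b').1 \in codom d0 ->
    ow b' = ow (rev b) -> b' <> rev b -> (rk (val b).2 < rk (val b').2)%N.
  move=> hb hb' e ne; apply: rkP; [|exact: target_H|exact: target_H].
  have [dd _] := lifted_mid (blift b') (blift (rev b)) e; have [e1 e2] := revP b.
  apply/asboolP; split; first by rewrite -/(bl b') dd e2.
  move=> le; apply: ne; apply: lab_top_inj; last exact: ow_top.
  by apply: val_inj; rewrite -/(bl b') -/(bl (rev b)) e2.
have ow_other b : ow (other b) = ow b by have [] := otherP b.
have other_neq b : other b <> b by have [] := otherP b.
exact: (discharging d0_inj b0_inj corner td_top ow_top td_rev rev_inj lab_rev lab_top_inj
  td_inj ow_other other_neq bottom_covered free_vertex rk_step hK).
Qed.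

End Inequality.

Lemma trivial_pi1_point (R : realType) (Y : topologicalType) (y : Y) :
  [set: Y] = [set y] -> trivial_pi1 R Y.
Proof.
move=> Y1 g _ _; have pt z : z = y by have : [set: Y] z by []; rewrite Y1.
exists (fun=> g 0); split.
- by apply: continuous_subspaceT => ?; exact: cvg_cst.
- by move=> s _; split => //; rewrite (pt (g 0)) (pt (g s)).
- by [].
Qed.

Lemma ncells1E (R : realType) (F : topologicalType) (S : cell_structure R F)
    (H : set (cell S)) (psi : F -> F) (Y : topologicalType) (SY : cell_structure R Y)
    (f : Y -> mt_space H psi) (f_comb : combinatorial SY (mapping_torus_cells H psi) f) :
  finite_set [set: cell SY] ->
  ncells SY 1 = (#|` cells1v f_comb| + #|` cells1h f_comb|)%N.
Proof.
move=> fin; have fs (P : set (cell SY)) : finite_set P by exact: sub_finite_set fin.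
rewrite /ncells -cardfsUI.
have -> : (cells1v f_comb `&` cells1h f_comb = fset0)%fset.
  apply/fsetP => c; rewrite inE [in RHS]inE; apply/negP => /andP[].
  rewrite !in_fset_set // => /set_mem[_ [e ce]] /set_mem[_ [u cu]].
  by move: cu; rewrite ce.
rewrite cardfs0 addn0; congr #|` _|; apply/fsetP => c.
rewrite inE !in_fset_set //; apply/idP/orP.
  move=> /set_mem c1; case ce : (tau f_comb c) => [e|u]; [left|right];
    by apply/mem_set; split => //; rewrite ce; eexists.
by move=> [/set_mem[c1 _]|/set_mem[c1 _]]; exact/mem_set.
Qed.

Theorem theorem1p1 (R : realType) (F : topologicalType)
    (S : cell_structure R F) (H : set (cell S)) (psi : F -> F)
    (F_graph : is_graph S) (F_finite : is_finite_complex S)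
    (H_subgraph : is_subcomplex H)
    (psi_cellular : cellular_on S S H psi)
    (psi_immersion : immersion (space_of H) psi)
    (psi_forest : exists (T : topologicalType) (ST : cell_structure R T),
       is_forest ST /\
       homeomorphic (set_type (space_of H `&` psi @^-1` space_of H)) T) :
  negative_immersions (mapping_torus_cells H psi).
Proof.
have [rk rkP] := dart_rank F_graph F_finite H_subgraph psi_immersion psi_forest.
pose M := (#|{: darts H psi}|.+1 ^ (\max_l rk l) * #|{: darts H psi}|)%N.
(* The successor keeps [K] positive even if there are no darts. The constant is the inverse of
   [2 * K], since the discharging bounds the number of 2-cells by [- 2 * K] times the Euler
   characteristic. *)
have [K MK K0] : exists2 K, (M <= K)%N & (0 : R) < (2 * K)%:R.
  by exists M.+1; rewrite // ltr0n muln_gt0.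
exists (2 * K)%:R^-1; first by rewrite invr_gt0.
move=> Y SY f Y_complex f_comb f_imm Y_compact Y_connected Y_collapsed Y_isolated.
have [[y Y1]|ineq] := discharging_cells psi_cellular Y_complex f_comb f_imm Y_compact Y_connected
  Y_collapsed Y_isolated rkP MK.
  by left; exact: trivial_pi1_point Y1.
right; have fin := finite_cells F_graph F_finite Y_complex f_comb f_imm Y_compact.
rewrite /euler (ncells1E f_comb fin) /ncells -/(cells0 SY) -/(cells2 SY).
rewrite mulNr lerNr mulrC ler_pdivrMr //.
move: (2 * K)%N K0 ineq => k k0; rewrite -(ler_nat R) natrD !natrM !natrD => ineq.
by rewrite !rmorphD !rmorphN /= -!pmulrn natrD; lra.
Qed.
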